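(* Every symmetry of $\Delta$ is equivalent to a symmetry which, for some integers $d,s$ with $0\le 2s\le d$, has the form $$P=\sum_{\substack{k+l\leq d\\ \min(k,l)=s}}V^{a_{1}\dots a_{k}\bar{b}_{1}\dots\bar{b}_{l}\sigma\dots\sigma}\,\partial_{a_{1}}\cdots\partial_{a_{k}}\partial_{\bar{b}_{1}}\cdots\partial_{\bar{b}_{l}}\partial_{\sigma}\cdots\partial_{\sigma}+\mathrm{LDTS},$$ where each $V^{a_{1}\dots a_{k}\bar{b}_{1}\dots\bar{b}_{l}\sigma\dots\sigma}$ has exactly $d$ indices (so $\sigma$, and correspondingly $\partial_\sigma$, occurs $d-k-l$ times), LDTS denotes terms of degree strictly lower than $(d,s)$, and: (1) each $V^{a_{1}\dots a_{k}\bar{b}_{1}\dots\bar{b}_{l}\sigma\dots\sigma}$ is maximally symmetric (symmetric in $a_1,\dots,a_k$ and in $\bar b_1,\dots,\bar b_l$) and trace-free; (2) $V^{a_{1}\dots a_{s}\bar{b}_{1}\dots\bar{b}_{s}\sigma\dots\sigma}$ is a solution of the first BGG equation of type $(d,s)$, and, for all $k\ge 0$ with $k+2s\le d$, $$V^{a_{1}\dots a_{k+s}\bar{b}_{1}\dots\bar{b}_{s}\sigma\dots\sigma}=\frac{i^{k}}{k!}\,\partial^{(a_{1}}\cdots\partial^{a_{k}}V^{a_{k+1}\dots a_{k+s})\bar{b}_{1}\dots\bar{b}_{s}\sigma\dots\sigma},$$ $$V^{a_{1}\dots a_{s}\bar{b}_{1}\dots\bar{b}_{k+s}\sigma\dots\sigma}=\frac{(-i)^{k}}{k!}\,\partial^{(\bar{b}_{1}}\cdots\partial^{\bar{b}_{k}}V^{\bar{b}_{k+1}\dots\bar{b}_{k+s})a_{1}\dots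 a_{s}\sigma\dots\sigma}.$$
   Context: Setting. Let $g_{\bar a b}$ be a nondegenerate Hermitian form on $\mathbb{C}^n$ of signature $(p,q)$, $p+q=n$, with inverse $g^{a\bar b}$; the Einstein summation convention is used, and $z_a=g_{\bar b a}\bar z^{b}$. Let $$M=\Big\{(z^1,\dots,z^n,z^\infty)\in\mathbb{C}^{n+1}:\ \sum_a z^az_a+z^\infty+\bar z^\infty=0\Big\},$$ a smooth $(2n+1)$-dimensional manifold with coordinates $(z^a,\sigma)$, $z^\infty=-\tfrac12 z^az_a+i\sigma$. On $M$ consider the complex vector fields $\partial_a=\partial_{z^a}-z_a\partial_{z^\infty}$, their conjugates $\partial_{\bar a}$, and $\partial_\sigma=i(\partial_{z^\infty}-\partial_{\bar z^\infty})$. The only nontrivial commutator is $[\partial_{\bar a},\partial_b]=ig_{\bar ab}\partial_\sigma$. Indices on derivatives are raised with $g$: $\partial^{a}=g^{a\bar b}\partial_{\bar b}$, $\partial^{\bar b}=g^{a\bar b}\partial_a$. Round brackets denote symmetrization of the enclosed indices of the same type (barred or unbarred). Sub-Laplacian. Fix $w_1,w_2\in\mathbb{C}$ with $w_1-w_2\in\mathbb{Z}$ and $n+w_1+w_2=0$. Densities of weight $(w_1,w_2)$ and $(w_1-1,w_2-1)$ on $M$ are identified with smooth complex-valued functions on $M$. The CR sub-Laplacian, mapping $(w_1,w_2)$-densities to $(w_1-1,w_2-1)$-densities, is $$\Delta f=\tfrac12 g^{a\bar b}(\partial_a\partial_{\bar b}+\partial_{\bar b}\partial_a)f+i\tfrac{w_1-w_2}{2}\partial_\sigma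 f .$$ Symmetries. A symmetry of $\Delta$ is a linear differential operator $\mathcal D$ for which there is a differential operator $\delta$ with $\delta\Delta=\Delta\mathcal D$. A symmetry is trivial if it is of the form $Q\Delta$ for some linear differential operator $Q$. Two symmetries are equivalent if their difference is a trivial symmetry. Degree. A term $\partial_{a_1}\cdots\partial_{a_k}\partial_{\bar b_1}\cdots\partial_{\bar b_l}\partial_\sigma\cdots\partial_\sigma$ with $m$ factors $\partial_\sigma$ has degree $(d,s)$ with $d=k+l+m$ and $s=\min(k,l)$. Degrees are ordered by: $(d,s)\le(d',s')$ if $d<d'$, or $d=d'$ and $s\ge s'$. Trace-free means that contraction with $g_{\bar b a}$ of any unbarred index with any barred index vanishes. First BGG equation of type $(d,s)$. This corresponds to the first BGG operator for the representation with Dynkin labels $d-2s,s,0,\dots,0,s,d-2s$. A trace-free tensor $V^{a_1\dots a_s\bar b_1\dots\bar b_s\sigma\dots\sigma}$ on $M$, symmetric in the $a$'s and in the $\bar b$'s, is a solution if $$\text{the trace-free part of }\ \partial^{(a_1}\cdots\partial^{a_{d+1-2s}}V^{a_{d+2-2s}\dots a_{d+1-s})\bar b_1\dots\bar b_s\sigma\dots\sigma}\ \text{ is }0,$$ $$\text{the trace-free part of }\ \partial^{(\bar b_1}\cdots\partial^{\bar b_{d+1-2s}}V^{\bar b_{d+2-2s}\dots\bar b_{d+1-s})a_1\dots a_s\sigma\dots\sigma}\ \text{ is }0.$$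
   Formalization: In (2) each V is the trace-free part of the displayed right-hand side, since for s,k≥1 that side need not be trace-free and the literal equality can fail; the leading sum is also required to be nonzero unless the given symmetry is trivial. *)

(* Defs.v *)
From HB Require Import structures.
From mathcomp Require Import all_boot all_order all_algebra all_fingroup.
From mathcomp Require Import all_classical all_reals all_analysis.
From mathcomp Require Export complex.
Set Implicit Arguments.
Unset Strict Implicit.
Unset Printing Implicit Defensive.
Import Order.TTheory GRing.Theory Num.Theory.
Import numFieldNormedType.Exports.
Local Open Scope ring_scope.
Local Open Scope complex_scope.

(* The hypersurface z^a z_a + z^oo + conj z^oo = 0 of C^(n+1) is used in its
   global chart (z, sigma) : C^n x R, where z^oo = - z^a z_a / 2 + i sigma.
   A point is the triple (Re z, Im z, sigma). *)
Definition cr_point (R : realType) (n : nat) : Type :=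
  ('rV[R]_n * 'rV[R]_n * R)%type.

Section Functions.
Context {R : realType} {n : nat}.
Local Notation C := (R[i]).
Local Notation M := ('rV[R]_n * 'rV[R]_n * R)%type.
Implicit Types (f : M -> C) (x : M).

(* A real function is C^oo when all its iterated directional derivatives (of
   any order, order 0 included) are differentiable everywhere. *)
Definition smooth_real (h : M -> R) : Prop :=
  forall (vs : seq M) (x : M),
    differentiable (foldr (fun v (k : M -> R) => 'D_v k) h vs) x.

Definition smooth f : Prop :=
  smooth_real (fun x => complex.Re (f x)) /\
  smooth_real (fun x => complex.Im (f x)).

Definition cderive (v : M) f : M -> C := fun x =>
  ('D_v (fun y => complex.Re (f y)) x) +i* ('D_v (fun y => complex.Im (f y)) x).

Definition zcoord x (a : 'I_n) : C := (x.1.1 0 a) +i* (x.1.2 0 a).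

Definition dRe (a : 'I_n) : M := (delta_mx 0 a, 0, 0).
Definition dIm (a : 'I_n) : M := (0, delta_mx 0 a, 0).

Definition wirtinger (a : 'I_n) f : M -> C := fun x =>
  2%:R^-1 * (cderive (dRe a) f x - 'i * cderive (dIm a) f x).
Definition wirtinger_bar (a : 'I_n) f : M -> C := fun x =>
  2%:R^-1 * (cderive (dRe a) f x + 'i * cderive (dIm a) f x).

Definition dsigma f : M -> C := cderive (0, 0, 1) f.

Variable g : 'M[C]_n.

(* g b a stands for g_{bar b a}; hence invmx g a b stands for g^{a bar b}. *)
Definition zlow x (a : 'I_n) : C := \sum_b g b a * (zcoord x b)^*.

(* The field d/dz^a - z_a d/dz^oo kills z^oo + z^a z_a + conj z^oo; as
   sigma = (z^oo - conj z^oo) / 2i, it sends sigma to - z_a / 2i = i z_a / 2. *)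
Definition dhol (a : 'I_n) f : M -> C := fun x =>
  wirtinger a f x + 'i / 2%:R * zlow x a * dsigma f x.
Definition dbar (a : 'I_n) f : M -> C := fun x =>
  wirtinger_bar a f x - 'i / 2%:R * (zlow x a)^* * dsigma f x.

(* dup a is d^a = g^{a bar b} d_{bar b}; dupbar b is d^{bar b} = g^{a bar b} d_a *)
Definition dup (a : 'I_n) f : M -> C := fun x =>
  \sum_b invmx g a b * dbar b f x.
Definition dupbar (b : 'I_n) f : M -> C := fun x =>
  \sum_a invmx g a b * dhol a f x.

(* d_{a_1} ... d_{a_k} d_{bar b_1} ... d_{bar b_l} d_sigma ^ m *)
Definition monomial (A B : seq 'I_n) (m : nat) f : M -> C :=
  foldr dhol (foldr dbar (iter m dsigma f) B) A.

Inductive frame : Type := Hol of 'I_n | Bar of 'I_n | Sigma.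

Definition dframe (v : frame) : (M -> C) -> M -> C :=
  match v with Hol a => dhol a | Bar a => dbar a | Sigma => dsigma end.

(* Linear differential operators with smooth coefficients. The fields d_a,
   d_{bar a}, d_sigma form a global frame of the complexified tangent bundle,
   so finite sums of smooth multiples of their compositions give them all.
   Operators only matter through their values on smooth functions. *)
Definition diff_op (D : (M -> C) -> M -> C) : Prop :=
  exists (N : nat) (c : 'I_N -> M -> C) (w : 'I_N -> seq frame),
    (forall i, smooth (c i)) /\
    forall f, smooth f -> forall x,
      D f x = \sum_i c i x * foldr dframe f (w i) x.

Definition sublaplacian (w1 w2 : C) f : M -> C := fun x =>
  2%:R^-1 * (\sum_a \sum_b
     invmx g a b * (dhol a (dbar b f) x + dbar b (dhol a f) x))
  + 'i * ((w1 - w2) / 2%:R) * dsigma f x.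

Definition symmetry (w1 w2 : C) (D : (M -> C) -> M -> C) : Prop :=
  diff_op D /\
  exists delta, diff_op delta /\
    forall f, smooth f -> forall x,
      delta (sublaplacian w1 w2 f) x = sublaplacian w1 w2 (D f) x.

Definition trivial_symmetry (w1 w2 : C) (D : (M -> C) -> M -> C) : Prop :=
  exists Q, diff_op Q /\
    forall f, smooth f -> forall x, D f x = Q (sublaplacian w1 w2 f) x.

Definition equivalent (w1 w2 : C) (D P : (M -> C) -> M -> C) : Prop :=
  trivial_symmetry w1 w2 (fun f x => D f x - P f x).

(* Degrees are pairs (d, s); for equal d, a larger s is a lower degree. *)
Definition deg_le (p q : nat * nat) : bool :=
  (p.1 < q.1)%N || ((p.1 == q.1) && (q.2 <= p.2)%N).
Definition deg_lt (p q : nat * nat) : bool := deg_le p q && (p != q).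

Definition monomial_degree (A B : seq 'I_n) (m : nat) : nat * nat :=
  ((size A + size B + m)%N, minn (size A) (size B)).

(* LDTS: a finite sum of terms of degree strictly lower than (d, s) *)
Definition lower_degree_terms (d s : nat) (L : (M -> C) -> M -> C) : Prop :=
  exists (N : nat) (c : 'I_N -> M -> C) (A B : 'I_N -> seq 'I_n)
         (m : 'I_N -> nat),
    (forall i, smooth (c i)) /\
    (forall i, deg_lt (monomial_degree (A i) (B i) (m i)) (d, s)) /\
    forall f, smooth f -> forall x,
      L f x = \sum_i c i x * monomial (A i) (B i) (m i) f x.

(* Tensors at a point: T A B is the component with unbarred upper indices A and
   barred upper indices B; only the sizes k, l of interest are meaningful. *)
Local Notation tensor := (seq 'I_n -> seq 'I_n -> C).

Definition permute (A : seq 'I_n) (p : 'S_(size A)) : seq 'I_n :=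
  [seq tnth (in_tuple A) (p j) | j <- enum 'I_(size A)].

Definition symmetrize (F : seq 'I_n -> C) (A : seq 'I_n) : C :=
  ((size A)`!%:R)^-1 * \sum_(p : 'S_(size A)) F (permute p).

Definition symmetric_tensor (k l : nat) (T : tensor) : Prop :=
  forall A A' B B', size A = k -> size B = l -> perm_eq A A' -> perm_eq B B' ->
    T A B = T A' B'.

Definition trace_free (k l : nat) (T : tensor) : Prop :=
  forall A1 A2 B1 B2 : seq 'I_n,
    (size A1 + size A2).+1 = k -> (size B1 + size B2).+1 = l ->
    \sum_a \sum_b g b a * T (A1 ++ a :: A2) (B1 ++ b :: B2) = 0.

(* g^{(a_1 (bar b_1} phi^{a_2 ... a_k) bar b_2 ... bar b_l)}, which is 0 when
   there is no unbarred or no barred index *)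
Definition pure_trace (phi : tensor) : tensor := fun A B =>
  symmetrize (fun A' => symmetrize (fun B' =>
    match A', B' with
    | a :: A'', b :: B'' => invmx g a b * phi A'' B''
    | _, _ => 0
    end) B) A.

(* T0 is the trace-free part of the symmetric tensor T: the trace-free tensor
   differing from T by a pure trace. Iterated derivatives of trace-free tensors
   are in general not trace-free. *)
Definition trace_free_part_is (k l : nat) (T T0 : tensor) : Prop :=
  symmetric_tensor k l T0 /\ trace_free k l T0 /\
  exists phi : tensor, forall A B, size A = k -> size B = l ->
    T A B = T0 A B + pure_trace phi A B.

(* d^{(a_1} ... d^{a_j} V^{a_{j+1} ... a_k) B} at x, for A = a_1 ... a_k *)
Definition sym_dup (j : nat) (V : seq 'I_n -> seq 'I_n -> M -> C) x : tensor :=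
  fun A B =>
    symmetrize (fun A' => foldr dup (V (drop j A') B) (take j A') x) A.
(* d^{(bar b_1} ... d^{bar b_j} V^{bar b_{j+1} ... bar b_l) A} at x *)
Definition sym_dupbar (j : nat) (V : seq 'I_n -> seq 'I_n -> M -> C) x
  : tensor := fun A B =>
    symmetrize (fun B' => foldr dupbar (V A (drop j B')) (take j B') x) B.

Definition first_BGG_solution (d s : nat) (V : seq 'I_n -> seq 'I_n -> M -> C)
  : Prop :=
  (forall x, symmetric_tensor s s (fun A B => V A B x)) /\
  (forall x, trace_free s s (fun A B => V A B x)) /\
  (forall x, trace_free_part_is (d + 1 - s) s
     (sym_dup (d + 1 - 2 * s) V x) (fun _ _ => 0)) /\
  (forall x, trace_free_part_is s (d + 1 - s)
     (sym_dupbar (d + 1 - 2 * s) V x) (fun _ _ => 0)).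

(* the (k, l) with k + l <= d and min (k, l) = s *)
Definition leading (d s k l : nat) : bool :=
  (k + l <= d)%N && (minn k l == s).

(* The components V^{A bar B sigma ... sigma} with d indices for all (k, l) are
   gathered in a single V, with k = size A and l = size B. *)
Definition leading_part (d s : nat) (V : seq 'I_n -> seq 'I_n -> M -> C) f
  : M -> C := fun x =>
  \sum_(k < d.+1) \sum_(l < d.+1 | leading d s k l)
    \sum_(A : k.-tuple 'I_n) \sum_(B : l.-tuple 'I_n)
      V A B x * monomial A B (d - k - l) f x.

End Functions.

(* Main.v *)
From HB Require Import structures.
Require Import Defs.
From mathcomp Require Import all_boot all_order all_algebra all_fingroup.
From mathcomp Require Import all_classical all_reals all_analysis.
From mathcomp Require Import ring lra zify.
Set Implicit Arguments.
Unset Strict Implicit.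
Unset Printing Implicit Defensive.
Import Order.TTheory GRing.Theory Num.Theory.
Import numFieldNormedType.Exports.
Local Open Scope ring_scope.

(** Let [D] be a symmetry, so that [delta Delta = Delta D]. Then the commutator
    [[Delta, D] = (delta - D) Delta] is divisible by [Delta] on the right, and
    the theorem reads off what this says about its terms of top order.

    Let [d] be the order of [D] and let [V^{A B}], symmetric in [A] and in [B],
    be the coefficients of the terms [d_A d_{bar B} d_sigma^m] with
    [|A| + |B| + m = d]. As [[Delta, d_a] = i d_a d_sigma],
    [[Delta, d_{bar b}] = - i d_{bar b} d_sigma] and [[Delta, d_sigma] = 0], the
    coefficients of [[Delta, D]] of order [d + 1] with [k] unbarred and [l]
    barred indices are the symmetrization of
    [d^a V^{k-1,l} + d^{bar b} V^{k,l-1} + i (k - l) V^{k,l}]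
    (lemma [has_symbol_bracket]), whereas those of a product [Q Delta] are
    [g^{-1}] times the symbol of [Q], hence a pure trace ([has_symbol_lapr]).
    If [V^{k,l} = 0] for [min (k, l) < s], the middle summand is absent for
    [l = s < k], and [V^{k,s} = i / (k - s) d^a V^{k-1,s}] up to a pure trace.
    Iteration from [k = s] gives the formulas of the theorem, and the last
    instance, [k = d + 1 - s], where [V^{k,s}] is absent because only [d] indices
    are available, is the first BGG equation ([iter_sym_up_leading] and its
    mirror image [iter_sym_upbar_leading]).

    Two facts on traces are needed. Multiplication of symmetric tensors by
    [g^{-1}] is injective, so that [Q Delta] has order exactly two more than [Q]
    and the quotient has the order that the argument expects ([lap_divides]);
    and every symmetric tensor is trace-free up to a pure trace. Both follow
    from [tr (g^{-1} q) = (n + k + l) q + g^{-1} tr q], up to normalization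
    ([gtrace_gmul_sum]): equations [alpha q + g^{-1} tr q = T] with [alpha > 0]
    are solved by taking traces, which lowers both ranks.

    Subtracting [Q Delta] from [D] changes the symbol of [D] by a pure trace.
    Hence the part of the symbol with [min (k, l) = s] can be made trace-free;
    if it becomes zero one passes to [s + 1], and once [2 s > d] the order has
    dropped ([symmetry_normal_form]).

    The argument is algebraic and is carried out in a commutative ring with
    derivations satisfying the commutation relations of the frame and with
    coordinate functions. The coordinates serve to prove that an operator has
    only one family of symmetric coefficients ([family_op_eq0]). The last parts
    show that smooth functions on the hypersurface form such a ring, for which
    the equality of mixed directional derivatives is the analytic input
    ([derive_comm]), and translate the tensor operations of the statement. *)

(** * Sums over the letters of a word and over words *)

Section PickSum.
Context {T : Type} {W : nmodType}.
Implicit Types (F : T -> seq T -> W) (A : seq T).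

(** Summing over the positions of a word, rather than over all permutations,
    is the Leibniz rule in its natural form; dividing by the length turns it into
    symmetrization when [F a] is already symmetric. *)
Fixpoint pick_sum F A : W :=
  if A is x :: A' then F x A' + pick_sum (fun a B => F a (x :: B)) A' else 0.

Lemma pick_sum_cons F x A :
  pick_sum F (x :: A) = F x A + pick_sum (fun a B => F a (x :: B)) A.
Proof. by []. Qed.

Lemma eq_pick_sum F G A :
  (forall a B, size A = (size B).+1 -> F a B = G a B) ->
  pick_sum F A = pick_sum G A.
Proof.
elim: A F G => //= x A IH F G FG; congr (_ + _); first exact: FG.
by apply: IH => a B sB; apply: FG; rewrite sB.
Qed.

Lemma pick_sumD F G A :
  pick_sum (fun a B => F a B + G a B) A = pick_sum F A + pick_sum G A.
Proof.
elim: A F G => [|x A IH] F G /=; first by rewrite addr0.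
by rewrite IH addrACA.
Qed.

Lemma pick_sum0 F A :
  (forall a B, size A = (size B).+1 -> F a B = 0) -> pick_sum F A = 0.
Proof.
elim: A F => //= x A IH F F0; rewrite F0 // IH ?addr0 // => a B sB.
by apply: F0; rewrite sB.
Qed.

Lemma pick_sum_sum (I : Type) (r : seq I) (P : pred I) (F : I -> T -> seq T -> W) A :
  pick_sum (fun a B => \sum_(i <- r | P i) F i a B) A =
  \sum_(i <- r | P i) pick_sum (F i) A.
Proof.
elim: A F => [|x A IH] F /=; first by rewrite big1.
by rewrite IH big_split.
Qed.

Lemma pick_sum_exch (F : T -> T -> seq T -> W) A :
  pick_sum (fun a B => pick_sum (fun b D => F a b D) B) A =
  pick_sum (fun b B => pick_sum (fun a D => F a b D) B) A.
Proof.
elim: A F => //= x A IH F; rewrite !pick_sumD IH !addrA; congr (_ + _).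
exact: addrC.
Qed.

End PickSum.

Lemma pick_sum_pick_sum (T U : Type) (W : nmodType)
  (F : T -> seq T -> U -> seq U -> W) A B :
  pick_sum (fun a A' => pick_sum (F a A') B) A =
  pick_sum (fun b B' => pick_sum (fun a A' => F a A' b B') A) B.
Proof.
elim: A F => [|x A IH] F /=; first by rewrite pick_sum0.
by rewrite IH pick_sumD.
Qed.

Lemma raddf_pick_sum (T : Type) (W W' : nmodType) (h : {additive W -> W'})
    (F : T -> seq T -> W) A :
  h (pick_sum F A) = pick_sum (fun a B => h (F a B)) A.
Proof.
by elim: A F => [|x A IH] F /=; rewrite ?raddf0 // raddfD /= IH.
Qed.

Lemma pick_sum_mull (T : Type) (W : pzRingType) (c : W) (F : T -> seq T -> W) A :
  pick_sum (fun a B => c * F a B) A = c * pick_sum F A.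
Proof. by elim: A F => [|x A IH] F /=; rewrite ?mulr0 // mulrDr IH. Qed.

Lemma perm_swap_head (T : eqType) (a b : T) A : perm_eq (a :: b :: A) (b :: a :: A).
Proof. by apply/permPl; exact: (perm_catCA [:: a] [:: b] A). Qed.

Section PickSumPerm.
Context {T : eqType} {W : nmodType}.
Implicit Types (F : T -> seq T -> W) (A : seq T).

Definition word_symmetric (Z : Type) (F : seq T -> Z) :=
  forall A B, perm_eq A B -> F A = F B.

Lemma pick_sum_sym_const (F : seq T -> W) A : word_symmetric F ->
  pick_sum (fun a B => F (a :: B)) A = F A *+ size A.
Proof.
elim: A F => //= x A IH F sF; rewrite mulrS; congr (_ + _).
rewrite (@eq_pick_sum _ _ _ (fun a B => (F \o cons x) (a :: B))); last first.
  by move=> a B _ /=; apply/sF/perm_swap_head.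
by rewrite (IH (F \o cons x)) // => B D BD; apply: sF; rewrite perm_cons.
Qed.

End PickSumPerm.

(** For symmetric [F a] only the multiset of letters matters, which makes the
    invariance of [pick_sum F] under permutations visible. *)
Lemma pick_sum_count (T : finType) (W : nmodType) (F : T -> seq T -> W) A :
  (forall a, word_symmetric (F a)) ->
  pick_sum F A = \sum_a F a (rem a A) *+ count_mem a A.
Proof.
elim: A F => [|x A IH] F sF /=; first by rewrite big1.
rewrite IH; last first.
  by move=> a B D BD; apply: sF; rewrite perm_cons.
rewrite [RHS](bigD1 x) //= eqxx mulrnDr mulr1n -addrA; congr (_ + _).
rewrite (bigD1 x) //=; congr (_ + _).
  have [xA|xA] := boolP (x \in A); last by rewrite (count_memPn xA).
  by congr (_ *+ _); apply: sF; rewrite perm_sym perm_to_rem.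
by apply: eq_bigr => a ax; rewrite eq_sym (negbTE ax) add0n.
Qed.

Lemma pick_sum_sym (T : finType) (W : nmodType) (F : T -> seq T -> W) :
  (forall a, word_symmetric (F a)) -> word_symmetric (pick_sum F).
Proof.
move=> sF A B AB; rewrite !pick_sum_count //; apply: eq_bigr => a _.
rewrite (seq.permP AB); congr (_ *+ _); apply: sF.
have [aA|aA] := boolP (a \in A).
  rewrite -(perm_cons a) -(permPl (perm_to_rem aA)) (permPl AB).
  by rewrite perm_to_rem // -(perm_mem AB).
by rewrite !rem_id // -(perm_mem AB).
Qed.

Section WordSum.
Context {I : finType} {W : nmodType}.
Implicit Types (F : seq I -> W).

(** Words of all lengths below [L] are summed at once, so that the length need
    not be carried along as an index of the coefficients. *)
Fixpoint word_sum (L : nat) F : W :=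
  if L is L'.+1 then F [::] + \sum_a word_sum L' (fun A => F (a :: A)) else 0.

Lemma eq_word_sum L F G :
  (forall A, (size A < L)%N -> F A = G A) -> word_sum L F = word_sum L G.
Proof.
elim: L F G => //= L IH F G FG; rewrite FG //; congr (_ + _).
by apply: eq_bigr => a _; apply: IH => A sA; apply: FG.
Qed.

Lemma word_sum0 L F : (forall A, (size A < L)%N -> F A = 0) -> word_sum L F = 0.
Proof.
elim: L F => //= L IH F F0; rewrite F0 // big1 ?addr0 // => a _.
by apply: IH => A sA; apply: F0.
Qed.

Lemma word_sumD L F G :
  word_sum L (fun A => F A + G A) = word_sum L F + word_sum L G.
Proof.
elim: L F G => [|L IH] F G /=; first by rewrite addr0.
rewrite addrACA -big_split; congr (_ + _).
by apply: eq_bigr => a _; rewrite IH.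
Qed.

Lemma word_sum_sum (J : Type) (r : seq J) (P : pred J) L (F : J -> seq I -> W) :
  word_sum L (fun A => \sum_(i <- r | P i) F i A) =
  \sum_(i <- r | P i) word_sum L (F i).
Proof.
elim: L F => [|L IH] F /=; first by rewrite big1.
rewrite big_split [in RHS]exchange_big /=; congr (_ + _).
by apply: eq_bigr => a _; rewrite IH.
Qed.

Lemma word_sum_widen L L' F : (L <= L')%N ->
  (forall A, (L <= size A)%N -> F A = 0) -> word_sum L F = word_sum L' F.
Proof.
elim: L L' F => [|L IH] [|L'] F // LL' F0.
  by rewrite [RHS]word_sum0 // => A _; apply: F0.
rewrite /=; congr (_ + _); apply: eq_bigr => a _.
by apply: IH => // A sA; apply: F0.
Qed.

Lemma word_sum_nil L F : (forall a A, F (a :: A) = 0) -> word_sum L.+1 F = F [::].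
Proof.
move=> F0 /=; rewrite big1 ?addr0 // => a _.
by apply: word_sum0 => A _; apply: F0.
Qed.

Lemma word_sum_tuple L F :
  word_sum L F = \sum_(k < L) \sum_(A : k.-tuple I) F A.
Proof.
elim: L F => [|L IH] F; first by rewrite big_ord0.
rewrite big_ord_recl /=; congr (_ + _).
  rewrite (bigD1 [tuple]) //= big1 ?addr0 // => A.
  by move/eqP; rewrite [A]tuple0.
under eq_bigr => a _ do rewrite IH.
rewrite exchange_big /=; apply: eq_bigr => k _.
rewrite pair_big /=.
rewrite (reindex (fun A : k.+1.-tuple I => (thead A, [tuple of behead A]))) /=.
  by apply: eq_bigr => A _; rewrite [in RHS](tuple_eta A).
exists (fun p : I * k.-tuple I => [tuple of p.1 :: p.2]) => [A _|[a A] _] /=.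
  by rewrite [RHS]tuple_eta.
by rewrite theadE; congr (_, _); apply: val_inj.
Qed.

End WordSum.

Lemma word_sum_word_sum (I J : finType) (W : nmodType) L L' (F : seq I -> seq J -> W) :
  word_sum L (fun A => word_sum L' (F A)) =
  word_sum L' (fun B => word_sum L (F^~ B)).
Proof.
elim: L F => [|L IH] F /=; first by rewrite [RHS]word_sum0.
rewrite word_sumD word_sum_sum; congr (_ + _).
by apply: eq_bigr => a _; rewrite (IH (fun A => F (a :: A))).
Qed.

Lemma raddf_word_sum (I : finType) (W W' : nmodType) (h : {additive W -> W'})
    L (F : seq I -> W) :
  h (word_sum L F) = word_sum L (fun A => h (F A)).
Proof.
elim: L F => [|L IH] F /=; rewrite ?raddf0 // raddfD raddf_sum.
by congr (_ + _); apply: eq_bigr => a _; rewrite IH.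
Qed.

Lemma word_sum_mull (I : finType) (W : pzRingType) (c : W) L (F : seq I -> W) :
  word_sum L (fun A => c * F A) = c * word_sum L F.
Proof.
elim: L F => [|L IH] F /=; first by rewrite mulr0.
rewrite mulrDr mulr_sumr; congr (_ + _).
by apply: eq_bigr => a _; rewrite (IH (fun A => F (a :: A))).
Qed.

(** Summation by parts for words: distributing the first letter of [a :: A] over
    all positions gives every word of length [k] exactly [k] times, as long as the
    other factor does not see the order of the letters. *)
Lemma word_sum_pick_sum (I : finType) (W : pzRingType) L
    (F : I -> seq I -> W) (m : seq I -> W) : word_symmetric m ->
  word_sum L.+1 (fun A => pick_sum F A * m A) =
  \sum_a word_sum L (fun A => (F a A * m (a :: A)) *+ (size A).+1).
Proof.
elim: L F m => [|L IH] F m sm.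
  by rewrite /= mul0r !big1 ?addr0.
have -> : word_sum L.+2 (fun A => pick_sum F A * m A) =
  \sum_x word_sum L.+1 (fun A =>
     F x A * m (x :: A) + pick_sum (fun a B => F a (x :: B)) A * m (x :: A)).
  rewrite [LHS]/= mul0r add0r; apply: eq_bigr => x _ /=; rewrite !mulrDl.
  by congr (_ + _); apply: eq_bigr => b _; apply: eq_word_sum => A _; rewrite !mulrDl.
under eq_bigr => x _ do rewrite word_sumD.
rewrite big_split /=.
have sc x : word_symmetric (fun A => m (x :: A)).
  by move=> A B AB; apply: sm; rewrite perm_cons.
have -> : \sum_(i : I) word_sum L.+1
    (fun A : seq I => pick_sum (fun a B => F a (i :: B)) A * m (i :: A)) =
   \sum_a word_sum L.+1 (fun A => (F a A * m (a :: A)) *+ size A).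
  under eq_bigr => x _ do rewrite (IH (fun a B => F a (x :: B)) (fun A => m (x :: A))) //.
  rewrite exchange_big; apply: eq_bigr => a _ /=; rewrite mulr0n add0r.
  apply: eq_bigr => x _; apply: eq_word_sum => A _; congr (_ * _ *+ _).
  by exact/sm/perm_swap_head.
have E : forall x, F x [::] * m [:: x] +
    \sum_a word_sum L (fun A => F x (a :: A) * m [:: x, a & A]) =
    word_sum L.+1 (fun A => F x A * m (x :: A)) by [].
under eq_bigr => x _ do rewrite E.
rewrite -big_split; apply: eq_bigr => a _ /=.
rewrite mulr0n mulr1n add0r -addrA -big_split; congr (_ + _).
by apply: eq_bigr => b _ /=; rewrite -word_sumD; apply: eq_word_sum => A _; rewrite -mulrS.
Qed.

Lemma foldr_perm (T : eqType) (U : Type) (h : T -> U -> U) (u : U) A B :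
  (forall a b v, h a (h b v) = h b (h a v)) -> perm_eq A B ->
  foldr h u A = foldr h u B.
Proof.
move=> hC; elim: A B => [|x A IH] B AB.
  by move: AB; rewrite perm_sym => /perm_nilP ->.
have xB : x \in B by rewrite -(perm_mem AB) mem_head.
case/splitPr: xB AB => B1 B2; rewrite perm_sym perm_catC /= perm_cons perm_catC => AB.
rewrite /= (IH (B1 ++ B2)); last by rewrite perm_sym.
rewrite !foldr_cat /=; elim: B1 {AB} => //= y B1 <-; exact: hC.
Qed.

(** * The frame and the sub-Laplacian over a commutative ring *)

(** The ring [S] stands for the smooth functions, [kap] for the inclusion of the
    constants, and [X], [Y], [Z] for the fields [d_a], [d_{bar b}], [d_sigma]. *)
Section Calculus.
Context {C : numFieldType} {S : comPzRingType} (kap : {rmorphism C -> S}).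
Context {n : nat} (g : 'M[C]_n) (ii : C).
Hypothesis g_unit : g \in unitmx.
Hypothesis ii2 : ii * ii = -1.

Context (X Y : 'I_n -> {additive S -> S}) (Z : {additive S -> S}).
Hypothesis X_mul : forall a (f h : S), X a (f * h) = X a f * h + f * X a h.
Hypothesis Y_mul : forall a (f h : S), Y a (f * h) = Y a f * h + f * Y a h.
Hypothesis Z_mul : forall f h : S, Z (f * h) = Z f * h + f * Z h.
Hypothesis X_cst : forall a c, X a (kap c) = 0.
Hypothesis Y_cst : forall a c, Y a (kap c) = 0.
Hypothesis Z_cst : forall c, Z (kap c) = 0.
Hypothesis XX : forall a b f, X a (X b f) = X b (X a f).
Hypothesis YY : forall a b f, Y a (Y b f) = Y b (Y a f).
Hypothesis ZX : forall a f, Z (X a f) = X a (Z f).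
Hypothesis ZY : forall a f, Z (Y a f) = Y a (Z f).
Hypothesis YX : forall a b f,
  Y b (X a f) = X a (Y b f) + kap (ii * g b a) * Z f.

Let Xc a c f : X a (kap c * f) = kap c * X a f.
Proof. by rewrite X_mul X_cst mul0r add0r. Qed.
Let Yc a c f : Y a (kap c * f) = kap c * Y a f.
Proof. by rewrite Y_mul Y_cst mul0r add0r. Qed.
Let Zc c f : Z (kap c * f) = kap c * Z f.
Proof. by rewrite Z_mul Z_cst mul0r add0r. Qed.

Notation ginv := (invmx g).

Lemma ginv_g a c : \sum_b ginv a b * g b c = (a == c)%:R.
Proof. by have /matrixP/(_ a c) := mulVmx g_unit; rewrite !mxE. Qed.

Lemma g_ginv a c : \sum_b g a b * ginv b c = (a == c)%:R.
Proof. by have /matrixP/(_ a c) := mulmxV g_unit; rewrite !mxE. Qed.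

Lemma sum_delta_l (W : pzRingType) a (F : 'I_n -> W) : \sum_b (b == a)%:R * F b = F a.
Proof.
rewrite (bigD1 a) //= eqxx mul1r big1 ?addr0 // => b /negbTE ->.
by rewrite mul0r.
Qed.

Lemma sum_delta_r (W : pzRingType) a (F : 'I_n -> W) : \sum_b (a == b)%:R * F b = F a.
Proof. by under eq_bigr => b _ do rewrite eq_sym; rewrite sum_delta_l. Qed.

(** The order of the factors is that of normal ordering: unbarred fields to the
    left, [Z] innermost. *)
Definition mon (A B : seq 'I_n) (m : nat) (f : S) : S :=
  foldr X (foldr Y (iter m Z f) B) A.

Arguments mon : simpl never.

Lemma mon_perm A A' B B' m f : perm_eq A A' -> perm_eq B B' ->
  mon A B m f = mon A' B' m f.
Proof.
move=> AA' BB'; rewrite /mon (foldr_perm _ _ BB'); last exact: YY.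
by apply: (foldr_perm _ _ AA'); exact: XX.
Qed.

Lemma foldr_is_additive (h : 'I_n -> {additive S -> S}) A :
  zmod_morphism (fun f => foldr h f A).
Proof. by move=> u v; elim: A => //= a A ->; rewrite raddfB. Qed.

Lemma iterZ_is_additive m : zmod_morphism (fun f => iter m Z f).
Proof. by move=> u v; elim: m => //= m ->; rewrite raddfB. Qed.

Lemma mon_is_additive A B m : zmod_morphism (mon A B m).
Proof. by move=> u v; rewrite /mon iterZ_is_additive !foldr_is_additive. Qed.
HB.instance Definition _ A B m :=
  GRing.isZmodMorphism.Build S S (mon A B m) (@mon_is_additive A B m).

Lemma foldr_cst (h : 'I_n -> {additive S -> S}) A c f :
  (forall a c f, h a (kap c * f) = kap c * h a f) ->
  foldr h (kap c * f) A = kap c * foldr h f A.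
Proof. by move=> hc; elim: A => //= a A ->; rewrite hc. Qed.

Lemma mon_cst A B m c f : mon A B m (kap c * f) = kap c * mon A B m f.
Proof.
have -> : mon A B m (kap c * f) = foldr X (foldr Y (kap c * iter m Z f) B) A.
  by congr foldr; congr foldr; elim: m => //= m ->; rewrite Zc.
by rewrite !foldr_cst.
Qed.

Lemma Z_foldr (h : 'I_n -> {additive S -> S}) A f :
  (forall a f, Z (h a f) = h a (Z f)) -> Z (foldr h f A) = foldr h (Z f) A.
Proof. by move=> hC; elim: A => //= a A IH; rewrite hC IH. Qed.

Lemma Z_mon A B m f : Z (mon A B m f) = mon A B m.+1 f.
Proof. by rewrite /mon !Z_foldr. Qed.

Lemma mon_Z A B m f : mon A B m (Z f) = mon A B m.+1 f.
Proof. by rewrite /mon -iterSr. Qed.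

Lemma mon_Y A B m b f : mon A B m (Y b f) = mon A (b :: B) m f.
Proof.
rewrite /mon; congr foldr => /=.
have -> : iter m Z (Y b f) = Y b (iter m Z f) by elim: m => //= m ->; rewrite ZY.
by elim: B => //= c B ->; rewrite YY.
Qed.

(** Moving [Y b] across the unbarred fields creates one [Z] for each of them, so
    the correction terms have order one less. *)
Lemma Y_mon A B m b f : Y b (mon A B m f) =
  mon A (b :: B) m f + pick_sum (fun a A' => kap (ii * g b a) * mon A' B m.+1 f) A.
Proof.
elim: A => [|a A IH]; first by rewrite /= addr0.
rewrite pick_sum_cons -[mon (a :: A) B m f]/(X a (mon A B m f)) YX IH Z_mon.
rewrite raddfD /= raddf_pick_sum addrAC addrA; congr (_ + _).
by apply: eq_pick_sum => c A' _; rewrite Xc.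
Qed.

Lemma mon_X A B m a f : mon A B m (X a f) =
  mon (a :: A) B m f + pick_sum (fun b B' => kap (ii * g b a) * mon A B' m.+1 f) B.
Proof.
elim: A => [|x A IH].
  elim: B => [|b B IH].
    by rewrite /= addr0 /mon /=; elim: m => //= m ->; rewrite ZX.
  rewrite pick_sum_cons -[mon [::] (b :: B) m (X a f)]/(Y b (mon [::] B m (X a f))).
  rewrite IH raddfD /= -[mon [:: a] B m f]/(X a (mon [::] B m f)) YX Z_mon.
  rewrite raddf_pick_sum -!addrA; congr (_ + (_ + _)).
  by apply: eq_pick_sum => c B' _; rewrite Yc.
rewrite -[mon (x :: A) B m (X a f)]/(X x (mon A B m (X a f))) IH raddfD /=.
rewrite -[mon (a :: A) B m f]/(X a (mon A B m f)) XX raddf_pick_sum; congr (_ + _).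
by apply: eq_pick_sum => c B' _; rewrite Xc.
Qed.

(* The coefficient of Z is arbitrary: putting the sub-Laplacian in normal order
   changes it, and so do the weights, but it only affects lower order terms. *)
Context (k0 : C).
Definition lap (f : S) : S :=
  \sum_a \sum_b kap (ginv a b) * X a (Y b f) + kap k0 * Z f.

Lemma lap_is_additive : zmod_morphism lap.
Proof.
move=> u v; rewrite /lap opprD addrACA -sumrB raddfB mulrBr; congr (_ + _).
apply: eq_bigr => a _; rewrite -sumrB; apply: eq_bigr => b _.
by rewrite !raddfB mulrBr.
Qed.
HB.instance Definition _ := GRing.isZmodMorphism.Build S S lap lap_is_additive.

Lemma lap_Z f : lap (Z f) = Z (lap f).
Proof.
rewrite /lap raddfD raddf_sum /= Zc; congr (_ + _).
apply: eq_bigr => a _; rewrite raddf_sum; apply: eq_bigr => b _.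
by rewrite /= Zc ZX ZY.
Qed.

(** The two traces over the metric collapse, which leaves a scalar multiple of
    [X c] itself: this is the source of the term [i (k - l)] below. *)
Lemma lap_X c f : lap (X c f) = X c (lap f) + kap ii * X c (Z f).
Proof.
rewrite /lap raddfD raddf_sum /= Xc ZX addrAC; congr (_ + _).
transitivity (\sum_a (X c (\sum_b kap (ginv a b) * X a (Y b f)) +
   kap (ii * (a == c)%:R) * X a (Z f))).
  apply: eq_bigr => a _.
  rewrite raddf_sum /= -(ginv_g a c) mulr_sumr raddf_sum mulr_suml -big_split.
  apply: eq_bigr => b _ /=; rewrite Xc YX raddfD /= Xc XX mulrDr; congr (_ + _).
  by rewrite mulrA -rmorphM mulrCA.
rewrite big_split; congr (_ + _) => /=.
under eq_bigr => a _ do rewrite rmorphM rmorph_nat mulrAC mulrC.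
by rewrite sum_delta_l.
Qed.

Lemma lap_Y c f : lap (Y c f) = Y c (lap f) - kap ii * Y c (Z f).
Proof.
rewrite /lap raddfD raddf_sum /= Yc ZY addrAC; congr (_ + _).
transitivity (\sum_b (Y c (\sum_a kap (ginv a b) * X a (Y b f)) -
   kap (ii * (c == b)%:R) * Y b (Z f))).
  rewrite exchange_big; apply: eq_bigr => b _.
  rewrite raddf_sum /= -(g_ginv c b) mulr_sumr raddf_sum mulr_suml -sumrB.
  apply: eq_bigr => a _ /=; rewrite Yc YX YY ZY mulrDr.
  by rewrite !rmorphM; ring.
rewrite sumrB; congr (_ - _) => /=.
  by rewrite -[LHS](raddf_sum (Y c)) -[RHS](raddf_sum (Y c)) exchange_big.
under eq_bigr => a _ do rewrite rmorphM rmorph_nat mulrAC mulrC.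
by rewrite sum_delta_r.
Qed.

(** No correction terms arise here, since [lap_X] and [lap_Y] only produce [Z],
    which is central. *)
Lemma lap_mon A B m f : lap (mon A B m f) = mon A B m (lap f) +
  kap (ii * ((size A)%:R - (size B)%:R)) * mon A B m.+1 f.
Proof.
elim: A => [|a A IH].
  elim: B => [|b B IH].
    rewrite /= subrr mulr0 rmorph0 mul0r addr0 /mon /=.
    by elim: m => //= m <-; rewrite lap_Z.
  have E f' m' : mon [::] (b :: B) m' f' = Y b (mon [::] B m' f') by [].
  rewrite !E lap_Y IH raddfD /= Yc Z_mon -addrA; congr (_ + _).
  by rewrite -mulrBl -rmorphB; congr (kap _ * _); rewrite /=; ring.
have E f' m' : mon (a :: A) B m' f' = X a (mon A B m' f') by [].
rewrite !E lap_X IH raddfD /= Xc Z_mon -addrA; congr (_ + _).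
by rewrite -mulrDl -rmorphD; congr (kap _ * _); rewrite /=; ring.
Qed.

(* What is left of the product of a monomial with the sub-Laplacian after removing
   the terms with two more indices. *)
Definition mon_lap_err A B m f :=
  \sum_a \sum_b kap (ginv a b) *
     pick_sum (fun b' B' => kap (ii * g b' a) * mon A (b :: B') m.+1 f) B +
  kap k0 * mon A B m.+1 f.

Lemma mon_lap A B m f : mon A B m (lap f) =
  \sum_a \sum_b kap (ginv a b) * mon (a :: A) (b :: B) m f + mon_lap_err A B m f.
Proof.
rewrite /lap raddfD raddf_sum /= mon_cst mon_Z /mon_lap_err addrA; congr (_ + _).
rewrite -big_split; apply: eq_bigr => a _ /=.
rewrite raddf_sum -big_split; apply: eq_bigr => b _ /=.
rewrite mon_cst mon_X mon_Y mulrDr; congr (_ + _ * _).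
by apply: eq_pick_sum => b' B' _; rewrite mon_Y.
Qed.

Lemma lap_mul c f : lap (c * f) = lap c * f + c * lap f +
  \sum_b (\sum_a kap (ginv a b) * X a c) * Y b f +
  \sum_a (\sum_b kap (ginv a b) * Y b c) * X a f.
Proof.
rewrite /lap Z_mul.
transitivity (\sum_a \sum_b (
   kap (ginv a b) * X a (Y b c) * f + c * (kap (ginv a b) * X a (Y b f)) +
   kap (ginv a b) * X a c * Y b f + kap (ginv a b) * Y b c * X a f) +
   (kap k0 * Z c * f + c * (kap k0 * Z f))).
  congr (_ + _); last by ring.
  apply: eq_bigr => a _; apply: eq_bigr => b _.
  by rewrite Y_mul raddfD /= !X_mul; ring.
have split4 (F1 F2 F3 F4 : 'I_n -> 'I_n -> S) :
   \sum_a \sum_b (F1 a b + F2 a b + F3 a b + F4 a b) =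
   \sum_a \sum_b F1 a b + \sum_a \sum_b F2 a b + \sum_a \sum_b F3 a b +
   \sum_a \sum_b F4 a b.
  rewrite -!big_split; apply: eq_bigr => a _.
  by rewrite -!big_split.
have E3 : \sum_a \sum_b kap (ginv a b) * X a c * Y b f =
    \sum_b (\sum_a kap (ginv a b) * X a c) * Y b f.
  by rewrite exchange_big; apply: eq_bigr => b _; rewrite mulr_suml.
have E4 : \sum_a \sum_b kap (ginv a b) * Y b c * X a f =
    \sum_a (\sum_b kap (ginv a b) * Y b c) * X a f.
  by apply: eq_bigr => b _; rewrite mulr_suml.
rewrite split4 E3 E4.
rewrite mulrDl mulrDr mulr_suml mulr_sumr.
have -> : \sum_i (\sum_b kap (ginv i b) * X i (Y b c)) * f =
  \sum_a \sum_b kap (ginv a b) * X a (Y b c) * f.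
  by apply: eq_bigr => a _; rewrite mulr_suml.
have -> : \sum_i c * (\sum_b kap (ginv i b) * X i (Y b f)) =
  \sum_a \sum_b c * (kap (ginv a b) * X a (Y b f)).
  by apply: eq_bigr => a _; rewrite mulr_sumr.
by ring.
Qed.


(** * Order of differential operators *)

Definition mon_index : Type := (seq 'I_n * seq 'I_n * nat)%type.
Definition index_order (t : mon_index) : nat := (size t.1.1 + size t.1.2 + t.2)%N.
Definition term_op (t : S * mon_index) (f : S) : S :=
  t.1 * mon t.2.1.1 t.2.1.2 t.2.2 f.

(** Restricting the indices of the monomials by a predicate covers both operators
    of bounded order and the lower degree terms of the theorem. *)
Definition spanned (p : pred mon_index) (D : S -> S) : Prop :=
  exists s : seq (S * mon_index), all (fun t => p t.2) s /\
    forall f, D f = \sum_(t <- s) term_op t f.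

Definition order_below (N : nat) : pred mon_index := fun t => (index_order t < N)%N.
(* A strict bound, so that the zero operator is the one of order below 0. *)
Notation order_lt N := (spanned (order_below N)).

Lemma spanned_ext p D D' : (forall f, D f = D' f) -> spanned p D -> spanned p D'.
Proof. by move=> E [s [sN Ds]]; exists s; split=> // f; rewrite -E. Qed.

Lemma spanned0 p : spanned p (fun _ => 0).
Proof. by exists [::]; split=> // f; rewrite big_nil. Qed.

Lemma spannedD p D D' : spanned p D -> spanned p D' ->
  spanned p (fun f => D f + D' f).
Proof.
move=> [s [sN Ds]] [s' [s'N Ds']]; exists (s ++ s'); rewrite all_cat sN s'N.
by split=> // f; rewrite big_cat Ds Ds'.
Qed.

Lemma spannedM p c D : spanned p D -> spanned p (fun f => c * D f).
Proof.
move=> [s [sN Ds]]; exists [seq (c * t.1, t.2) | t <- s]; rewrite all_map.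
split=> [|f]; first exact: sN.
rewrite Ds mulr_sumr big_map; apply: eq_bigr => t _.
by rewrite /term_op /= mulrA.
Qed.

Lemma spannedB p D D' : spanned p D -> spanned p D' ->
  spanned p (fun f => D f - D' f).
Proof.
move=> HD HD'; apply: (spanned_ext (D := fun f => D f + (-1) * D' f)).
  by move=> f; rewrite mulN1r.
by apply: spannedD => //; apply: spannedM.
Qed.

Lemma spanned_sum (J : Type) (r : seq J) p (D : J -> S -> S) :
  (forall i, spanned p (D i)) -> spanned p (fun f => \sum_(i <- r) D i f).
Proof.
move=> HD; elim: r => [|i r IH].
  by apply: spanned_ext (spanned0 p) => f; rewrite big_nil.
by apply: spanned_ext (spannedD (HD i) IH) => f; rewrite big_cons.
Qed.

Lemma spanned_pick_sum (T : Type) A p (F : T -> seq T -> S -> S) :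
  (forall a B, size A = (size B).+1 -> spanned p (F a B)) ->
  spanned p (fun f => pick_sum (fun a B => F a B f) A).
Proof.
elim: A F => [|x A IH] F HF /=; first exact: spanned0.
apply: spannedD; first exact: HF.
by apply: (IH (fun a B => F a (x :: B))) => a B sB; apply: HF; rewrite /= sB.
Qed.

Lemma spanned_word_sum (I : finType) L p (F : seq I -> S -> S) :
  (forall A, spanned p (F A)) -> spanned p (fun f => word_sum L (F^~ f)).
Proof.
elim: L F => [|L IH] F HF /=; first exact: spanned0.
apply: spannedD; first exact: HF.
by apply: spanned_sum => a; apply: (IH (fun A => F (a :: A))).
Qed.

Lemma spannedW p p' D : subpred p p' -> spanned p D -> spanned p' D.
Proof.
move=> pp' [s [sN Ds]]; exists s; split=> //.
by apply: sub_all sN => t; apply: pp'.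
Qed.

Lemma spanned_term (p : pred mon_index) c A B m : p (A, B, m) ->
  spanned p (fun f => c * mon A B m f).
Proof.
by move=> sN; exists [:: (c, (A, B, m))]; rewrite /= sN; split=> // f; rewrite big_seq1.
Qed.

Lemma order_ltW N N' D : (N <= N')%N -> order_lt N D -> order_lt N' D.
Proof. by move=> NN'; apply: spannedW => t /leq_trans; apply. Qed.

Lemma order_lt_term N c A B m : (size A + size B + m < N)%N ->
  order_lt N (fun f => c * mon A B m f).
Proof. exact: spanned_term. Qed.

Lemma order_lt_mon N A B m : (size A + size B + m < N)%N -> order_lt N (mon A B m).
Proof.
move=> sN; apply: spanned_ext (order_lt_term 1 sN) => f.
by rewrite mul1r.
Qed.

(** Closure of bounded order under an operation is checked on single terms
    [c * M], provided that the operation is additive. *)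
Lemma order_lt_lift (N N' : nat) (T : S -> (S -> S) -> S -> S) (D : S -> S) :
  order_lt N D ->
  forall D', (forall s : seq (S * mon_index), (forall f, D f = \sum_(t <- s) term_op t f) ->
     forall f, D' f = \sum_(t <- s) T t.1 (mon t.2.1.1 t.2.1.2 t.2.2) f) ->
  (forall c A B m, (size A + size B + m < N)%N -> order_lt N' (T c (mon A B m))) ->
  order_lt N' D'.
Proof.
move=> [s [sN Ds]] D' HD' HT.
apply: (spanned_ext (D := fun f => \sum_(t <- s) T t.1 (mon t.2.1.1 t.2.1.2 t.2.2) f)).
  by move=> f; rewrite (HD' _ Ds).
elim: s sN {Ds HD'} => [_|[c [[A B] m]] s IH /= /andP[tN sN]].
  by apply: spanned_ext (spanned0 _) => f; rewrite big_nil.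
by apply: spanned_ext (spannedD (HT _ _ _ _ tN) (IH sN)) => f; rewrite big_cons.
Qed.

Lemma order_lt_derivation (V : {additive S -> S}) N D :
  (forall f h, V (f * h) = V f * h + f * V h) ->
  (forall A B m, order_lt (size A + size B + m).+2 (fun f => V (mon A B m f))) ->
  order_lt N D -> order_lt N.+1 (fun f => V (D f)).
Proof.
move=> VM Vmon HD.
apply: (order_lt_lift (T := fun c M f => V c * M f + c * V (M f)) HD).
  move=> s Ds f; rewrite Ds raddf_sum; apply: eq_bigr => t _; exact: VM.
move=> c A B m sN; apply: spannedD.
  by apply: spannedM; apply: order_ltW (order_lt_mon (leqnn _)); rewrite ltnW.
by apply: spannedM; apply: order_ltW (Vmon A B m).
Qed.

Lemma order_lt_X_mon a A B m : order_lt (size A + size B + m).+2 (fun f => X a (mon A B m f)).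
Proof. exact: (order_lt_mon (A := a :: A)). Qed.

Lemma order_lt_Z_mon A B m : order_lt (size A + size B + m).+2 (fun f => Z (mon A B m f)).
Proof.
apply: spanned_ext (order_lt_mon (A := A) (B := B) (m := m.+1) _) => [f|].
  by rewrite Z_mon.
by rewrite addnS.
Qed.

Lemma order_lt_Y_mon_err b A B m : order_lt (size A + size B + m).+1
  (fun f => pick_sum (fun a A' => kap (ii * g b a) * mon A' B m.+1 f) A).
Proof.
apply: (spanned_pick_sum (F := fun a A' f => kap (ii * g b a) * mon A' B m.+1 f)).
by move=> a A' sA; apply: order_lt_term; rewrite sA; lia.
Qed.

Lemma order_lt_Y_mon b A B m : order_lt (size A + size B + m).+2 (fun f => Y b (mon A B m f)).
Proof.
apply: (spanned_ext (D := fun f => mon A (b :: B) m f + _)).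
  by move=> f; rewrite Y_mon.
apply: spannedD; first by apply: order_lt_mon => /=; lia.
by apply: order_ltW (order_lt_Y_mon_err b A B m).
Qed.

Lemma order_lt_X a N D : order_lt N D -> order_lt N.+1 (fun f => X a (D f)).
Proof. by apply: order_lt_derivation => // *; apply: order_lt_X_mon. Qed.

Lemma order_lt_Y a N D : order_lt N D -> order_lt N.+1 (fun f => Y a (D f)).
Proof. by apply: order_lt_derivation => // *; apply: order_lt_Y_mon. Qed.

Lemma order_lt_Z N D : order_lt N D -> order_lt N.+1 (fun f => Z (D f)).
Proof. by apply: order_lt_derivation => // *; apply: order_lt_Z_mon. Qed.

Lemma order_lt_lapl N D : order_lt N D -> order_lt N.+2 (fun f => lap (D f)).
Proof.
move=> HD; apply: spannedD; last first.
  by apply/spannedM/(order_ltW (leqnSn _))/order_lt_Z.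
apply: spanned_sum => a; apply: spanned_sum => b.
by apply/spannedM/order_lt_X/order_lt_Y.
Qed.

Lemma order_lt_mon_lap_err A B m :
  order_lt (size A + size B + m).+2 (mon_lap_err A B m).
Proof.
apply: spannedD; last by apply: order_lt_term; lia.
apply: spanned_sum => a; apply: spanned_sum => b; apply: spannedM.
apply: (spanned_pick_sum (F := fun b' B' f => kap (ii * g b' a) * mon A (b :: B') m.+1 f)).
by move=> b' B' sB; apply: order_lt_term; rewrite /= sB; lia.
Qed.

Lemma order_lt_lapr N D : order_lt N D -> order_lt N.+2 (fun f => D (lap f)).
Proof.
move=> HD.
apply: (order_lt_lift (T := fun c M f => c * M (lap f)) HD).
  by move=> s Ds f; rewrite Ds.
move=> c A B m sN; apply: spannedM.
apply: (spanned_ext (D := fun f => _ + mon_lap_err A B m f)).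
  by move=> f; rewrite mon_lap.
apply: spannedD.
  apply: spanned_sum => a; apply: spanned_sum => b.
  by apply: order_lt_term => /=; lia.
by apply: order_ltW (order_lt_mon_lap_err _ _ _); lia.
Qed.

(** Naively the commutator with an operator of order two raises the order by two;
    the second order terms [c * M lap] cancel, which leaves one. *)
Lemma order_lt_bracket N D : order_lt N D ->
  order_lt N.+1 (fun f => lap (D f) - D (lap f)).
Proof.
move=> HD.
apply: (order_lt_lift (T := fun c M f => lap (c * M f) - c * M (lap f)) HD).
  by move=> s Ds f; rewrite !Ds raddf_sum -sumrB.
move=> c A B m sN.
pose D' f := lap c * mon A B m f +
  c * (kap (ii * ((size A)%:R - (size B)%:R)) * mon A B m.+1 f) +
  \sum_b (\sum_a kap (ginv a b) * X a c) * Y b (mon A B m f) +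
  \sum_a (\sum_b kap (ginv a b) * Y b c) * X a (mon A B m f).
apply: (spanned_ext (D := D')).
  by move=> f; rewrite lap_mul lap_mon /D'; ring.
apply: spannedD; first apply: spannedD; first apply: spannedD.
- by apply: order_lt_term; lia.
- by apply/spannedM/order_lt_term; lia.
- apply: spanned_sum => b; apply: spannedM.
  by apply: order_ltW (order_lt_Y_mon _ _ _ _); lia.
apply: spanned_sum => b; apply: spannedM.
by apply: order_ltW (order_lt_X_mon _ _ _ _); lia.
Qed.

(** * Operators with symmetric coefficients *)

Implicit Types (T : seq 'I_n -> seq 'I_n -> S) (c : nat -> seq 'I_n -> seq 'I_n -> S).
Definition bisymmetric T := forall A A' B B', perm_eq A A' -> perm_eq B B' -> T A B = T A' B'.
Definition family_symmetric c := forall m, bisymmetric (c m).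
Definition supp_lt N c := forall m A B, (N <= size A + size B + m)%N -> c m A B = 0.

(** The coefficients [c m A B] are indexed by words; their lengths tell the numbers
    of unbarred and barred indices. The bound [L] on all three exponents is
    immaterial beyond the support of [c] (lemma [family_op_widen]). *)
Definition family_op L c (f : S) : S :=
  \sum_(m < L) word_sum L (fun A => word_sum L (fun B => c m A B * mon A B m f)).

Lemma family_op_widen L L' c f : (L <= L')%N -> supp_lt L c -> family_op L c f = family_op L' c f.
Proof.
move=> LL' sc; rewrite /family_op (big_ord_widen _ (fun m => word_sum L (fun A =>
  word_sum L (fun B => c m A B * mon A B m f))) LL').
rewrite big_mkcond; apply: eq_bigr => m _; case: ltnP => Lm.
  rewrite [RHS](_ : _ = word_sum L' (fun A => word_sum L (fun B => c m A B * mon A B m f))).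
    apply: word_sum_widen => // A sA; apply: word_sum0 => B _.
    by rewrite sc ?mul0r // -addnA (leq_trans sA) ?leq_addr.
  apply: eq_word_sum => A _; apply/esym/word_sum_widen => // B sB.
  by rewrite sc ?mul0r // addnAC (leq_trans sB) ?leq_addl.
symmetry; apply: word_sum0 => A _; apply: word_sum0 => B _.
by rewrite sc ?mul0r // (leq_trans Lm) ?leq_addl.
Qed.

Lemma family_opD L c c' f : family_op L (fun m A B => c m A B + c' m A B) f =
  family_op L c f + family_op L c' f.
Proof.
rewrite /family_op -big_split; apply: eq_bigr => m _ /=; rewrite -word_sumD.
apply: eq_word_sum => A _ /=; rewrite -word_sumD; apply: eq_word_sum => B _.
by rewrite mulrDl.
Qed.

Lemma family_opB L c c' f : family_op L (fun m A B => c m A B - c' m A B) f =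
  family_op L c f - family_op L c' f.
Proof.
apply/eqP; rewrite eq_sym subr_eq -family_opD; apply/eqP; apply: eq_bigr => m _.
by apply: eq_word_sum => A _; apply: eq_word_sum => B _; rewrite subrK.
Qed.

Lemma eq_family_op L c c' f : (forall m A B, c m A B = c' m A B) -> family_op L c f =
  family_op L c' f.
Proof.
move=> cc'; apply: eq_bigr => m _; apply: eq_word_sum => A _.
by apply: eq_word_sum => B _; rewrite cc'.
Qed.

Lemma order_lt_family_op N L c : supp_lt N c -> order_lt N (family_op L c).
Proof.
move=> sc; apply: spanned_sum => m; apply: spanned_word_sum => A.
apply: spanned_word_sum => B.
have [sN|sN] := ltnP (size A + size B + m) N; first exact: order_lt_term.
by apply: spanned_ext (spanned0 _) => f; rewrite sc ?mul0r.
Qed.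

(** The symmetrized Dirac mass at the word [A], described by how it acts on
    symmetric functions. *)
Lemma sym_delta (A : seq 'I_n) : exists e : seq 'I_n -> S,
  [/\ word_symmetric e, forall B, size B != size A -> e B = 0 &
   forall L (h : seq 'I_n -> S), (size A < L)%N -> word_symmetric h ->
     word_sum L (fun B => e B * h B) = h A].
Proof.
elim: A => [|x A [e [es e0 eA]]].
  exists (fun B => (B == [::])%:R); split.
  - move=> B B' BB'; congr (nat_of_bool _)%:R.
    by rewrite -!size_eq0 (perm_size BB').
  - by move=> B; rewrite size_eq0 => /negbTE ->.
  move=> [//|L] h _ _ /=; rewrite mul1r big1 ?addr0 // => a _.
  by apply: word_sum0 => B _; rewrite mul0r.
exists (pick_sum (fun a B => (a == x)%:R * (kap (size B).+1%:R^-1 * e B))); split.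
- apply: pick_sum_sym => a B B' BB'.
  by rewrite (es _ _ BB') (perm_size BB').
- move=> B sB; apply: pick_sum0 => a D sD.
  by rewrite e0 ?mulr0 //; apply: contraNneq sB => sDA; rewrite sD sDA.
move=> [//|L] h sL sh.
rewrite (word_sum_pick_sum L (fun a B => _)) //.
rewrite (bigD1 x) //= [X in _ + X]big1 ?addr0.
  rewrite -(eA L (fun B => h (x :: B))) //; last first.
    by move=> B B' BB'; apply: sh; rewrite perm_cons.
  apply: eq_word_sum => B _; rewrite eqxx mul1r -[LHS]mulr_natr.
  have E : kap (size B).+1%:R^-1 * (size B).+1%:R = 1.
    by rewrite -(rmorph_nat kap) -rmorphM mulVf ?rmorph1 ?pnatr_eq0.
  transitivity ((kap (size B).+1%:R^-1 * (size B).+1%:R) * (e B * h (x :: B))); first by ring.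
  by rewrite E mul1r.
move=> a /negbTE ax; apply: word_sum0 => B _.
by rewrite ax !mul0r mul0rn.
Qed.

(** A single monomial is the sum against the product of two symmetrized Dirac
    masses, because monomials do not depend on the order of their letters. *)
Lemma order_lt_normal_form N D : order_lt N D ->
  exists c, [/\ family_symmetric c, supp_lt N c & forall f, D f = family_op N c f].
Proof.
move=> [s [sN Ds]]; elim: s D sN Ds => [|[c0 [[A0 B0] m0]] s IH] D /=.
  move=> _ Ds; exists (fun _ _ _ => 0); split=> // f; rewrite Ds big_nil.
  apply/esym/big1 => m _; apply: word_sum0 => A _; apply: word_sum0 => B _.
  by rewrite mul0r.
rewrite /order_below /index_order /= => /andP[tN sN] Ds.
have [c [cs cN Dc]] := IH (fun f => \sum_(t <- s) term_op t f) sN (fun f => erefl).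
have [eA [eAs eA0 eAE]] := sym_delta A0.
have [eB [eBs eB0 eBE]] := sym_delta B0.
exists (fun m A B => (m == m0)%:R * c0 * (eA A * eB B) + c m A B); split.
- by move=> m A A' B B' AA' BB'; rewrite (cs _ _ _ _ _ AA' BB') (eAs _ _ AA') (eBs _ _ BB').
- move=> m A B sAB; rewrite cN // addr0.
  have [em|_] := eqVneq m m0; last by rewrite !mul0r.
  have [sA|/eA0 ->] := eqVneq (size A) (size A0); last by rewrite mul0r mulr0.
  have [sB|/eB0 ->] := eqVneq (size B) (size B0); last by rewrite !mulr0.
  by exfalso; lia.
move=> f; rewrite family_opD -Dc Ds big_cons; congr (_ + _); rewrite /term_op /=.
have m0N : (m0 < N)%N by lia.
rewrite /family_op (bigD1 (Ordinal m0N)) //= [X in _ + X]big1 ?addr0; last first.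
  move=> m mm0; apply: word_sum0 => A _.
  have -> : (nat_of_ord m == m0) = false.
    by apply: contraNF mm0 => /eqP E; apply/eqP/val_inj.
  by apply: word_sum0 => B _; rewrite !mul0r.
rewrite eqxx mul1r.
transitivity (c0 * word_sum N (fun A => eA A * word_sum N (fun B => eB B * mon A B m0 f))).
  congr (_ * _).
  rewrite -(eAE N (fun A => mon A B0 m0 f)); [|lia|by move=> A A' AA'; apply: mon_perm].
  apply: eq_word_sum => A _; congr (_ * _).
  rewrite -(eBE N (fun B => mon A B m0 f)) //; [lia|by move=> B B' BB'; apply: mon_perm].
rewrite -word_sum_mull; apply: eq_word_sum => A _.
rewrite mulrA -word_sum_mull; apply: eq_word_sum => B _.
by rewrite !mulrA.
Qed.


(** * Uniqueness of symmetric coefficients *)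

Context (z zb : 'I_n -> S) (sg : S).
Hypothesis X_z : forall a b, X a (z b) = (a == b)%:R.
Hypothesis Y_z : forall a b, Y a (z b) = 0.
Hypothesis Z_z : forall b, Z (z b) = 0.
Hypothesis X_zb : forall a b, X a (zb b) = 0.
Hypothesis Y_zb : forall a b, Y a (zb b) = (a == b)%:R.
Hypothesis Z_zb : forall b, Z (zb b) = 0.
Hypothesis Z_sg : Z sg = 1.

Lemma natS_inj k (x : S) : x *+ k.+1 = 0 -> x = 0.
Proof.
move=> xk; have E : kap k.+1%:R^-1 * k.+1%:R = 1.
  by rewrite -(rmorph_nat kap) -rmorphM mulVf ?rmorph1 ?pnatr_eq0.
by rewrite -[x]mul1r -E -mulrA mulrC mulr_natl xk mul0r.
Qed.

Lemma foldr_mull (h : 'I_n -> {additive S -> S}) A u f :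
  (forall a f, h a (u * f) = u * h a f) -> foldr h (u * f) A = u * foldr h f A.
Proof. by move=> hu; elim: A => //= a A ->; rewrite hu. Qed.

Lemma iterZ_mull m u f : Z u = 0 -> iter m Z (u * f) = u * iter m Z f.
Proof. by move=> Zu; elim: m => //= m ->; rewrite Z_mul Zu mul0r add0r. Qed.

Lemma mon_z A B m a f : mon A B m (z a * f) =
  z a * mon A B m f + pick_sum (fun x A' => (x == a)%:R * mon A' B m f) A.
Proof.
elim: A => [|x A IH].
  rewrite /= addr0 /mon /= iterZ_mull // foldr_mull // => b h.
  by rewrite Y_mul Y_z mul0r add0r.
rewrite pick_sum_cons -[mon (x :: A) B m (z a * f)]/(X x (mon A B m (z a * f))) IH.
rewrite raddfD /= X_mul X_z raddf_pick_sum -!addrA addrCA; congr (_ + (_ + _)).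
by apply: eq_pick_sum => y A' _ /=; rewrite -(rmorph_nat kap) Xc.
Qed.

Lemma mon_zb A B m b f : mon A B m (zb b * f) =
  zb b * mon A B m f + pick_sum (fun y B' => (y == b)%:R * mon A B' m f) B.
Proof.
elim: A => [|x A IH].
  elim: B => [|y B IH].
    by rewrite /= addr0 /mon /= iterZ_mull.
  rewrite pick_sum_cons -[mon [::] (y :: B) m (zb b * f)]/(Y y (mon [::] B m (zb b * f))) IH.
  rewrite raddfD /= Y_mul Y_zb raddf_pick_sum -!addrA addrCA; congr (_ + (_ + _)).
  by apply: eq_pick_sum => c B' _ /=; rewrite -(rmorph_nat kap) Yc.
rewrite -[mon (x :: A) B m (zb b * f)]/(X x (mon A B m (zb b * f))) IH.
rewrite raddfD /= X_mul X_zb mul0r add0r raddf_pick_sum; congr (_ + _).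
by apply: eq_pick_sum => c B' _ /=; rewrite -(rmorph_nat kap) Xc.
Qed.

(** Summation by parts against a Dirac mass at the letter [a]. *)
Lemma word_sum_pick_delta L (M c : seq 'I_n -> S) a : word_symmetric c ->
  (forall A, (L <= size A)%N -> c A = 0) ->
  word_sum L (fun A => c A * pick_sum (fun x A' => (x == a)%:R * M A') A) =
  word_sum L (fun A => c (a :: A) *+ (size A).+1 * M A).
Proof.
move=> cs cL.
rewrite (@word_sum_widen _ _ _ L.+1) //; last by move=> A /cL ->; rewrite mul0r.
under eq_word_sum => A _ do rewrite mulrC.
rewrite word_sum_pick_sum // (bigD1 a) //= [X in _ + X]big1 ?addr0.
  apply: eq_word_sum => A _; rewrite eqxx mul1r.
  by rewrite mulrC mulrnAl.
move=> x /negbTE xa; apply: word_sum0 => A _.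
by rewrite xa !mul0r mul0rn.
Qed.

(** The commutator with multiplication by a coordinate is the derivative of the
    symbol with respect to the dual frame variable, without correction terms. *)
Lemma family_op_z L c a f : family_symmetric c -> supp_lt L c ->
  family_op L c (z a * f) - z a * family_op L c f =
  family_op L (fun m A B => c m (a :: A) B *+ (size A).+1) f.
Proof.
move=> cs cL; rewrite /family_op mulr_sumr -sumrB; apply: eq_bigr => m _.
rewrite -!word_sum_mull.
transitivity (word_sum L (fun A => word_sum L (fun B =>
   c m A B * pick_sum (fun x A' => (x == a)%:R * mon A' B m f) A))).
  apply/eqP; rewrite subr_eq -word_sumD; apply/eqP; apply: eq_word_sum => A _.
  rewrite -word_sum_mull -word_sumD; apply: eq_word_sum => B _.
  by rewrite mon_z; ring.
rewrite word_sum_word_sum [RHS]word_sum_word_sum; apply: eq_word_sum => B _.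
rewrite (@word_sum_pick_delta L (fun A => mon A B m f) (fun A => c m A B)) //.
  by move=> A A' AA'; apply: cs.
by move=> A sA; apply: cL; rewrite -addnA (leq_trans sA) ?leq_addr.
Qed.

Lemma family_op_zb L c b f : family_symmetric c -> supp_lt L c ->
  family_op L c (zb b * f) - zb b * family_op L c f =
  family_op L (fun m A B => c m A (b :: B) *+ (size B).+1) f.
Proof.
move=> cs cL; rewrite /family_op mulr_sumr -sumrB; apply: eq_bigr => m _.
rewrite -!word_sum_mull.
transitivity (word_sum L (fun A => word_sum L (fun B =>
   c m A B * pick_sum (fun x B' => (x == b)%:R * mon A B' m f) B))).
  apply/eqP; rewrite subr_eq -word_sumD; apply/eqP; apply: eq_word_sum => A _.
  rewrite -word_sum_mull -word_sumD; apply: eq_word_sum => B _.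
  by rewrite mon_zb; ring.
apply: eq_word_sum => A _.
rewrite (@word_sum_pick_delta L (fun B => mon A B m f) (fun B => c m A B)) //.
  by move=> B B' BB'; apply: cs.
by move=> B sB; apply: cL; rewrite addnAC (leq_trans sB) ?leq_addl.
Qed.

Lemma Z_exp k : Z (sg ^+ k.+1) = sg ^+ k *+ k.+1.
Proof.
elim: k => [|k IH]; first by rewrite expr1 Z_sg expr0.
by rewrite exprS Z_mul IH Z_sg mul1r mulrnAr -exprS [in RHS]mulrS.
Qed.

Lemma iterZ_exp m : iter m Z (sg ^+ m) = m`!%:R.
Proof.
elim: m => [|m IH]; first by rewrite expr0.
rewrite iterSr Z_exp -mulr_natr -(rmorph_nat kap) mulrC.
by rewrite iterZ_mull ?Z_cst // IH rmorph_nat -natrM -factS.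
Qed.

Lemma iterZ_exp_gt m k : (k < m)%N -> iter m Z (sg ^+ k) = 0.
Proof.
move=> km; rewrite -(subnK km) iterD /= iterZ_exp -(rmorph_nat kap) Z_cst.
by elim: (_ - _)%N => //= j ->; rewrite raddf0.
Qed.

(** Commutators with the coordinates [z] and [zb] strip letters off the
    coefficients, so an induction on their number leaves only those of the powers
    of [Z], which are detected by the powers of [sg]. *)
Lemma family_op_eq0 L c : family_symmetric c -> supp_lt L c -> (forall f, family_op L c f = 0) ->
  forall m A B, c m A B = 0.
Proof.
move=> cs cL; have [K cK] : exists K, forall m A B, (K <= size A + size B)%N -> c m A B = 0.
  by exists L => m A B sAB; apply: cL; apply: leq_trans sAB (leq_addr _ _).
elim: K c cs cL cK => [|K IH] c cs cL cK c0 m A B; first exact: cK.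
have cA m' a A' B' : c m' (a :: A') B' = 0.
  apply: (@natS_inj (size A')).
  apply: (IH (fun m A B => c m (a :: A) B *+ (size A).+1)).
  - move=> m1 A1 A2 B1 B2 A12 B12.
    by rewrite (perm_size A12) (cs m1 (a :: A1) (a :: A2) B1 B2) ?perm_cons.
  - by move=> m1 A1 B1 s1; rewrite cL ?mul0rn //=; lia.
  - by move=> m1 A1 B1 s1; rewrite cK ?mul0rn.
  by move=> f; rewrite -family_op_z // !c0 mulr0 subrr.
have cB m' A' b B' : c m' A' (b :: B') = 0.
  apply: (@natS_inj (size B')).
  apply: (IH (fun m A B => c m A (b :: B) *+ (size B).+1)).
  - move=> m1 A1 A2 B1 B2 A12 B12.
    by rewrite (perm_size B12) (cs m1 A1 A2 (b :: B1) (b :: B2)) ?perm_cons.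
  - by move=> m1 A1 B1 s1; rewrite cL ?mul0rn //=; lia.
  - by move=> m1 A1 B1 s1; rewrite cK ?mul0rn //= addnS ltnS.
  by move=> f; rewrite -family_op_zb // !c0 mulr0 subrr.
case: A B => [|a A] [|b B] //.
have nfE f : \sum_(m < L) c m [::] [::] * iter m Z f = 0.
  transitivity (family_op L c f); last exact: c0.
  apply: eq_bigr => m' _.
  move: (nat_of_ord m') (ltn_ord m') => k kL; have -> : L = L.-1.+1 by lia.
  rewrite word_sum_nil // => [|a A].
    by rewrite word_sum_nil // => b B; rewrite cB mul0r.
  by apply: word_sum0 => B _; rewrite cA mul0r.
have [mL|Lm] := ltnP m L; last by apply: cL.
elim/ltn_ind: m mL => m IHm mL.
have := nfE (sg ^+ m).
rewrite (bigD1 (Ordinal mL)) //= iterZ_exp big1 ?addr0.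
  rewrite mulr_natr => H; apply: (@natS_inj (m`!).-1).
  by rewrite prednK ?fact_gt0.
move=> m' m'm; have [lt|lt|E] := ltngtP m' m.
- by rewrite IHm ?mul0r.
- by rewrite iterZ_exp_gt ?mulr0.
by case/eqP: m'm; apply: val_inj.
Qed.


(** * Raising indices and multiplying by the metric *)

Arguments word_sum : simpl never.
(** For symmetric [F a] this is the symmetrization of the tensor [F a A'] in all
    the letters of [a :: A']. *)
Definition pick_mean (F : 'I_n -> seq 'I_n -> S) (A : seq 'I_n) : S :=
  kap (size A)%:R^-1 * pick_sum F A.

Lemma eq_pick_mean F G A :
  (forall a B, size A = (size B).+1 -> F a B = G a B) ->
  pick_mean F A = pick_mean G A.
Proof. by move=> FG; congr (_ * _); apply: eq_pick_sum. Qed.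

Lemma pick_mean0 F A :
  (forall a B, size A = (size B).+1 -> F a B = 0) -> pick_mean F A = 0.
Proof. by move=> F0; rewrite /pick_mean pick_sum0 ?mulr0. Qed.

Lemma pick_mean_nil F : pick_mean F [::] = 0.
Proof. by rewrite /pick_mean mulr0. Qed.

Lemma pick_meanD F G A :
  pick_mean (fun a B => F a B + G a B) A = pick_mean F A + pick_mean G A.
Proof. by rewrite /pick_mean pick_sumD mulrDr. Qed.

Lemma pick_mean_mull (u : S) F A :
  pick_mean (fun a B => u * F a B) A = u * pick_mean F A.
Proof. by rewrite /pick_mean pick_sum_mull mulrCA. Qed.

Lemma pick_mean_sym F : (forall a, word_symmetric (F a)) ->
  word_symmetric (pick_mean F).
Proof.
move=> Fs A B AB; rewrite /pick_mean (perm_size AB); congr (_ * _).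
exact: pick_sum_sym.
Qed.

Lemma pick_mean_pick_mean (F : 'I_n -> seq 'I_n -> 'I_n -> seq 'I_n -> S) A B :
  pick_mean (fun a A' => pick_mean (F a A') B) A =
  pick_mean (fun b B' => pick_mean (fun a A' => F a A' b B') A) B.
Proof.
rewrite /pick_mean !pick_sum_mull (pick_sum_pick_sum F).
exact: mulrCA.
Qed.

Lemma pick_mean_exch (F : 'I_n -> 'I_n -> seq 'I_n -> S) A :
  pick_mean (fun a B => pick_mean (fun b D => F a b D) B) A =
  pick_mean (fun b B => pick_mean (fun a D => F a b D) B) A.
Proof.
rewrite /pick_mean; congr (_ * _).
transitivity (kap (size A).-1%:R^-1 *
    pick_sum (fun a B => pick_sum (fun b D => F a b D) B) A).
  by rewrite -pick_sum_mull; apply: eq_pick_sum => a B ->.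
rewrite pick_sum_exch -pick_sum_mull.
by apply: eq_pick_sum => a B ->.
Qed.

Lemma pick_mean_derivation (V : {additive S -> S}) F A :
  (forall k f, V (kap k * f) = kap k * V f) ->
  V (pick_mean F A) = pick_mean (fun a B => V (F a B)) A.
Proof. by move=> Vc; rewrite /pick_mean Vc raddf_pick_sum. Qed.

Lemma kap_natV k : kap k.+1%:R^-1 * k.+1%:R = 1.
Proof. by rewrite -(rmorph_nat kap) -rmorphM mulVf ?rmorph1 ?pnatr_eq0. Qed.

Lemma word_sum_pick_mean L F (h : seq 'I_n -> S) : word_symmetric h ->
  word_sum L.+1 (fun A => pick_mean F A * h A) =
  \sum_a word_sum L (fun A => F a A * h (a :: A)).
Proof.
move=> hs.
transitivity (word_sum L.+1 (fun A =>
    pick_sum (fun a B => kap (size B).+1%:R^-1 * F a B) A * h A)).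
  apply: eq_word_sum => A _; congr (_ * _).
  by rewrite /pick_mean -pick_sum_mull; apply: eq_pick_sum => a B ->.
rewrite (word_sum_pick_sum L (fun a B => _)) //; apply: eq_bigr => a _.
apply: eq_word_sum => A _; rewrite -[LHS]mulr_natr.
transitivity ((kap (size A).+1%:R^-1 * (size A).+1%:R) * (F a A * h (a :: A))).
  by ring.
by rewrite kap_natV mul1r.
Qed.

(** Symmetrizing coefficients does not change an operator, in the two sets of
    indices simultaneously. *)
Lemma word_sum_pick_mean2 L L' F (h : seq 'I_n -> seq 'I_n -> S) : bisymmetric h ->
  word_sum L.+1 (fun A => word_sum L'.+1 (fun B =>
    pick_mean (fun a A' => pick_mean (F a A') B) A * h A B)) =
  \sum_a \sum_b word_sum L (fun A => word_sum L' (fun B =>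
    F a A b B * h (a :: A) (b :: B))).
Proof.
move=> hs; rewrite word_sum_word_sum.
under eq_word_sum => B _.
  rewrite word_sum_pick_mean; first over.
  by move=> A A' AA'; apply: hs.
rewrite word_sum_sum; apply: eq_bigr => a _.
rewrite word_sum_word_sum -word_sum_sum; apply: eq_word_sum => A _.
by rewrite word_sum_pick_mean // => B B' BB'; apply: hs.
Qed.

Definition up a (f : S) : S := \sum_b kap (ginv a b) * Y b f.
Definition upbar b (f : S) : S := \sum_a kap (ginv a b) * X a f.

Lemma up_is_additive a : zmod_morphism (up a).
Proof.
by move=> u v; rewrite /up -sumrB; apply: eq_bigr => b _; rewrite raddfB mulrBr.
Qed.
HB.instance Definition _ a := GRing.isZmodMorphism.Build S S (up a) (@up_is_additive a).
Lemma upbar_is_additive a : zmod_morphism (upbar a).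
Proof.
by move=> u v; rewrite /upbar -sumrB; apply: eq_bigr => b _; rewrite raddfB mulrBr.
Qed.
HB.instance Definition _ a := GRing.isZmodMorphism.Build S S (upbar a) (@upbar_is_additive a).

Lemma up_cst a (k : C) f : up a (kap k * f) = kap k * up a f.
Proof. by rewrite /up mulr_sumr; apply: eq_bigr => b _; rewrite Yc mulrCA. Qed.
Lemma upbar_cst a (k : C) f : upbar a (kap k * f) = kap k * upbar a f.
Proof. by rewrite /upbar mulr_sumr; apply: eq_bigr => b _; rewrite Xc mulrCA. Qed.

(** The symmetrized product with the inverse metric, that is, the pure trace made
    from [T]. *)
Definition gmul T : seq 'I_n -> seq 'I_n -> S := fun A B =>
  pick_mean (fun a A' => pick_mean (fun b B' => kap (ginv a b) * T A' B') B) A.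
Definition sym_up T : seq 'I_n -> seq 'I_n -> S := fun A B =>
  pick_mean (fun a A' => up a (T A' B)) A.
Definition sym_upbar T : seq 'I_n -> seq 'I_n -> S := fun A B =>
  pick_mean (fun b B' => upbar b (T A B')) B.

Lemma bisymmetric_gmul T : bisymmetric T -> bisymmetric (gmul T).
Proof.
move=> Ts A A' B B' AA' BB'.
transitivity (gmul T A' B).
  apply: pick_mean_sym => // a A1 A2 A12; apply: eq_pick_mean => b B1 _.
  by rewrite (Ts _ _ _ _ A12 (perm_refl B1)).
apply: eq_pick_mean => a A1 _; apply: pick_mean_sym => // b B1 B2 B12.
by rewrite (Ts _ _ _ _ (perm_refl A1) B12).
Qed.

Lemma bisymmetric_sym_up T : bisymmetric T -> bisymmetric (sym_up T).
Proof.
move=> Ts A A' B B' AA' BB'.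
transitivity (sym_up T A' B).
  by apply: pick_mean_sym => // a A1 A2 A12; rewrite (Ts _ _ _ _ A12 (perm_refl B)).
by apply: eq_pick_mean => a A1 _; rewrite (Ts _ _ _ _ (perm_refl A1) BB').
Qed.

Lemma bisymmetric_sym_upbar T : bisymmetric T -> bisymmetric (sym_upbar T).
Proof.
move=> Ts A A' B B' AA' BB'.
transitivity (sym_upbar T A B').
  by apply: pick_mean_sym => // a B1 B2 B12; rewrite (Ts _ _ _ _ (perm_refl A) B12).
by apply: eq_pick_mean => a B1 _; rewrite (Ts _ _ _ _ AA' (perm_refl B1)).
Qed.

(** The inverse metric is constant, and symmetrizing two indices one after the
    other does not depend on which one is taken first; hence derivatives of pure
    traces are pure traces. *)
Lemma sym_up_gmul T A B : sym_up (gmul T) A B = gmul (sym_up T) A B.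
Proof.
rewrite /sym_up /gmul.
transitivity (pick_mean (fun a A' => pick_mean (fun a' A'' =>
   pick_mean (fun b B' => kap (ginv a' b) * up a (T A'' B')) B) A') A).
  apply: eq_pick_mean => a A' _; rewrite pick_mean_derivation; last exact: up_cst.
  apply: eq_pick_mean => a' A'' _; rewrite pick_mean_derivation; last exact: up_cst.
  by apply: eq_pick_mean => b B' _; rewrite /= up_cst.
rewrite pick_mean_exch; apply: eq_pick_mean => a A' _.
rewrite pick_mean_pick_mean; apply: eq_pick_mean => b B' _.
by rewrite pick_mean_mull.
Qed.

Lemma sym_upbar_gmul T A B : sym_upbar (gmul T) A B = gmul (sym_upbar T) A B.
Proof.
rewrite /sym_upbar /gmul.
transitivity (pick_mean (fun b B' => pick_mean (fun a A' =>
   pick_mean (fun b' B'' => kap (ginv a b') * upbar b (T A' B'')) B') A) B).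
  apply: eq_pick_mean => b B' _; rewrite pick_mean_derivation; last exact: upbar_cst.
  apply: eq_pick_mean => a A' _; rewrite pick_mean_derivation; last exact: upbar_cst.
  by apply: eq_pick_mean => b' B'' _; rewrite /= upbar_cst.
rewrite pick_mean_pick_mean; apply: eq_pick_mean => a A' _.
rewrite pick_mean_exch; apply: eq_pick_mean => b B' _.
by rewrite pick_mean_mull.
Qed.

(** * Leading symbols *)

Definition sigma_shift c : nat -> seq 'I_n -> seq 'I_n -> S := fun m A B =>
  kap (ii * ((size A)%:R - (size B)%:R)) * (if m is m'.+1 then c m' A B else 0).
(** The Poisson bracket with the symbol of the sub-Laplacian, including the
    contribution [sigma_shift] of the non-commuting frame. *)
Definition bracket_symbol c : nat -> seq 'I_n -> seq 'I_n -> S := fun m A B =>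
  sym_up (c m) A B + sym_upbar (c m) A B + sigma_shift c m A B.

Lemma family_op_gmul L c f : supp_lt L c ->
  family_op L.+1 (fun m => gmul (c m)) f =
  \sum_(m < L) word_sum L (fun A => word_sum L (fun B => c m A B *
    (\sum_a \sum_b kap (ginv a b) * mon (a :: A) (b :: B) m f))).
Proof.
move=> cL; rewrite /family_op big_ord_recr /= [X in _ + X]word_sum0 ?addr0; last first.
  move=> A _; apply: word_sum0 => B _; rewrite /gmul pick_mean0 ?mul0r // => a A' _.
  by apply: pick_mean0 => b B' _; rewrite cL ?mulr0 //= leq_addl.
apply: eq_bigr => m _.
rewrite (word_sum_pick_mean2 L L (fun a A b B => kap (ginv a b) * c m A B)
  (h := fun A B => mon A B m f)); last by move=> A A' B B'; apply: mon_perm.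
under [RHS]eq_word_sum => A _.
  under eq_word_sum => B _ do [rewrite mulr_sumr; under eq_bigr => a _ do rewrite mulr_sumr].
  rewrite word_sum_sum.
  under eq_bigr => a _ do rewrite word_sum_sum.
  over.
rewrite word_sum_sum; apply: eq_bigr => a _.
rewrite word_sum_sum; apply: eq_bigr => b _.
apply: eq_word_sum => A _; apply: eq_word_sum => B _ /=.
by rewrite mulrCA mulrA.
Qed.

Lemma family_op_sym_up L c f : supp_lt L c ->
  family_op L.+1 (fun m => sym_up (c m)) f =
  \sum_(m < L) word_sum L (fun A => word_sum L (fun B =>
    (\sum_a up a (c m A B) * mon (a :: A) B m f))).
Proof.
move=> cL; rewrite /family_op big_ord_recr /= [X in _ + X]word_sum0 ?addr0; last first.
  move=> A _; apply: word_sum0 => B _; rewrite /sym_up pick_mean0 ?mul0r // => a A' _.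
  by rewrite cL ?raddf0 //= leq_addl.
apply: eq_bigr => m _; rewrite word_sum_word_sum [RHS]word_sum_word_sum.
rewrite -(@word_sum_widen _ _ L) //; last first.
  move=> B sB; apply: word_sum0 => A _; rewrite /sym_up pick_mean0 ?mul0r // => a A' _.
  by rewrite cL ?raddf0 //= addnAC (leq_trans sB) ?leq_addl.
apply: eq_word_sum => B _; rewrite word_sum_sum.
rewrite (word_sum_pick_mean L (fun a A => up a (c m A B)) (h := fun A => mon A B m f)) //.
by move=> A A' AA'; apply: mon_perm.
Qed.

Lemma family_op_sym_upbar L c f : supp_lt L c ->
  family_op L.+1 (fun m => sym_upbar (c m)) f =
  \sum_(m < L) word_sum L (fun A => word_sum L (fun B =>
    (\sum_b upbar b (c m A B) * mon A (b :: B) m f))).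
Proof.
move=> cL; rewrite /family_op big_ord_recr /= [X in _ + X]word_sum0 ?addr0; last first.
  move=> A _; apply: word_sum0 => B _; rewrite /sym_upbar pick_mean0 ?mul0r // => b B' _.
  by rewrite cL ?raddf0 //= leq_addl.
apply: eq_bigr => m _.
rewrite -(@word_sum_widen _ _ L) //; last first.
  move=> A sA; apply: word_sum0 => B _; rewrite /sym_upbar pick_mean0 ?mul0r // => b B' _.
  by rewrite cL ?raddf0 //= -addnA (leq_trans sA) ?leq_addr.
apply: eq_word_sum => A _; rewrite word_sum_sum.
rewrite (word_sum_pick_mean L (fun b B => upbar b (c m A B)) (h := fun B => mon A B m f)) //.
by move=> B B' BB'; apply: mon_perm.
Qed.

Lemma family_op_sigma_shift L c f : supp_lt L c ->
  family_op L.+1 (sigma_shift c) f =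
  \sum_(m < L) word_sum L (fun A => word_sum L (fun B =>
    c m A B * (kap (ii * ((size A)%:R - (size B)%:R)) * mon A B m.+1 f))).
Proof.
move=> cL; rewrite /family_op big_ord_recl /= [X in X + _]word_sum0 ?add0r; last first.
  by move=> A _; apply: word_sum0 => B _; rewrite /sigma_shift mulr0 mul0r.
apply: eq_bigr => m _; rewrite /sigma_shift /= -(@word_sum_widen _ _ L) //; last first.
  move=> A sA; apply: word_sum0 => B _.
  by rewrite cL ?mulr0 ?mul0r //= -addnA (leq_trans sA) ?leq_addr.
apply: eq_word_sum => A _; rewrite -(@word_sum_widen _ _ L) //; last first.
  move=> B sB.
  by rewrite cL ?mulr0 ?mul0r //= addnAC (leq_trans sB) ?leq_addl.
by apply: eq_word_sum => B _; rewrite mulrCA mulrA.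
Qed.

Definition homogeneous_part N c : nat -> seq 'I_n -> seq 'I_n -> S := fun m A B =>
  if (size A + size B + m == N)%N then c m A B else 0.

Lemma family_symmetric_homogeneous_part N c :
  family_symmetric c -> family_symmetric (homogeneous_part N c).
Proof.
move=> cs m A A' B B' AA' BB'.
by rewrite /homogeneous_part (perm_size AA') (perm_size BB') (cs _ _ _ _ _ AA' BB').
Qed.

Lemma supp_lt_homogeneous_part N c : supp_lt N.+1 (homogeneous_part N c).
Proof. by move=> m A B sN; rewrite /homogeneous_part ifN // neq_ltn sN orbT. Qed.

(** A symmetric family represents the symbol of order [N] by its values on total
    degree [N]; the other values are free, which spares truncations. *)
Definition has_symbol N c (D : S -> S) : Prop :=
  family_symmetric c /\ order_lt N (fun f => D f - family_op N.+1 (homogeneous_part N c) f).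

Lemma has_symbol_ext N c D D' : (forall f, D f = D' f) -> has_symbol N c D ->
  has_symbol N c D'.
Proof.
move=> DD' [cs H]; split=> //; apply: spanned_ext H => f; by rewrite DD'.
Qed.

Lemma has_symbol_order N c D : has_symbol N c D -> order_lt N.+1 D.
Proof.
move=> [cs H].
apply: (spanned_ext (D :=
  fun f => (D f - family_op N.+1 (homogeneous_part N c) f) + family_op N.+1
  (homogeneous_part N c) f)).
  by move=> f; rewrite subrK.
by apply: spannedD; [apply: order_ltW H|apply/order_lt_family_op/supp_lt_homogeneous_part].
Qed.

Lemma has_symbol_exists N D : order_lt N.+1 D -> exists c, has_symbol N c D.
Proof.
move=> /order_lt_normal_form[c [cs cN Dc]]; exists c; split=> //.
apply: (spanned_ext (D := family_op N.+1 (fun m A B => c m A B - homogeneous_part N c m A B))).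
  by move=> f; rewrite family_opB -Dc.
apply: order_lt_family_op => m A B; rewrite leq_eqVlt /homogeneous_part => /predU1P[->|sN].
  by rewrite eqxx subrr.
by rewrite cN // ifN ?subrr // neq_ltn sN orbT.
Qed.

(** Applied to a difference, this says that an operator determines its leading
    coefficients. *)
Lemma has_symbol_uniq N c D : has_symbol N c D -> order_lt N D ->
  forall m A B, (size A + size B + m)%N = N -> c m A B = 0.
Proof.
move=> [cs H] HD m A B sN.
have /order_lt_normal_form[e [es eN De]] := spannedB HD H.
have e0 : supp_lt N.+1 e by move=> m' A' B' /ltnW /eN.
have : homogeneous_part N c m A B - e m A B = 0.
  apply: (@family_op_eq0 N.+1 (fun m A B => homogeneous_part N c m A B - e m A B)).
  - move=> m' A1 A2 B1 B2 A12 B12.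
    by rewrite (family_symmetric_homogeneous_part N cs m' A12 B12) (es _ _ _ _ _ A12 B12).
  - by move=> m' A' B' s'; rewrite supp_lt_homogeneous_part // e0 ?subrr.
  move=> f; rewrite family_opB -(@family_op_widen N N.+1 e f) // -De.
  by ring.
by rewrite /homogeneous_part sN eqxx eN ?sN // subr0.
Qed.

Lemma has_symbol0 N c D : has_symbol N c D ->
  (forall m A B, (size A + size B + m)%N = N -> c m A B = 0) -> order_lt N D.
Proof.
move=> [cs H] c0; apply: spanned_ext H => f.
rewrite [X in _ - X](_ : _ = 0) ?subr0 //.
apply: big1 => m _; apply: word_sum0 => A _; apply: word_sum0 => B _.
by rewrite /homogeneous_part; case: eqP => [/c0 ->|_]; rewrite mul0r.
Qed.

Lemma has_symbolB N c c' D D' : has_symbol N c D -> has_symbol N c' D' ->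
  has_symbol N (fun m A B => c m A B - c' m A B) (fun f => D f - D' f).
Proof.
move=> [cs H] [cs' H']; split.
  by move=> m A A' B B' AA' BB'; rewrite (cs _ _ _ _ _ AA' BB') (cs' _ _ _ _ _ AA' BB').
apply: spanned_ext (spannedB H H') => f.
have -> : family_op N.+1 (homogeneous_part N (fun m A B => c m A B - c' m A B)) f =
    family_op N.+1 (homogeneous_part N c) f - family_op N.+1 (homogeneous_part N c') f.
  by rewrite -family_opB; apply: eq_family_op => m A B; rewrite /homogeneous_part;
    case: ifP; rewrite ?subrr.
by ring.
Qed.

(** Composition with the sub-Laplacian multiplies the symbol by the symbol of the
    latter, which is the inverse metric. *)
Lemma has_symbol_lapr N c D : has_symbol N c D ->
  has_symbol N.+2 (fun m => gmul (c m)) (fun f => D (lap f)).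
Proof.
move=> [cs H]; split; first by move=> m; apply: bisymmetric_gmul.
set c' := homogeneous_part N c; have c'N : supp_lt N.+1 c' by exact: supp_lt_homogeneous_part.
have c'N2 : supp_lt N.+2 c' by move=> m A B /ltnW/c'N.
pose E f := \sum_(m < N.+2) word_sum N.+2 (fun A => word_sum N.+2 (fun B =>
  c' m A B * mon_lap_err A B m f)).
apply: (spanned_ext (D := fun f => (D (lap f) - family_op N.+1 c' (lap f)) + E f)).
  move=> f; rewrite -addrA; congr (_ + _).
  have -> : family_op N.+3 (homogeneous_part N.+2 (fun m => gmul (c m))) f =
    family_op N.+3 (fun m => gmul (c' m)) f.
    apply: eq_family_op => m A B; rewrite /homogeneous_part; case: eqP => sN.
      apply: eq_pick_mean => a A' sA; apply: eq_pick_mean => b B' sB.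
      by rewrite /c' /homogeneous_part ifT //; apply/eqP; lia.
    symmetry; apply: pick_mean0 => a A' sA; apply: pick_mean0 => b B' sB.
    by rewrite /c' /homogeneous_part ifN ?mulr0 //; apply/eqP => ?; apply: sN; lia.
  rewrite family_op_gmul // (@family_op_widen N.+1 N.+2) // addrC; apply/eqP;
    rewrite subr_eq addrC -subr_eq opprK; apply/eqP.
  rewrite /family_op /E -big_split; apply: eq_bigr => m _ /=.
  rewrite -word_sumD; apply: eq_word_sum => A _ /=.
  rewrite -word_sumD; apply: eq_word_sum => B _ /=.
  by rewrite -mulrDr [E in _ = _ * E]mon_lap addrC.
apply: spannedD; first exact: order_lt_lapr H.
apply: spanned_sum => m; apply: spanned_word_sum => A; apply: spanned_word_sum => B.
have [sN|sN] := eqVneq (size A + size B + m)%N N.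
  by apply/spannedM/(order_ltW _ (order_lt_mon_lap_err _ _ _)); rewrite sN.
apply: spanned_ext (spanned0 _) => f.
by rewrite /c' /homogeneous_part ifN // mul0r.
Qed.

Lemma family_symmetric_bracket_symbol c : family_symmetric c -> family_symmetric (bracket_symbol c).
Proof.
move=> cs m A A' B B' AA' BB'; rewrite /bracket_symbol /sigma_shift.
rewrite (bisymmetric_sym_up (cs m) AA' BB') (bisymmetric_sym_upbar (cs m) AA' BB').
rewrite (perm_size AA') (perm_size BB').
by case: m => // m; rewrite (cs _ _ _ _ _ AA' BB').
Qed.

(** By the Leibniz rule [lap_mul], one of the two derivatives hits the coefficient,
    or [lap_mon] applies; everything else has order at most [N]. *)
Lemma has_symbol_bracket N c D : has_symbol N c D ->
  has_symbol N.+1 (bracket_symbol c) (fun f => lap (D f) - D (lap f)).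
Proof.
move=> [cs H]; split; first exact: family_symmetric_bracket_symbol.
set c' := homogeneous_part N c; have c'N : supp_lt N.+1 c' by exact: supp_lt_homogeneous_part.
pose E f := \sum_(m < N.+1) word_sum N.+1 (fun A => word_sum N.+1 (fun B =>
  lap (c' m A B) * mon A B m f + \sum_b upbar b (c' m A B) *
   pick_sum (fun a A' => kap (ii * g b a) * mon A' B m.+1 f) A)).
apply: (spanned_ext (D := fun f =>
   (lap (D f - family_op N.+1 c' f) - (D (lap f) - family_op N.+1 c' (lap f))) + E f)).
  move=> f.
  have -> : family_op N.+2 (homogeneous_part N.+1 (bracket_symbol c)) f =
    family_op N.+2 (bracket_symbol c') f.
    apply: eq_family_op => m A B; rewrite /homogeneous_part; case: eqP => sN.
      congr (_ + _ + _); [apply: eq_pick_mean => a A' sA|apply: eq_pick_mean => a B' sB|].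
      - by rewrite /c' /homogeneous_part ifT //; apply/eqP; lia.
      - by rewrite /c' /homogeneous_part ifT //; apply/eqP; lia.
      rewrite /sigma_shift; case: m sN => // m sN; congr (_ * _).
      by rewrite /c' /homogeneous_part ifT //; apply/eqP; lia.
    symmetry; rewrite /bracket_symbol /sym_up /sym_upbar /sigma_shift !pick_mean0 ?add0r.
    - case: m sN => [|m] sN; first by rewrite mulr0.
      by rewrite /c' /homogeneous_part ifN ?mulr0 //; apply/eqP => ?; apply: sN; lia.
    - move=> a A' sA; rewrite /c' /homogeneous_part ifN ?raddf0 //.
      by apply/eqP => ?; apply: sN; lia.
    - move=> a A' sA; rewrite /c' /homogeneous_part ifN ?raddf0 //.
      by apply/eqP => ?; apply: sN; lia.
  rewrite /bracket_symbol !family_opD family_op_sym_up // family_op_sym_upbar //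
    family_op_sigma_shift //.
  rewrite raddfB /=.
  have -> : lap (family_op N.+1 c' f) = family_op N.+1 c' (lap f) +
    \sum_(m < N.+1) word_sum N.+1 (fun A => word_sum N.+1 (fun B =>
       \sum_a up a (c' m A B) * mon (a :: A) B m f)) +
    \sum_(m < N.+1) word_sum N.+1 (fun A => word_sum N.+1 (fun B =>
       \sum_b upbar b (c' m A B) * mon A (b :: B) m f)) +
    \sum_(m < N.+1) word_sum N.+1 (fun A => word_sum N.+1 (fun B =>
      c' m A B * (kap (ii * ((size A)%:R - (size B)%:R)) * mon A B m.+1 f))) + E f.
    rewrite /family_op raddf_sum /E -!big_split; apply: eq_bigr => m _ /=.
    rewrite raddf_word_sum -!word_sumD; apply: eq_word_sum => A _ /=.
    rewrite raddf_word_sum -!word_sumD; apply: eq_word_sum => B _ /=.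
    have -> : lap (c' m A B * mon A B m f) =
       lap (c' m A B) * mon A B m f + c' m A B * lap (mon A B m f) +
       \sum_b upbar b (c' m A B) * Y b (mon A B m f) +
       \sum_a up a (c' m A B) * mon (a :: A) B m f by exact: lap_mul.
    have -> : \sum_b upbar b (c' m A B) * Y b (mon A B m f) =
       \sum_b upbar b (c' m A B) * mon A (b :: B) m f +
       \sum_b upbar b (c' m A B) *
         pick_sum (fun a A' => kap (ii * g b a) * mon A' B m.+1 f) A.
      by rewrite -big_split; apply: eq_bigr => b _; rewrite Y_mon mulrDr.
    by rewrite lap_mon; ring.
  by ring.
apply: spannedD.
  exact: order_lt_bracket H.
apply: spanned_sum => m; apply: spanned_word_sum => A; apply: spanned_word_sum => B.
have [sN|sN] := eqVneq (size A + size B + m)%N N.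
  apply: spannedD; first by apply: order_lt_term; rewrite sN.
  apply: spanned_sum => b; apply: spannedM.
  by apply: order_ltW (order_lt_Y_mon_err b A B m); rewrite sN.
apply: spanned_ext (spanned0 _) => f.
rewrite /c' /homogeneous_part ifN // raddf0 mul0r add0r big1 // => b _.
by rewrite raddf0 mul0r.
Qed.


(** * Trace-free parts *)

Definition gtrace T : seq 'I_n -> seq 'I_n -> S := fun A B =>
  \sum_a \sum_b kap (g b a) * T (a :: A) (b :: B).
(* Without the factors of gmul the commutation with traces has integer
   coefficients. *)
Definition gmul_sum T : seq 'I_n -> seq 'I_n -> S := fun A B =>
  pick_sum (fun a A' => pick_sum (fun b B' => kap (ginv a b) * T A' B') B) A.

Lemma gmulE T A B : gmul T A B = kap ((size A)%:R^-1 * (size B)%:R^-1) * gmul_sum T A B.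
Proof. by rewrite /gmul /pick_mean pick_sum_mull mulrA -rmorphM. Qed.

Lemma eq_gmul_sum T T' A B :
  (forall A' B', size A = (size A').+1 -> size B = (size B').+1 -> T A' B' = T' A' B') ->
  gmul_sum T A B = gmul_sum T' A B.
Proof.
move=> TT'; apply: eq_pick_sum => a A' sA; apply: eq_pick_sum => b B' sB.
by rewrite TT'.
Qed.

Lemma gmul_sum_mull (u : S) T A B : gmul_sum (fun A B => u * T A B) A B = u * gmul_sum T A B.
Proof.
rewrite /gmul_sum -pick_sum_mull; apply: eq_pick_sum => a A' _.
by rewrite -pick_sum_mull; apply: eq_pick_sum => b B' _; rewrite mulrCA.
Qed.

Lemma bisymmetric_gmul_sum T : bisymmetric T -> bisymmetric (gmul_sum T).
Proof.
move=> Ts A A' B B' AA' BB'.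
transitivity (gmul_sum T A' B).
  apply: pick_sum_sym => // a A1 A2 A12; apply: eq_pick_sum => b B1 _.
  by rewrite (Ts _ _ _ _ A12 (perm_refl B1)).
apply: eq_pick_sum => a A1 _; apply: pick_sum_sym => // b B1 B2 B12.
by rewrite (Ts _ _ _ _ (perm_refl A1) B12).
Qed.

Lemma bisymmetric_gtrace T : bisymmetric T -> bisymmetric (gtrace T).
Proof.
move=> Ts A A' B B' AA' BB'; apply: eq_bigr => a _; apply: eq_bigr => b _.
by rewrite (Ts _ (a :: A') _ (b :: B')) ?perm_cons.
Qed.

Lemma sum_g_ginv (F : 'I_n -> S) b' :
  \sum_a \sum_b kap (g b a) * (kap (ginv a b') * F b) = F b'.
Proof.
rewrite exchange_big /=.
transitivity (\sum_b (b == b')%:R * F b); last exact: sum_delta_l.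
apply: eq_bigr => b _; rewrite -(rmorph_nat kap) -g_ginv rmorph_sum mulr_suml.
by apply: eq_bigr => a _; rewrite mulrA -rmorphM.
Qed.

Lemma sum_ginv_g (F : 'I_n -> S) a' :
  \sum_a \sum_b kap (g b a) * (kap (ginv a' b) * F a) = F a'.
Proof.
transitivity (\sum_a (a' == a)%:R * F a); last exact: sum_delta_r.
apply: eq_bigr => a _; rewrite -(rmorph_nat kap) -ginv_g rmorph_sum mulr_suml.
by apply: eq_bigr => b _; rewrite mulrA -rmorphM [g b a * _]mulrC.
Qed.

(** The two contracted indices sit both on the metric, which gives [n], or one of
    them on the metric and the other on [T], which replaces a letter of [T] by
    itself, or both on [T]. *)
Lemma gtrace_gmul_sum T A B : bisymmetric T ->
  gtrace (gmul_sum T) A B = (n + size A + size B)%:R * T A B + gmul_sum (gtrace T) A B.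
Proof.
move=> Ts; pose G4 a b := gmul_sum (fun A B => T (a :: A) (b :: B)) A B.
transitivity (\sum_a \sum_b kap (g b a) * (
   kap (ginv a b) * T A B +
   pick_sum (fun b' B' => kap (ginv a b') * T A (b :: B')) B +
   pick_sum (fun a' A' => kap (ginv a' b) * T (a :: A') B) A + G4 a b)).
  apply: eq_bigr => a _; apply: eq_bigr => b _; congr (_ * _).
  by rewrite /gmul_sum pick_sum_cons !pick_sumD /= -!addrA.
have split4 (F1 F2 F3 F4 : 'I_n -> 'I_n -> S) :
   \sum_a \sum_b kap (g b a) * (F1 a b + F2 a b + F3 a b + F4 a b) =
   \sum_a \sum_b kap (g b a) * F1 a b + \sum_a \sum_b kap (g b a) * F2 a b +
   \sum_a \sum_b kap (g b a) * F3 a b + \sum_a \sum_b kap (g b a) * F4 a b.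
  rewrite -!big_split; apply: eq_bigr => a _.
  by rewrite -!big_split; apply: eq_bigr => b _ /=; ring.
rewrite split4.
have -> : \sum_a \sum_b kap (g b a) * (kap (ginv a b) * T A B) = n%:R * T A B.
  rewrite exchange_big /= -[n in n%:R]card_ord -sum1_card natr_sum mulr_suml.
  apply: eq_bigr => b _; rewrite -(rmorph_nat kap) -[1%N](congr1 nat_of_bool (eqxx b)).
  rewrite -g_ginv rmorph_sum mulr_suml.
  by apply: eq_bigr => a _; rewrite mulrA -rmorphM.
have -> : \sum_a \sum_b kap (g b a) *
    pick_sum (fun b' B' => kap (ginv a b') * T A (b :: B')) B = (size B)%:R * T A B.
  rewrite mulr_natl -(@pick_sum_sym_const _ _ (T A)); last by move=> ? ?; apply: Ts.
  under eq_bigr => a _ do [under eq_bigr => b _ do rewrite -pick_sum_mull; rewrite -pick_sum_sum].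
  rewrite -pick_sum_sum; apply: eq_pick_sum => b' B' _.
  exact: (sum_g_ginv (fun b => T A (b :: B'))).
have -> : \sum_a \sum_b kap (g b a) *
    pick_sum (fun a' A' => kap (ginv a' b) * T (a :: A') B) A = (size A)%:R * T A B.
  rewrite mulr_natl -(@pick_sum_sym_const _ _ (T^~ B)); last by move=> ? ? ?; apply: Ts.
  under eq_bigr => a _ do [under eq_bigr => b _ do rewrite -pick_sum_mull; rewrite -pick_sum_sum].
  rewrite -pick_sum_sum; apply: eq_pick_sum => a' A' _.
  exact: (sum_ginv_g (fun a => T (a :: A') B)).
have -> : \sum_a \sum_b kap (g b a) * G4 a b = gmul_sum (gtrace T) A B.
  rewrite /G4 /gmul_sum.
  under eq_bigr => a _ do [under eq_bigr => b _ do rewrite -pick_sum_mull; rewrite -pick_sum_sum].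
  rewrite -pick_sum_sum; apply: eq_pick_sum => a' A' _.
  under eq_bigr => a _ do [under eq_bigr => b _ do rewrite -pick_sum_mull; rewrite -pick_sum_sum].
  rewrite -pick_sum_sum; apply: eq_pick_sum => b' B' _.
  rewrite /gtrace mulr_sumr; apply: eq_bigr => a _; rewrite mulr_sumr.
  by apply: eq_bigr => b _; rewrite mulrCA.
by rewrite !natrD; ring.
Qed.

(** Solves [al q + gmul_sum (gtrace q) = T] on words of lengths [k] and [l]. By
    [gtrace_gmul_sum], the trace [r] of a solution satisfies the same kind of
    equation, with right hand side [gtrace T], a larger constant and shorter
    words; then [q] is read off. *)
Fixpoint fischer_solve (k l al : nat) T : seq 'I_n -> seq 'I_n -> S :=
  match k, l with
  | k'.+1, l'.+1 => fun A B =>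
      kap al%:R^-1 * (T A B - gmul_sum (fischer_solve k' l' (al + (n + k' + l')) (gtrace T)) A B)
  | _, _ => fun A B => kap al%:R^-1 * T A B
  end.

Lemma bisymmetric_fischer_solve k l al T : bisymmetric T -> bisymmetric (fischer_solve k l al T).
Proof.
elim: k l al T => [|k IH] [|l] al T Ts A A' B B' AA' BB' /=;
  rewrite (Ts _ _ _ _ AA' BB') //.
by congr (_ * (_ - _)); apply: bisymmetric_gmul_sum => //; apply: IH; apply: bisymmetric_gtrace.
Qed.

Lemma natr_kapV k : (0 < k)%N -> k%:R * kap k%:R^-1 = 1.
Proof. by case: k => // k _; rewrite mulrC kap_natV. Qed.

Lemma gmul_sum_nil0 T A B : (size A == 0)%N || (size B == 0)%N -> gmul_sum T A B = 0.
Proof.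
move=> s0; apply: pick_sum0 => a A' sA; apply: pick_sum0 => b B' sB.
by move: s0; rewrite sA sB.
Qed.

Lemma fischer_solveP k l al T A B : (0 < al)%N -> bisymmetric T -> size A = k -> size B = l ->
  al%:R * fischer_solve k l al T A B + gmul_sum (gtrace (fischer_solve k l al T)) A B = T A B.
Proof.
elim: k l al T A B => [|k IH] l al T A B al0 Ts sA sB.
  by rewrite gmul_sum_nil0 ?sA // addr0 mulrA natr_kapV // mul1r.
case: l sB => [|l] sB.
  by rewrite gmul_sum_nil0 ?sB ?orbT // addr0 mulrA natr_kapV // mul1r.
set q := fischer_solve k.+1 l.+1 al T; set r := fischer_solve k l (al + (n + k + l)) (gtrace T).
have rs : bisymmetric r by apply/bisymmetric_fischer_solve/bisymmetric_gtrace.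
have qE A' B' : q A' B' = kap al%:R^-1 * (T A' B' - gmul_sum r A' B') by [].
have tq A' B' : size A' = k -> size B' = l -> gtrace q A' B' = r A' B'.
  move=> sA' sB'.
  have : gtrace q A' B' = kap al%:R^-1 * (gtrace T A' B' - gtrace (gmul_sum r) A' B').
    rewrite /gtrace -sumrB mulr_sumr; apply: eq_bigr => a _.
    rewrite -sumrB mulr_sumr; apply: eq_bigr => b _.
    by rewrite qE; ring.
  rewrite gtrace_gmul_sum // sA' sB' => ->.
  rewrite -(IH l (al + (n + k + l))%N (gtrace T) A' B') //; last 2 first.
  - by rewrite addn_gt0 al0.
  - exact: bisymmetric_gtrace.
  rewrite -/r; transitivity (al%:R * kap al%:R^-1 * r A' B'); first by rewrite natrD; ring.
  by rewrite natr_kapV // mul1r.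
rewrite (@eq_gmul_sum _ r); last by move=> A' B' A'E B'E; apply: tq; lia.
by rewrite qE mulrA natr_kapV // mul1r subrK.
Qed.

(** Taking the trace of the equation gives one of the same kind for [gtrace T]. *)
Lemma gmul_sum_inj_aux k l al T : (0 < al)%N -> bisymmetric T ->
  (forall A B, size A = k -> size B = l -> al%:R * T A B + gmul_sum (gtrace T) A B = 0) ->
  forall A B, size A = k -> size B = l -> T A B = 0.
Proof.
have base al' (x : S) : (0 < al')%N -> al'%:R * x = 0 -> x = 0.
  by case: al' => // al' _; rewrite mulr_natl; apply: natS_inj.
elim: k l al T => [|k IH] l al T al0 Ts H A B sA sB.
  by apply: (base al) => //; rewrite -(H A B) // gmul_sum_nil0 ?sA ?addr0.
case: l H sB => [|l] H sB.
  by apply: (base al) => //; rewrite -(H A B) // gmul_sum_nil0 ?sB ?orbT ?addr0.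
apply: (base al) => //; rewrite -[RHS](H A B) //.
rewrite [X in _ + X](_ : _ = 0) ?addr0 //.
rewrite (@eq_gmul_sum _ (fun _ _ => 0)).
  by apply: pick_sum0 => a A' _; apply: pick_sum0 => b B' _; rewrite mulr0.
move=> A' B' sA' sB'.
have {sA'} sA' : size A' = k by move: sA'; rewrite sA => -[].
have {sB'} sB' : size B' = l by move: sB'; rewrite sB => -[].
apply: (IH l (al + (n + k + l))%N (gtrace T)) sA' sB'.
- by rewrite addn_gt0 al0.
- exact: bisymmetric_gtrace.
move=> A1 B1 s1 s2.
have : gtrace (fun A B => al%:R * T A B + gmul_sum (gtrace T) A B) A1 B1 = 0.
  apply: big1 => a _; apply: big1 => b _.
  by rewrite H ?mulr0 /= ?s1 ?s2.
move=> <-; transitivity (al%:R * gtrace T A1 B1 + gtrace (gmul_sum (gtrace T)) A1 B1).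
  by rewrite gtrace_gmul_sum; [rewrite s1 s2 natrD; ring|exact: bisymmetric_gtrace].
rewrite /gtrace mulr_sumr -big_split; apply: eq_bigr => a _ /=.
by rewrite mulr_sumr -big_split; apply: eq_bigr => b _ /=; ring.
Qed.

(** The trace of a vanishing product is the equation of [gmul_sum_inj_aux] with
    [al = n + k + l]. *)
Lemma gmul_inj k l T : (0 < n)%N -> bisymmetric T ->
  (forall A B, size A = k.+1 -> size B = l.+1 -> gmul T A B = 0) ->
  forall A B, size A = k -> size B = l -> T A B = 0.
Proof.
move=> n0 Ts H; apply: (@gmul_sum_inj_aux k l (n + k + l)) => //.
  by rewrite !addn_gt0 n0.
move=> A B sA sB; have := gtrace_gmul_sum A B Ts; rewrite sA sB => <-.
apply: big1 => a _; apply: big1 => b _.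
suff -> : gmul_sum T (a :: A) (b :: B) = 0 by rewrite mulr0.
have := H (a :: A) (b :: B); rewrite gmulE /= sA sB => /(_ erefl erefl) h0.
transitivity ((k.+1%:R * kap k.+1%:R^-1) * (l.+1%:R * kap l.+1%:R^-1) * gmul_sum T (a
  :: A) (b :: B)).
  by rewrite !natr_kapV // !mul1r.
by rewrite rmorphM in h0; rewrite mulrACA -!mulrA [kap _ * (kap _ * _)]mulrA h0 !mulr0.
Qed.

(** The tensor whose product with the metric is to be subtracted from [T]. The
    factor undoes the normalization of [gmul]; [T] has one more index of each
    kind than [trace_quotient T]. *)
Definition trace_quotient T : seq 'I_n -> seq 'I_n -> S := fun A B =>
  ((size A).+1 * (size B).+1)%:R *
    fischer_solve (size A) (size B) (n + size A + size B) (gtrace T) A B.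

Lemma bisymmetric_trace_quotient T : bisymmetric T -> bisymmetric (trace_quotient T).
Proof.
move=> Ts A A' B B' AA' BB'; rewrite /trace_quotient (perm_size AA') (perm_size BB').
by congr (_ * _); apply: bisymmetric_fischer_solve => //; apply: bisymmetric_gtrace.
Qed.

Lemma gtrace_trace_quotient T A B : bisymmetric T ->
  gtrace (fun A B => T A B - gmul (trace_quotient T) A B) A B = 0.
Proof.
move=> Ts; case: (posnP n) => [n0|n0].
  by apply: big1 => a _; case: a => a a_n; exfalso; rewrite n0 in a_n.
set k := size A; set l := size B.
pose r := fischer_solve k l (n + k + l) (gtrace T).
transitivity (gtrace T A B - gtrace (gmul_sum r) A B).
  rewrite /gtrace -sumrB; apply: eq_bigr => a _; rewrite -sumrB; apply: eq_bigr => b _.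
  rewrite -mulrBr; congr (_ * (_ - _)); rewrite gmulE.
  rewrite (@eq_gmul_sum _ (fun A B => (k.+1 * l.+1)%:R * r A B)); last first.
    by move=> A' B' [sA] [sB]; rewrite /trace_quotient -sA -sB.
  rewrite gmul_sum_mull rmorphM /= -/k -/l.
  transitivity ((k.+1%:R * kap k.+1%:R^-1) * (l.+1%:R * kap l.+1%:R^-1) * gmul_sum r (a
    :: A) (b :: B)); last first.
    by rewrite !natr_kapV // !mul1r.
  by rewrite natrM; ring.
rewrite gtrace_gmul_sum; last by apply/bisymmetric_fischer_solve/bisymmetric_gtrace.
rewrite -(@fischer_solveP k l (n + k + l) (gtrace T) A B) ?subrr //; first by rewrite !addn_gt0 n0.
exact: bisymmetric_gtrace.
Qed.

(** If [Q] had larger order, the product of its symbol with the metric would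
    vanish, contrary to [gmul_inj]. *)
Lemma lap_divides M N Q : (0 < n)%N -> order_lt M Q ->
  order_lt N.+2 (fun f => Q (lap f)) -> order_lt N Q.
Proof.
move=> n0; elim: M => [|M IH] HQ HQl; first by apply: order_ltW HQ.
have [MN|NM] := leqP M.+1 N; first by apply: order_ltW HQ.
apply: IH => //.
have [q sq] := has_symbol_exists HQ; apply: (has_symbol0 sq) => m A B sN.
have q0 := has_symbol_uniq (has_symbol_lapr sq) (order_ltW (_ : N.+2 <= M.+2)%N HQl) _.
apply: (@gmul_inj (size A) (size B)) => //; first by case: sq => qs _; apply: qs.
by move=> A' B' sA sB; apply: q0; [lia|rewrite sA sB; lia].
Qed.

Definition symmetry_of D := (exists M, order_lt M D) /\
  exists delta M, order_lt M delta /\ forall f, delta (lap f) = lap (D f).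

(** The commutator is [Q lap] for [Q = delta - D], so its symbol is a pure trace.
    In dimension zero the symbol of the sub-Laplacian vanishes, but then there are
    no nonempty words. *)
Lemma bracket_equation N c D : symmetry_of D -> has_symbol N c D ->
  exists q, family_symmetric q /\ forall m A B, (size A + size B + m)%N = N.+1 ->
    (0 < size A + size B)%N -> bracket_symbol c m A B = gmul (q m) A B.
Proof.
move=> [_ [delta [M [Hdelta HD]]]] sD.
case: (posnP n) => [n0|n0].
  exists (fun _ _ _ => 0); split=> // m A B _ AB.
  have no_index (a : 'I_n) : False by case: a => a; rewrite n0.
  case: A AB => [|a A] AB; last by case: (no_index a).
  by case: B AB => [|b B] AB; last case: (no_index b).
have HDN := has_symbol_order sD.
pose Q f := delta f - D f.
have HQ : order_lt (maxn M N.+1) Q.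
  by apply: spannedB; [apply: order_ltW Hdelta|apply: order_ltW HDN]; rewrite ?leq_maxl ?leq_maxr.
have sB := has_symbol_bracket sD.
have sBQ : has_symbol N.+1 (bracket_symbol c) (fun f => Q (lap f)).
  by apply: has_symbol_ext sB => f; rewrite /Q HD.
have HQN : order_lt N Q by apply: (lap_divides n0 HQ); apply: has_symbol_order sBQ.
case: N sD HDN HQ sB sBQ HQN => [|N] sD HDN HQ sB sBQ HQN.
  exists (fun _ _ _ => 0); split=> // m A B sN _.
  have -> : gmul (fun _ _ => 0) A B = 0.
    by apply: pick_mean0 => a A' _; apply: pick_mean0 => b B' _; rewrite mulr0.
  apply: (has_symbol_uniq sBQ) => //.
  have [s [s0 Qs]] := HQN; apply: spanned_ext (spanned0 _) => f; rewrite Qs.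
  by case: s s0 {Qs} => [|t s] //; rewrite big_nil.
have [q sq] := has_symbol_exists HQN; exists q; split; first by case: sq.
move=> m A B sN _; apply/eqP; rewrite -subr_eq0; apply/eqP.
apply: (has_symbol_uniq (has_symbolB sBQ (has_symbol_lapr sq))) => //.
by apply: spanned_ext (spanned0 _) => f; rewrite subrr.
Qed.

(** * Reduction of symmetries modulo trivial ones *)

Definition vanish_below N s c := forall m A B, (size A + size B + m)%N = N ->
  (minn (size A) (size B) < s)%N -> c m A B = 0.
Definition trace_free_at N s c := forall m A B, (size A + size B + m).+2 = N ->
  (minn (size A) (size B)).+1 = s -> gtrace (c m) A B = 0.

Lemma symmetry_subr D Q M : symmetry_of D -> order_lt M Q ->
  symmetry_of (fun f => D f - Q (lap f)).
Proof.
move=> [[MD HD] [delta [Md [Hd dD]]]] HQ; split.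
  exists (maxn MD M.+2); apply: spannedB; first by apply: order_ltW HD; rewrite leq_maxl.
  by apply: order_ltW (order_lt_lapr HQ); rewrite leq_maxr.
exists (fun f => delta f - lap (Q f)), (maxn Md M.+2); split.
  apply: spannedB; first by apply: order_ltW Hd; rewrite leq_maxl.
  by apply: order_ltW (order_lt_lapl HQ); rewrite leq_maxr.
by move=> f; rewrite raddfB dD.
Qed.

(** Only the components with [min (k, l) = s] are corrected, and the correction
    does not reach those with smaller minimum. *)
Lemma trace_reduction N s c D : has_symbol N c D -> vanish_below N s c ->
  exists Q M c', [/\ order_lt M Q, has_symbol N c' (fun f => D f - Q (lap f)),
    vanish_below N s c' & trace_free_at N s c'].
Proof.
move=> sD vD; have [cs _] := sD.
case: (leqP 2 N) => [N2|N2]; last first.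
  exists (fun _ => 0), 0%N, c; split=> //; first exact: spanned0.
    by apply: has_symbol_ext sD => f; rewrite subr0.
  by move=> m A B sN; exfalso; lia.
case: N N2 sD vD => [|[|N]] // _ sD vD.
pose phi m A B := if (minn (size A) (size B)).+1 == s then trace_quotient (c m) A B else 0.
have phis : family_symmetric phi.
  move=> m A A' B B' AA' BB'; rewrite /phi (perm_size AA') (perm_size BB').
  by rewrite (bisymmetric_trace_quotient (cs m) AA' BB').
pose Q := family_op N.+1 (homogeneous_part N phi).
have HQ : order_lt N.+1 Q by apply/order_lt_family_op/supp_lt_homogeneous_part.
have sQ : has_symbol N phi Q.
  by split=> //; apply: spanned_ext (spanned0 _) => f; rewrite /Q subrr.
pose c' m A B := c m A B - gmul (phi m) A B.
have ptr_phi m A B : gmul (phi m) A B =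
    if minn (size A) (size B) == s then gmul (trace_quotient (c m)) A B else 0.
  case: ifP => mAB; last first.
    apply: pick_mean0 => a A' sA; apply: pick_mean0 => b B' sB.
    by rewrite /phi ifF ?mulr0 //; move: mAB; rewrite sA sB minnSS.
  case: s vD @phi phis @Q HQ sQ @c' mAB => [|s] vD phi phis Q HQ sQ c' mAB.
    apply: eq_pick_mean => a A' sA; apply: eq_pick_mean => b B' sB.
    by move: mAB; rewrite sA sB minnSS.
  apply: eq_pick_mean => a A' sA; apply: eq_pick_mean => b B' sB.
  by rewrite /phi; move: mAB; rewrite sA sB minnSS => ->.
exists Q, N.+1, c'; split=> //.
- exact: (has_symbolB sD (has_symbol_lapr sQ)).
- move=> m A B sN ms; rewrite /c' vD // ptr_phi ifN ?subr0 //.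
  by rewrite neq_ltn ms.
move=> m A B _ ms; rewrite -[RHS](gtrace_trace_quotient A B (cs m)).
apply: eq_bigr => a _; apply: eq_bigr => b _.
by rewrite /c' ptr_phi /= minnSS ms eqxx.
Qed.

Definition has_normal_form D :=
  (exists Q M, order_lt M Q /\ forall f, D f = Q (lap f)) \/
  exists Q M N s c, let P f := D f - Q (lap f) in
    [/\ order_lt M Q, symmetry_of P, has_symbol N c P,
        vanish_below N s c /\ trace_free_at N s c &
        exists m A B, [/\ (size A + size B + m)%N = N,
          minn (size A) (size B) = s & c m A B <> 0]].

(** Lexicographic induction on the order and on the number of admissible values
    of [s]: a vanishing trace-free part lets [s] grow, and for [s > N] the whole
    symbol vanishes. *)
Lemma symmetry_normal_form D : symmetry_of D -> has_normal_form D.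
Proof.
move=> symD; have [[N HD] _] := symD; elim: N D symD HD => [|N IH] D symD HD.
  left; exists (fun _ => 0), 0%N; split; first exact: spanned0.
  have [s [s0 Ds]] := HD => f; rewrite Ds.
  by case: s s0 {Ds} => [|t s] //; rewrite big_nil.
suff main j s D' c : (N.+1 - s <= j)%N -> symmetry_of D' ->
    has_symbol N c D' -> vanish_below N s c -> has_normal_form D'.
  by have [c sD] := has_symbol_exists HD; apply: (main N.+1 0%N D c).
elim: j s D' c {D symD HD} => [|j IHj] s D c Ns symD sD vs.
  apply: (IH D symD); apply: (has_symbol0 sD) => m A B sN; apply: vs => //.
  by rewrite minnE; lia.
have [Q [M [c' [HQ sP vP tP]]]] := trace_reduction sD vs.
have symP := symmetry_subr symD HQ.
have [nz|allz] := EM (exists m A B, [/\ (size A + size B + m)%N = N,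
          minn (size A) (size B) = s & c' m A B <> 0]).
  by right; exists Q, M, N, s, c'.
have vP' : vanish_below N s.+1 c'.
  move=> m A B sN; rewrite ltnS leq_eqVlt => /predU1P[ms|]; last exact: vP.
  by apply: contrapT => cn; apply: allz; exists m, A, B.
have [] := IHj s.+1 _ c' _ symP sP vP'; first by lia.
  move=> [Q' [M' [HQ' PQ']]]; left.
  exists (fun f => Q f + Q' f), (maxn M M'); split.
    by apply: spannedD; [apply: order_ltW HQ|apply: order_ltW HQ']; rewrite ?leq_maxl ?leq_maxr.
  by move=> f; rewrite -PQ' addrC subrK.
move=> [Q' [M' [N' [s' [c1 [HQ' symP' sP' vt' nz']]]]]]; right.
exists (fun f => Q f + Q' f), (maxn M M'), N', s', c1.
have E f : D f - Q (lap f) - Q' (lap f) = D f - (Q (lap f) + Q' (lap f)).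
  by rewrite opprD addrA.
split=> //.
- by apply: spannedD; [apply: order_ltW HQ|apply: order_ltW HQ']; rewrite ?leq_maxl ?leq_maxr.
- case: symP' => [[M1 HM1] [de [M2 [Hde Ede]]]]; split.
    by exists M1; apply: spanned_ext HM1.
  by exists de, M2; split=> // f; rewrite Ede E.
exact: has_symbol_ext sP'.
Qed.


(** * The first BGG equation *)

Definition is_leading (d s k l : nat) : bool := (k + l <= d)%N && (minn k l == s).

Definition leading_tensor d s c : seq 'I_n -> seq 'I_n -> S := fun A B =>
  if is_leading d s (size A) (size B) then c (d - size A - size B)%N A B else 0.

Lemma bisymmetric_leading d s c : family_symmetric c -> bisymmetric (leading_tensor d s c).
Proof.
move=> cs A A' B B' AA' BB'; rewrite /leading_tensor (perm_size AA') (perm_size BB').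
by rewrite (cs _ _ _ _ _ AA' BB').
Qed.

Lemma gtrace_leading d s c A B : trace_free_at d s c -> gtrace (leading_tensor d s c) A B = 0.
Proof.
move=> ct; rewrite /gtrace /leading_tensor /=.
case: (boolP (is_leading d s (size A).+1 (size B).+1)) => [|_]; last first.
  by apply: big1 => a _; apply: big1 => b _; rewrite mulr0.
rewrite /is_leading minnSS => /andP[sd /eqP ms]; apply: ct => //; lia.
Qed.

Section Iterates.
Variables (d s : nat) (c : nat -> seq 'I_n -> seq 'I_n -> S) (D : S -> S).
Hypotheses (symD : symmetry_of D) (sD : has_symbol d c D) (vD : vanish_below d s c).
Let V := leading_tensor d s c.

(** This is [bracket_equation] for [|B| = s < |A|]: the derivative in the barred
    direction involves only components with fewer than [s] barred indices, which
    vanish. For [|A| + s = d + 1] the tensor itself is zero. *)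
Lemma sym_up_leading : exists q, bisymmetric q /\
  forall A B, size B = s -> (s < size A)%N -> (size A + s <= d.+1)%N ->
    sym_up V A B = - kap (ii * ((size A)%:R - s%:R)) * V A B + gmul q A B.
Proof.
have [q0 [q0s E]] := bracket_equation symD sD.
exists (fun A B => q0 (d.+1 - (size A + size B).+2)%N A B); split.
  move=> A A' B B' AA' BB'; rewrite (perm_size AA') (perm_size BB').
  by rewrite (q0s _ _ _ _ _ AA' BB').
move=> A B sB sA sd; pose m := (d.+1 - (size A + size B))%N.
have := E m A B; rewrite /bracket_symbol => /(_ _ _) E'.
have -> : gmul (fun A B => q0 (d.+1 - (size A + size B).+2)%N A B) A B = gmul (q0 m) A B.
  apply: eq_pick_mean => a A' sA'; apply: eq_pick_mean => b B' sB'.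
  by rewrite /m sA' sB' addSn addnS.
rewrite -E'; [|rewrite /m; lia|lia].
have -> : sym_up V A B = sym_up (c m) A B.
  apply: eq_pick_mean => a A' sA'; congr (up a _).
  rewrite /V /leading_tensor ifT; last by rewrite /is_leading; apply/andP; split;
    [lia|apply/eqP; lia].
  by congr c; rewrite /m sA'; lia.
have -> : sym_upbar (c m) A B = 0.
  apply: pick_mean0 => b B' sB'; rewrite vD ?raddf0 //; first by rewrite /m; lia.
  by lia.
have -> : sigma_shift c m A B = kap (ii * ((size A)%:R - s%:R)) * V A B; last by ring.
rewrite /sigma_shift sB /V /leading_tensor; case Em: m => [|m'].
  by rewrite ifF // /is_leading; apply/negbTE; rewrite negb_and -ltnNge; apply/orP;
    left; move: Em; rewrite /m; lia.
rewrite ifT; last by rewrite /is_leading; apply/andP; split; [move: Em; rewrite /m;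
  lia|apply/eqP; lia].
by congr (_ * c _ _ _); move: Em; rewrite /m; lia.
Qed.

Lemma sym_upbar_leading : exists q, bisymmetric q /\
  forall A B, size A = s -> (s < size B)%N -> (size B + s <= d.+1)%N ->
    sym_upbar V A B = kap (ii * ((size B)%:R - s%:R)) * V A B + gmul q A B.
Proof.
have [q0 [q0s E]] := bracket_equation symD sD.
exists (fun A B => q0 (d.+1 - (size A + size B).+2)%N A B); split.
  move=> A A' B B' AA' BB'; rewrite (perm_size AA') (perm_size BB').
  by rewrite (q0s _ _ _ _ _ AA' BB').
move=> A B sA sB sd; pose m := (d.+1 - (size A + size B))%N.
have := E m A B; rewrite /bracket_symbol => /(_ _ _) E'.
have -> : gmul (fun A B => q0 (d.+1 - (size A + size B).+2)%N A B) A B = gmul (q0 m) A B.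
  apply: eq_pick_mean => a A' sA'; apply: eq_pick_mean => b B' sB'.
  by rewrite /m sA' sB' addSn addnS.
rewrite -E'; [|rewrite /m; lia|lia].
have -> : sym_upbar V A B = sym_upbar (c m) A B.
  apply: eq_pick_mean => b B' sB'; congr (upbar b _).
  rewrite /V /leading_tensor ifT; last by rewrite /is_leading; apply/andP; split;
    [lia|apply/eqP; lia].
  by congr c; rewrite /m sB'; lia.
have -> : sym_up (c m) A B = 0.
  apply: pick_mean0 => a A' sA'; rewrite vD ?raddf0 //; first by rewrite /m; lia.
  by lia.
have -> : sigma_shift c m A B = - kap (ii * ((size B)%:R - s%:R)) * V A B; last by ring.
rewrite /sigma_shift sA /V /leading_tensor -rmorphN -mulrN opprB; case Em: m => [|m'].
  by rewrite ifF // /is_leading; apply/negbTE; rewrite negb_and -ltnNge; apply/orP;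
    left; move: Em; rewrite /m; lia.
rewrite ifT; last by rewrite /is_leading; apply/andP; split; [move: Em; rewrite /m;
  lia|apply/eqP; lia].
by congr (_ * c _ _ _); move: Em; rewrite /m; lia.
Qed.

Lemma gmul_lin (u : C) T T' A B :
  gmul (fun A B => kap u * (T A B + T' A B)) A B = kap u * (gmul T A B + gmul T' A B).
Proof.
rewrite /gmul -pick_meanD -pick_mean_mull; apply: eq_pick_mean => a A' _.
rewrite -pick_meanD -pick_mean_mull; apply: eq_pick_mean => b B' _.
by rewrite -mulrDr mulrCA.
Qed.

Lemma kap_fact_step (u : C) k :
  kap (u ^+ k.+1 / k.+1`!%:R) = kap (u / k.+1%:R) * kap (u ^+ k / k`!%:R).
Proof.
by rewrite -rmorphM factS natrM invfM exprS; congr (kap _); ring.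
Qed.

(** The [k]-th step divides by [- i k], since [|A| - s = k] there; pure traces are
    carried along by [sym_up_gmul]. *)
Lemma iter_sym_up_leading k : (k + 2 * s <= d.+1)%N -> exists phi, bisymmetric phi /\
  forall A B, size A = (k + s)%N -> size B = s ->
    kap (ii ^+ k / k`!%:R) * iter k sym_up V A B = V A B + gmul phi A B.
Proof.
have [q [qs qE]] := sym_up_leading.
elim: k => [|k IH] ks.
  exists (fun _ _ => 0); split=> // A B _ _; rewrite /= expr0 fact0 divr1 rmorph1 mul1r.
  rewrite [X in _ + X](_ : _ = 0) ?addr0 //.
  by apply: pick_mean0 => a A' _; apply: pick_mean0 => b B' _; rewrite mulr0.
have [|phi [phis phiE]] := IH; first by lia.
exists (fun A B => kap (ii / k.+1%:R) * (q A B + sym_up phi A B)); split.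
  move=> A A' B B' AA' BB'.
  by rewrite (qs _ _ _ _ AA' BB') (bisymmetric_sym_up phis AA' BB').
move=> A B sA sB; rewrite gmul_lin kap_fact_step // -sym_up_gmul.
have H : kap (ii ^+ k / k`!%:R) * iter k.+1 sym_up V A B = sym_up V A B + sym_up (gmul phi) A B.
  rewrite -pick_mean_mull -pick_meanD; apply: eq_pick_mean => a A' sA'.
  by rewrite -up_cst -raddfD -phiE //=; lia.
rewrite -mulrA H qE //; [|lia|lia].
have Ek : kap (ii / k.+1%:R) * kap (ii * ((size A)%:R - s%:R)) = -1.
  have -> : (size A)%:R - s%:R = k.+1%:R :> C.
    by rewrite sA natrD addrK.
  by rewrite -rmorphM mulrACA ii2 mulVf ?pnatr_eq0 // mulr1 rmorphN1.
transitivity (- (kap (ii / k.+1%:R) * kap (ii * ((size A)%:R - s%:R))) * V A B +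
  kap (ii / k.+1%:R) * (gmul q A B + sym_up (gmul phi) A B)); first by ring.
by rewrite Ek opprK mul1r.
Qed.

Lemma iter_sym_upbar_leading k : (k + 2 * s <= d.+1)%N -> exists phi, bisymmetric phi /\
  forall A B, size A = s -> size B = (k + s)%N ->
    kap ((- ii) ^+ k / k`!%:R) * iter k sym_upbar V A B = V A B + gmul phi A B.
Proof.
have [q [qs qE]] := sym_upbar_leading.
elim: k => [|k IH] ks.
  exists (fun _ _ => 0); split=> // A B _ _; rewrite /= expr0 fact0 divr1 rmorph1 mul1r.
  rewrite [X in _ + X](_ : _ = 0) ?addr0 //.
  by apply: pick_mean0 => a A' _; apply: pick_mean0 => b B' _; rewrite mulr0.
have [|phi [phis phiE]] := IH; first by lia.
exists (fun A B => kap (- ii / k.+1%:R) * (q A B + sym_upbar phi A B)); split.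
  move=> A A' B B' AA' BB'.
  by rewrite (qs _ _ _ _ AA' BB') (bisymmetric_sym_upbar phis AA' BB').
have ii2' : - ii * - ii = -1 by rewrite mulrNN.
move=> A B sA sB; rewrite gmul_lin kap_fact_step // -sym_upbar_gmul.
have H : kap ((- ii) ^+ k / k`!%:R) * iter k.+1 sym_upbar V A B =
  sym_upbar V A B + sym_upbar (gmul phi) A B.
  rewrite -pick_mean_mull -pick_meanD; apply: eq_pick_mean => a B' sB'.
  by rewrite -upbar_cst -raddfD -phiE //=; lia.
rewrite -mulrA H qE //; [|lia|lia].
have Ek : kap (- ii / k.+1%:R) * kap (ii * ((size B)%:R - s%:R)) = 1.
  have -> : (size B)%:R - s%:R = k.+1%:R :> C.
    by rewrite sB natrD addrK.
  by rewrite -rmorphM mulrACA mulNr ii2 opprK mul1r mulVf ?pnatr_eq0 // rmorph1.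
transitivity ((kap (- ii / k.+1%:R) * kap (ii * ((size B)%:R - s%:R))) * V A B +
  kap (- ii / k.+1%:R) * (gmul q A B + sym_upbar (gmul phi) A B)); first by ring.
by rewrite Ek mul1r.
Qed.

End Iterates.

Definition lower_degree d s : pred mon_index := fun t =>
  (index_order t < d)%N ||
  ((index_order t == d) && (s < minn (size t.1.1) (size t.1.2))%N).

(** The leading coefficients are split by whether [min (k, l)] equals or exceeds
    [s]; in the former case the power of [Z] is determined by the words. *)
Lemma leading_decomposition d s c D : has_symbol d c D -> vanish_below d s c ->
  spanned (lower_degree d s) (fun f => D f -
    \sum_(k < d.+1) \sum_(l < d.+1 | is_leading d s k l)
      \sum_(A : k.-tuple 'I_n) \sum_(B : l.-tuple 'I_n)
        leading_tensor d s c A B * mon A B (d - k - l) f).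
Proof.
move=> [cs HD] vD; set V := leading_tensor d s c.
pose c1 m A B := if minn (size A) (size B) == s then homogeneous_part d c m A B else 0.
pose c2 m A B := if (s < minn (size A) (size B))%N then homogeneous_part d c m A B else 0.
have E1 f : family_op d.+1 c1 f = \sum_(k < d.+1) \sum_(l < d.+1 | is_leading d s k l)
      \sum_(A : k.-tuple 'I_n) \sum_(B : l.-tuple 'I_n) V A B * mon A B (d - k - l) f.
  rewrite /family_op -word_sum_sum.
  transitivity (word_sum d.+1 (fun A => word_sum d.+1 (fun B =>
      V A B * mon A B (d - size A - size B) f))).
    apply: eq_word_sum => A _; rewrite -word_sum_sum; apply: eq_word_sum => B _.
    rewrite /V /leading_tensor /is_leading /c1 /homogeneous_part.
    have [ms|ms] := eqVneq (minn (size A) (size B)) s; last first.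
      by rewrite andbF mul0r big1 // => m _; rewrite mul0r.
    rewrite andbT; case: leqP => sd; last first.
      rewrite mul0r big1 // => m _; rewrite ifN ?mul0r //.
      by rewrite neq_ltn (leq_trans sd) ?orbT // leq_addr.
    have mlt : (d - size A - size B < d.+1)%N by lia.
    rewrite (bigD1 (Ordinal mlt)) //= ifT; last by apply/eqP; lia.
    rewrite big1 ?addr0 // => m mm; rewrite ifN ?mul0r //.
    apply: contraNneq mm => sm; apply/eqP/val_inj => /=; lia.
  rewrite word_sum_tuple; apply: eq_bigr => k _.
  under eq_bigr => A _ do rewrite word_sum_tuple.
  rewrite exchange_big [RHS]big_mkcond; apply: eq_bigr => l _ /=.
  case: ifP => kl.
    apply: eq_bigr => A _; apply: eq_bigr => B _.
    by rewrite !size_tuple.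
  apply: big1 => A _; apply: big1 => B _.
  by rewrite /V /leading_tensor !size_tuple kl mul0r.
have E12 f : family_op d.+1 (homogeneous_part d c) f = family_op d.+1 c1 f + family_op d.+1 c2 f.
  rewrite -family_opD; apply: eq_family_op => m A B; rewrite /c1 /c2.
  case: ltngtP => ms; rewrite ?addr0 ?add0r //.
  by rewrite /homogeneous_part; case: eqP => // sm; rewrite vD.
apply: (spanned_ext (D :=
  fun f => (D f - family_op d.+1 (homogeneous_part d c) f) + family_op d.+1 c2 f)).
  by move=> f; rewrite -E1 E12; ring.
apply: spannedD; first by apply: spannedW HD => t td; apply/orP; left.
apply: spanned_sum => m; apply: spanned_word_sum => A; apply: spanned_word_sum => B.
rewrite /c2 /homogeneous_part; case: ifP => ms; last first.
  by apply: spanned_ext (spanned0 _) => f; rewrite mul0r.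
case: ifP => sm; last by apply: spanned_ext (spanned0 _) => f; rewrite mul0r.
by apply: spanned_term; rewrite /lower_degree /index_order /= sm ms orbT.
Qed.

Theorem symmetry_leading_part D : symmetry_of D ->
  (exists Q M, order_lt M Q /\ forall f, D f = Q (lap f)) \/
  exists Q M d s V, let P f := D f - Q (lap f) in
   [/\ order_lt M Q, symmetry_of P,
    [/\ (2 * s <= d)%N, bisymmetric V,
      forall A B, ~~ is_leading d s (size A) (size B) -> V A B = 0,
      forall A B, gtrace V A B = 0 &
      exists A B, is_leading d s (size A) (size B) /\ V A B <> 0],
    spanned (lower_degree d s) (fun f => P f -
    \sum_(k < d.+1) \sum_(l < d.+1 | is_leading d s k l)
      \sum_(A : k.-tuple 'I_n) \sum_(B : l.-tuple 'I_n)
        V A B * mon A B (d - k - l) f) &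
    forall k, (k + 2 * s <= d.+1)%N ->
     (exists phi, bisymmetric phi /\
       forall A B, size A = (k + s)%N -> size B = s ->
       kap (ii ^+ k / k`!%:R) * iter k sym_up V A B = V A B + gmul phi A B) /\
     (exists phi, bisymmetric phi /\
       forall A B, size A = s -> size B = (k + s)%N ->
       kap ((- ii) ^+ k / k`!%:R) * iter k sym_upbar V A B = V A B + gmul phi A B)].
Proof.
move=> symD; have [[Q [M HQ]]|] := symmetry_normal_form symD; first by left; exists Q, M.
move=> [Q [M [d [s [c [HQ symP sP [vP tP] [m [A [B [sd ms nz]]]]]]]]]]; right.
exists Q, M, d, s, (leading_tensor d s c).
have lead : is_leading d s (size A) (size B).
  by rewrite /is_leading ms eqxx andbT -sd leq_addr.
split=> //.
- split=> //.
  + by lia.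
  + by apply: bisymmetric_leading; case: sP.
  + by move=> A' B' /negbTE nl; rewrite /leading_tensor nl.
  + by move=> A' B'; apply: gtrace_leading.
  exists A, B; split=> //; rewrite /leading_tensor lead.
  by rewrite (_ : _ - _ = m)%N //; lia.
- exact: leading_decomposition.
move=> k ks; split; first exact: (iter_sym_up_leading symP sP vP ks).
exact: (iter_sym_upbar_leading symP sP vP ks).
Qed.

End Calculus.

Local Open Scope classical_set_scope.

(** * Symmetry of second directional derivatives *)

Section Schwarz.
Context {R : realType} {V : normedModType R}.
Implicit Types (f G : V -> R) (u v x : V).

Lemma is_derive_line f u w (t : R) : differentiable f (t *: u + w) ->
  is_derive t 1 (fun s : R => f (s *: u + w)) ('D_u f (t *: u + w)).
Proof.
move=> df.
have E : (fun h : R => h^-1 *: (((fun s : R => f (s *: u + w)) \o shift t) (h *: (1 :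
  R)) - f (t *: u + w))) =
   (fun h : R => h^-1 *: ((f \o shift (t *: u + w)) (h *: u) - f (t *: u + w))).
  apply/funext => h /=; congr (_ *: (f _ - _)).
  by rewrite [h *: 1]mulr1 scalerDl addrA.
split; last by rewrite /derive E.
by rewrite /derivable E; apply: diff_derivable.
Qed.

Lemma differentiable_eps G x : differentiable G x -> forall e : R, 0 < e ->
  \forall h \near (0 : V), `|G (h + x) - (G x + 'd G x h)| <= e * `|h|.
Proof.
by move=> /diff_locally /eqaddoP dG e e0; have := dG e e0.
Qed.

(** By the mean value theorem along [u] the second difference is [t] times an
    increment of ['D_u f], which the differential of ['D_u f] at [x] controls. *)
Lemma second_difference f u v x : (forall y, differentiable f y) ->
  differentiable ('D_u f) x -> forall e : R, 0 < e ->
  \forall t \near (0 : R)^'+,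
   `| (f (t *: u + (t *: v + x)) - f (t *: u + x) - (f (t *: v + x) - f x))
      - t ^+ 2 * 'D_v ('D_u f) x| <= e * t ^+ 2.
Proof.
move=> df dG e e0; set G := 'D_u f.
(* The two increments have norm at most t (|u| + |v|) and t |u|; the summand 1
   makes K positive. *)
pose K := `|u| + `|v| + `|u| + 1.
have nu := normr_ge0 u; have nv := normr_ge0 v.
have K0 : 0 < K by rewrite ltr_wpDl // !addr_ge0.
have e'0 : 0 < e / K by rewrite divr_gt0.
have /nbhs_ballP[r /= r0 Hr] := differentiable_eps dG e'0.
near=> t.
have t0 : 0 < t by [].
have tr : t * K < r.
  by rewrite -ltr_pdivlMr //; near: t; apply: nbhs_right_lt; rewrite divr_gt0.
pose phi (s : R) := f (s *: u + (t *: v + x)) - f (s *: u + x).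
have [] := @MVT R phi (fun s => G (s *: u + (t *: v + x)) - G (s *: u + x)) 0 t t0.
- by move=> s _; apply: is_deriveB; apply: is_derive_line.
- apply: continuous_subspaceT => s; apply: differentiable_continuous.
  by apply/derivable1_diffP/derivableB; apply: (@ex_derive _ _ _ _ _ _ _ (is_derive_line _)).
move=> s; rewrite in_itv /= => /andP[s0 st].
rewrite /phi !scale0r !add0r subr0 => ->.
have st' : `|s| <= t by rewrite ger0_norm ltW.
have B w : `|w| <= t * (`|u| + `|v|) -> `|G (w + x) - (G x + 'd G x w)| <= (e / K) * `|w|.
  move=> wK; apply: Hr; rewrite -ball_normE /= sub0r normrN.
  apply: le_lt_trans wK _; apply: le_lt_trans tr.
  by rewrite ler_pM2l // /K; lra.
have n1 : `|s *: u + t *: v| <= t * (`|u| + `|v|).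
  apply: le_trans (ler_normD _ _) _; rewrite !normrZ mulrDr (gtr0_norm t0).
  by rewrite lerD2r ler_wpM2r.
have n2 : `|s *: u| <= t * `|u|.
  by rewrite normrZ ler_wpM2r.
have B1 := B _ n1.
have B2 : `|G (s *: u + x) - (G x + 'd G x (s *: u))| <= (e / K) * `|s *: u|.
  by apply: B; apply: le_trans n2 _; rewrite ler_pM2l //; lra.
rewrite (deriveE _ dG) addrA.
have -> : (G (s *: u + t *: v + x) - G (s *: u + x)) * t - t ^+ 2 * 'd G x v =
   t * ((G (s *: u + t *: v + x) - (G x + 'd G x (s *: u + t *: v))) -
        (G (s *: u + x) - (G x + 'd G x (s *: u)))).
  have L k w : 'd G x (k *: w) = k * 'd G x w by rewrite linearZ.
  have LD w1 w2 : 'd G x (w1 + w2) = 'd G x w1 + 'd G x w2 by rewrite linearD.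
  by rewrite LD !L; ring.
rewrite normrM (gtr0_norm t0) expr2 mulrCA ler_pM2l //.
apply: le_trans (ler_normB _ _) _.
apply: le_trans (lerD B1 B2) _.
rewrite -mulrDr -mulrA; apply: ler_wpM2l; first exact: ltW.
rewrite mulrC -ler_pdivlMr ?invr_gt0 // invrK.
by apply: le_trans (lerD n1 n2) _; rewrite -mulrDr ler_pM2l // /K; lra.
Unshelve. all: by end_near. Qed.

(** The second difference does not change when [u] and [v] are exchanged, so its
    two asymptotic values agree. *)
Lemma derive_comm f u v x : (forall y, differentiable f y) ->
  differentiable ('D_u f) x -> differentiable ('D_v f) x ->
  'D_v ('D_u f) x = 'D_u ('D_v f) x.
Proof.
move=> df du dv; apply/eqP; rewrite -subr_eq0 -normr_le0; apply/ler_addgt0Pl => e e0; rewrite addr0.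
have e20 : 0 < e / 2 by rewrite divr_gt0.
have [t [[H1 H2] t0]] := filter_ex (filterI
  (filterI (second_difference v df du e20) (second_difference u df dv e20))
  (nbhs_right_gt (0 : R))).
have t2 : 0 < t ^+ 2 by rewrite exprn_gt0.
rewrite -(ler_pM2l t2) -{1}(gtr0_norm t2) -normrM.
rewrite [t *: v + (t *: u + x)]addrCA in H2.
move: H1 H2; move: (f _) (f _) (f _) (f _) ('D_v _ _) ('D_u _ _) => d c b a p q H1 H2.
have -> : t ^+ 2 * (p - q) = (a - c - (b - d) - t ^+ 2 * q) -
    (a - b - (c - d) - t ^+ 2 * p) by ring.
apply: le_trans (ler_normB _ _) _; apply: le_trans (lerD H2 H1) _.
by rewrite -mulrDl -splitr mulrC.
Qed.

End Schwarz.

Local Close Scope classical_set_scope.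

Local Open Scope complex_scope.

(** * Smooth functions *)

Section SmoothReal.
Context {R : realType} {n : nat}.
Local Notation M := ('rV[R]_n * 'rV[R]_n * R)%type.
Implicit Types (h k : M -> R).

(** Smoothness asks for derivatives of all orders, so it is shown by exhibiting a
    class of differentiable functions that is closed under derivation. *)
Lemma smooth_real_coind (P : (M -> R) -> Prop) :
  (forall h, P h -> forall x, differentiable h x) ->
  (forall h v, P h -> P ('D_v h)) -> forall h, P h -> smooth_real h.
Proof.
move=> Pd PD h Ph vs x; apply: Pd; elim: vs => //= v vs IH; exact: PD.
Qed.

Lemma smooth_real_differentiable h x : smooth_real h -> differentiable h x.
Proof. by move=> /(_ [::] x). Qed.

Lemma smooth_real_derive h v : smooth_real h -> smooth_real ('D_v h).
Proof. by move=> sh vs x; have := sh (rcons vs v) x; rewrite foldr_rcons. Qed.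

Lemma smooth_real_cst (r : R) : smooth_real (cst r : M -> R).
Proof.
apply: (@smooth_real_coind (fun h => exists r, h = cst r)); last by exists r.
  by move=> h [s ->] x; apply: differentiable_cst.
move=> h v [s ->]; exists 0; apply/funext => x; exact: derive_cst.
Qed.

Lemma derive_linear (l : {linear M -> R}) v : continuous l -> 'D_v l = cst (l v).
Proof.
move=> lc; apply/funext => x; rewrite deriveE; last exact: linear_differentiable.
by rewrite diff_lin.
Qed.

Lemma smooth_real_linear (l : {linear M -> R}) : continuous l -> smooth_real l.
Proof.
move=> lc.
apply: (@smooth_real_coind (fun h => h = l \/ exists r, h = cst r)); last by left.
  move=> h [->|[s ->]] x; [exact: linear_differentiable|exact: differentiable_cst].
move=> h v [->|[s ->]]; right; first by exists (l v); rewrite derive_linear.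
by exists 0; apply/funext => x; apply: derive_cst.
Qed.

(** The derivative of a product is a sum of products; a class containing both is
    needed to apply [smooth_real_coind] to either. *)
Inductive smooth_gen : (M -> R) -> Prop :=
| smooth_gen_base h : smooth_real h -> smooth_gen h
| smooth_gen_add h k : smooth_gen h -> smooth_gen k -> smooth_gen (h + k)
| smooth_gen_mul h k : smooth_gen h -> smooth_gen k -> smooth_gen (h * k).

Lemma smooth_gen_differentiable h x : smooth_gen h -> differentiable h x.
Proof.
elim=> [{}h sh|{}h k _ dh _ dk|{}h k _ dh _ dk].
- exact: smooth_real_differentiable.
- exact: differentiableD.
exact: differentiableM.
Qed.

Lemma deriveD_fun h k v : (forall x, differentiable h x) ->
  (forall x, differentiable k x) -> 'D_v (h + k) = 'D_v h + 'D_v k.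
Proof. by move=> dh dk; apply/funext => x; rewrite deriveD //; apply: diff_derivable. Qed.

Lemma deriveM_fun h k v : (forall x, differentiable h x) ->
  (forall x, differentiable k x) -> 'D_v (h * k) = 'D_v h * k + h * 'D_v k.
Proof.
move=> dh dk; apply/funext => x; rewrite deriveM; try exact: diff_derivable.
by rewrite addrC [X in X + _]mulrC.
Qed.

Lemma smooth_gen_smooth h : smooth_gen h -> smooth_real h.
Proof.
move: h; apply: smooth_real_coind; first by move=> h sh x; apply: smooth_gen_differentiable.
move=> h v; elim=> [{}h sh|{}h k sh IHh sk IHk|{}h k sh IHh sk IHk].
- exact/smooth_gen_base/smooth_real_derive.
- rewrite deriveD_fun; try by move=> x; apply: smooth_gen_differentiable.
  exact: smooth_gen_add.
rewrite deriveM_fun; try by move=> x; apply: smooth_gen_differentiable.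
by apply: smooth_gen_add; apply: smooth_gen_mul.
Qed.

Lemma smooth_realD h k : smooth_real h -> smooth_real k -> smooth_real (h + k).
Proof. by move=> sh sk; apply/smooth_gen_smooth/smooth_gen_add; apply: smooth_gen_base. Qed.

Lemma smooth_realM h k : smooth_real h -> smooth_real k -> smooth_real (h * k).
Proof. by move=> sh sk; apply/smooth_gen_smooth/smooth_gen_mul; apply: smooth_gen_base. Qed.

Lemma smooth_realN h : smooth_real h -> smooth_real (- h).
Proof.
move=> sh; have -> : - h = cst (-1) * h.
  by apply/funext => x; rewrite [RHS]mulN1r.
by apply: smooth_realM => //; apply: smooth_real_cst.
Qed.

Lemma smooth_real_derive_comm h u v : smooth_real h -> 'D_u ('D_v h) = 'D_v ('D_u h).
Proof.
move=> sh; apply/funext => x; apply: derive_comm.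
- by move=> y; apply: smooth_real_differentiable.
- exact/smooth_real_differentiable/smooth_real_derive.
exact/smooth_real_differentiable/smooth_real_derive.
Qed.

Definition coord_re (a : 'I_n) (x : M) : R := x.1.1 0 a.
Definition coord_im (a : 'I_n) (x : M) : R := x.1.2 0 a.
Definition coord_sigma (x : M) : R := x.2.

Lemma coord_re_linear a : linear (coord_re a).
Proof. by move=> r u v; rewrite /coord_re /= !mxE. Qed.
HB.instance Definition _ a := GRing.isLinear.Build R M R _ (coord_re a) (coord_re_linear a).
Lemma coord_im_linear a : linear (coord_im a).
Proof. by move=> r u v; rewrite /coord_im /= !mxE. Qed.
HB.instance Definition _ a := GRing.isLinear.Build R M R _ (coord_im a) (coord_im_linear a).
Lemma coord_sigma_linear : linear coord_sigma.
Proof. by []. Qed.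
HB.instance Definition _ := GRing.isLinear.Build R M R _ coord_sigma coord_sigma_linear.

Lemma coord_re_continuous a : continuous (coord_re a).
Proof.
move=> x; apply: (@continuous_comp _ _ _ (fun x : M => x.1.1) (fun N : 'rV[R]_n => N 0 a)).
  by apply: (@continuous_comp _ _ _ fst fst); apply: cvg_fst.
exact: coord_continuous.
Qed.
Lemma coord_im_continuous a : continuous (coord_im a).
Proof.
move=> x; apply: (@continuous_comp _ _ _ (fun x : M => x.1.2) (fun N : 'rV[R]_n => N 0 a)).
  by apply: (@continuous_comp _ _ _ fst snd); [apply: cvg_fst|apply: cvg_snd].
exact: coord_continuous.
Qed.
Lemma coord_sigma_continuous : continuous coord_sigma.
Proof. by move=> x; apply: cvg_snd. Qed.

End SmoothReal.

Section SmoothRing.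
Context {R : realType} {n : nat}.
Local Notation C := (R[i]).
Local Notation M := ('rV[R]_n * 'rV[R]_n * R)%type.
Implicit Types (f h : M -> C).

Definition re f : M -> R := fun x => complex.Re (f x).
Definition im f : M -> R := fun x => complex.Im (f x).

Lemma eq_re_im f h : re f = re h -> im f = im h -> f = h.
Proof.
move=> rfh ifh; apply/funext => x.
have := congr1 (@^~ x) rfh; have := congr1 (@^~ x) ifh; rewrite /re /im.
by case: (f x) (h x) => a b [c d] /= -> ->.
Qed.

Lemma reD f h : re (f + h) = re f + re h.
Proof. by apply/funext => x; rewrite /re /GRing.add /=; case: (f x) (h x) => a b []. Qed.
Lemma imD f h : im (f + h) = im f + im h.
Proof. by apply/funext => x; rewrite /im /GRing.add /=; case: (f x) (h x) => a b []. Qed.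
Lemma reN f : re (- f) = - re f.
Proof. by apply/funext => x; rewrite /re /GRing.opp /=; case: (f x). Qed.
Lemma imN f : im (- f) = - im f.
Proof. by apply/funext => x; rewrite /im /GRing.opp /=; case: (f x). Qed.
Lemma reM f h : re (f * h) = re f * re h - im f * im h.
Proof.
apply/funext => x; rewrite -[LHS]/(complex.Re (f x * h x)).
rewrite -[RHS]/(complex.Re (f x) * complex.Re (h x) - complex.Im (f x) * complex.Im (h x)).
by case: (f x) (h x) => a b [].
Qed.
Lemma imM f h : im (f * h) = re f * im h + im f * re h.
Proof.
apply/funext => x; rewrite -[LHS]/(complex.Im (f x * h x)).
rewrite -[RHS]/(complex.Re (f x) * complex.Im (h x) + complex.Im (f x) * complex.Re (h x)).
by case: (f x) (h x) => a b [].
Qed.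

Lemma smoothD f h : smooth f -> smooth h -> smooth (f + h).
Proof.
by move=> [rf jf] [rh jh]; split; [rewrite -/(re _) reD|rewrite -/(im _) imD];
  apply: smooth_realD.
Qed.
Lemma smoothN f : smooth f -> smooth (- f).
Proof.
by move=> [rf jf]; split; [rewrite -/(re _) reN|rewrite -/(im _) imN];
  apply: smooth_realN.
Qed.
Lemma smoothM f h : smooth f -> smooth h -> smooth (f * h).
Proof.
move=> [rf jf] [rh jh]; split; [rewrite -/(re _) reM|rewrite -/(im _) imM].
  by apply: smooth_realD; [|apply: smooth_realN]; apply: smooth_realM.
by apply: smooth_realD; apply: smooth_realM.
Qed.
Lemma smooth_cst (c : C) : smooth (cst c : M -> C).
Proof. by split; apply: smooth_real_cst. Qed.

Lemma re_cderive v f : re (cderive v f) = 'D_v (re f).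
Proof. by []. Qed.
Lemma im_cderive v f : im (cderive v f) = 'D_v (im f).
Proof. by []. Qed.

Lemma smooth_cderive v f : smooth f -> smooth (cderive v f).
Proof. by move=> [rf jf]; split; apply: smooth_real_derive. Qed.

Lemma cderiveD v f h : smooth f -> smooth h ->
  cderive v (f + h) = cderive v f + cderive v h.
Proof.
move=> [rf jf] [rh jh]; apply: eq_re_im.
  rewrite reD !re_cderive reD deriveD_fun // => x; exact: smooth_real_differentiable.
rewrite imD !im_cderive imD deriveD_fun // => x; exact: smooth_real_differentiable.
Qed.

Lemma cderiveM v f h : smooth f -> smooth h ->
  cderive v (f * h) = cderive v f * h + f * cderive v h.
Proof.
move=> [rf jf] [rh jh].
have dif k x : smooth_real k -> differentiable (k : M -> R) x.
  by move=> sk; apply: smooth_real_differentiable.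
have dM k l x : smooth_real k -> smooth_real l -> differentiable (k * l : M -> R) x.
  by move=> sk sl; apply/dif/smooth_realM.
have DM k l : smooth_real k -> smooth_real l ->
    'D_v (k * l) = 'D_v k * l + k * 'D_v l :> (M -> R).
  by move=> sk sl; apply: deriveM_fun => x; apply: dif.
apply: eq_re_im.
  rewrite reD !reM !re_cderive !im_cderive reM deriveD_fun; try by move=> x;
    apply: dM || (apply/dif/smooth_realN/smooth_realM).
  have -> : 'D_v (- (im f * im h)) = - 'D_v (im f * im h).
    by apply/funext => x; rewrite deriveN //; apply/diff_derivable/dM.
  rewrite (DM (re f) (re h)) // (DM (im f) (im h)) //.
  by rewrite opprD addrACA.
rewrite imD !imM !re_cderive !im_cderive imM deriveD_fun; try by move=> x; apply: dM.
rewrite (DM (re f) (im h)) // (DM (im f) (re h)) //.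
by rewrite addrACA.
Qed.

Lemma cderive_cst v (c : C) : cderive v (cst c : M -> C) = 0.
Proof. by apply/eq_re_im; apply/funext => x; apply: derive_cst. Qed.

Lemma cderive_comm u v f : smooth f -> cderive u (cderive v f) = cderive v (cderive u f).
Proof. by move=> [rf jf]; apply/eq_re_im; apply: smooth_real_derive_comm. Qed.

Definition smooth_pred : {pred M -> C} := fun f => `[< smooth f >].

Lemma smooth_subring : subring_closed smooth_pred.
Proof.
split=> [|f h /asboolP sf /asboolP sh|f h /asboolP sf /asboolP sh]; apply/asboolP.
- exact: smooth_cst.
- by apply: smoothD => //; apply: smoothN.
exact: smoothM.
Qed.
HB.instance Definition _ := GRing.isSubringClosed.Build (M -> C) smooth_pred smooth_subring.

Record smooth_fun := SmoothFun { sval_fun :> M -> C; _ : sval_fun \in smooth_pred }.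
HB.instance Definition _ := [isSub for sval_fun].
HB.instance Definition _ := [Choice of smooth_fun by <:].
HB.instance Definition _ := GRing.SubChoice_isSubComPzRing.Build _ _ smooth_fun smooth_subring.

Lemma smooth_funP (f : smooth_fun) : smooth f.
Proof. by apply/asboolP; case: f. Qed.

Definition mk_smooth f (sf : smooth f) : smooth_fun := SmoothFun (asboolT sf).

Lemma smooth_fun_eq (f h : smooth_fun) : (forall x, f x = h x) -> f = h.
Proof. by move=> fh; apply/val_inj/funext. Qed.

End SmoothRing.

(** * The frame on the hypersurface *)

Section HeisenbergFields.
Context {R : realType} {n : nat}.
Local Notation C := (R[i]).
Local Notation M := ('rV[R]_n * 'rV[R]_n * R)%type.
Local Notation S := (@smooth_fun R n).
Implicit Types (f h : S).

Definition constant (c : C) : S := mk_smooth (smooth_cst c).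

Lemma constant_zmod : zmod_morphism constant.
Proof. by move=> c d; apply: smooth_fun_eq. Qed.
HB.instance Definition _ := GRing.isZmodMorphism.Build C S constant constant_zmod.
Lemma constant_monoid : monoid_morphism constant.
Proof. by split=> [|c d]; apply: smooth_fun_eq. Qed.
HB.instance Definition _ := GRing.isMonoidMorphism.Build C S constant constant_monoid.

Definition sderive (v : M) f : S := mk_smooth (smooth_cderive v (smooth_funP f)).

Lemma sderive_additive v : zmod_morphism (sderive v).
Proof.
move=> f h; apply/val_inj => /=; apply/eqP; rewrite -[X in X == _](addrK (cderive v h)).
have sf := smooth_funP f; have sh := smooth_funP h.
rewrite -cderiveD ?subrK //; exact: smoothD sf (smoothN sh).
Qed.
HB.instance Definition _ v := GRing.isZmodMorphism.Build S S (sderive v) (sderive_additive v).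

Lemma sderive_mul v f h : sderive v (f * h) = sderive v f * h + f * sderive v h.
Proof. by apply/val_inj; rewrite /= cderiveM //; apply: smooth_funP. Qed.

Lemma sderive_constant v c : sderive v (constant c) = 0.
Proof. by apply/val_inj; rewrite /= cderive_cst. Qed.

Lemma sderive_comm u v f : sderive u (sderive v f) = sderive v (sderive u f).
Proof. by apply/val_inj; apply/cderive_comm/smooth_funP. Qed.

Lemma smooth_coord_re a : smooth_real (@coord_re R n a).
Proof. exact: smooth_real_linear (@coord_re_continuous R n a). Qed.
Lemma smooth_coord_im a : smooth_real (@coord_im R n a).
Proof. exact: smooth_real_linear (@coord_im_continuous R n a). Qed.
Lemma smooth_coord_s : smooth_real (@coord_sigma R n).
Proof. exact: smooth_real_linear (@coord_sigma_continuous R n). Qed.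

Lemma smooth_coord_z a : smooth (fun x : M => coord_re a x +i* coord_im a x).
Proof.
by split; [exact: smooth_coord_re|exact: smooth_coord_im].
Qed.
Lemma smooth_coord_zbar a : smooth (fun x : M => coord_re a x +i* - coord_im a x).
Proof.
split; first exact: smooth_coord_re.
exact: (smooth_realN (smooth_coord_im a)).
Qed.
Lemma smooth_coord_sigma : smooth (fun x : M => coord_sigma x +i* 0).
Proof.
split; first exact: smooth_coord_s.
exact: (smooth_real_cst 0).
Qed.

Definition sz a : S := mk_smooth (smooth_coord_z a).
Definition szbar a : S := mk_smooth (smooth_coord_zbar a).
Definition ssigma : S := mk_smooth smooth_coord_sigma.

Lemma sderive_sz v a : sderive v (sz a) = constant (v.1.1 0 a +i* v.1.2 0 a).
Proof.
apply/val_inj/eq_re_im => /=.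
  by rewrite re_cderive [LHS](derive_linear v (@coord_re_continuous R n a)).
by rewrite im_cderive [LHS](derive_linear v (@coord_im_continuous R n a)).
Qed.

Lemma sderive_szbar v a : sderive v (szbar a) = constant (v.1.1 0 a +i* - v.1.2 0 a).
Proof.
apply/val_inj/eq_re_im => /=.
  by rewrite re_cderive [LHS](derive_linear v (@coord_re_continuous R n a)).
rewrite im_cderive; apply/funext => x; rewrite [LHS]deriveN; last first.
  exact/diff_derivable/linear_differentiable/(@coord_im_continuous R n a).
rewrite -[RHS]/(- (v.1.2 0 a)); congr (- _).
exact: (congr1 (@^~ x) (derive_linear v (@coord_im_continuous R n a))).
Qed.

Lemma sderive_ssigma v : sderive v ssigma = constant (v.2 +i* 0).
Proof.
apply/val_inj/eq_re_im => /=.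
  by rewrite re_cderive [LHS](derive_linear v (@coord_sigma_continuous R n)).
by rewrite im_cderive; apply/funext => x; apply: derive_cst.
Qed.

Local Notation kap := constant.
Definition half : S := kap 2%:R^-1.
Definition imag : S := kap 'i.
Definition swirtinger (a : 'I_n) f : S := half * (sderive (dRe a) f - imag * sderive (dIm a) f).
Definition swirtinger_bar (a : 'I_n) f : S := half * (sderive (dRe a) f + imag * sderive (dIm a) f).
Definition sdsigma f : S := sderive (0, 0, 1) f.

Lemma imag_imag : imag * imag = -1.
Proof. by rewrite -rmorphM -expr2 sqrCi rmorphN1. Qed.

Lemma swirtinger_additive a : zmod_morphism (swirtinger a).
Proof. by move=> f h; rewrite /swirtinger !raddfB /=; ring. Qed.
HB.instance Definition _ a := GRing.isZmodMorphism.Build S S (swirtinger a) (swirtinger_additive a).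
Lemma swirtinger_bar_additive a : zmod_morphism (swirtinger_bar a).
Proof. by move=> f h; rewrite /swirtinger_bar !raddfB /=; ring. Qed.
HB.instance Definition _ a :=
  GRing.isZmodMorphism.Build S S (swirtinger_bar a) (swirtinger_bar_additive a).
Lemma sdsigma_additive : zmod_morphism sdsigma.
Proof. exact: sderive_additive. Qed.
HB.instance Definition _ := GRing.isZmodMorphism.Build S S sdsigma sdsigma_additive.

Lemma swirtinger_mul a f h : swirtinger a (f * h) = swirtinger a f * h + f * swirtinger a h.
Proof. by rewrite /swirtinger !sderive_mul; ring. Qed.
Lemma swirtinger_bar_mul a f h : swirtinger_bar a (f * h) =
  swirtinger_bar a f * h + f * swirtinger_bar a h.
Proof. by rewrite /swirtinger_bar !sderive_mul; ring. Qed.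
Lemma sdsigma_mul f h : sdsigma (f * h) = sdsigma f * h + f * sdsigma h.
Proof. exact: sderive_mul. Qed.
Lemma swirtinger_cst a c : swirtinger a (kap c) = 0.
Proof. by rewrite /swirtinger !sderive_constant; ring. Qed.
Lemma swirtinger_bar_cst a c : swirtinger_bar a (kap c) = 0.
Proof. by rewrite /swirtinger_bar !sderive_constant; ring. Qed.
Lemma sdsigma_cst c : sdsigma (kap c) = 0.
Proof. exact: sderive_constant. Qed.

Lemma sderive_kap v c f : sderive v (kap c * f) = kap c * sderive v f.
Proof. by rewrite sderive_mul sderive_constant mul0r add0r. Qed.

Lemma sderive_swirtinger v a f : sderive v (swirtinger a f) = swirtinger a (sderive v f).
Proof. by rewrite /swirtinger sderive_kap raddfB /= sderive_kap ![sderive v (sderive _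
  f)]sderive_comm. Qed.
Lemma sderive_swirtinger_bar v a f : sderive v (swirtinger_bar a f) =
  swirtinger_bar a (sderive v f).
Proof. by rewrite /swirtinger_bar sderive_kap raddfD /= sderive_kap ![sderive v
  (sderive _ f)]sderive_comm. Qed.

Lemma swirtinger_kap a c f : swirtinger a (kap c * f) = kap c * swirtinger a f.
Proof. by rewrite swirtinger_mul swirtinger_cst mul0r add0r. Qed.
Lemma swirtinger_bar_kap a c f : swirtinger_bar a (kap c * f) = kap c * swirtinger_bar a f.
Proof. by rewrite swirtinger_bar_mul swirtinger_bar_cst mul0r add0r. Qed.
Lemma sdsigma_kap c f : sdsigma (kap c * f) = kap c * sdsigma f.
Proof. exact: sderive_kap. Qed.

Lemma swirtinger_swirtinger a b f : swirtinger a (swirtinger b f) = swirtinger b (swirtinger a f).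
Proof.
rewrite [LHS]/swirtinger !sderive_swirtinger.
by rewrite [swirtinger a f]/swirtinger swirtinger_kap raddfB /= swirtinger_kap.
Qed.
Lemma swirtinger_bar_swirtinger_bar a b f : swirtinger_bar a (swirtinger_bar b f) =
  swirtinger_bar b (swirtinger_bar a f).
Proof.
rewrite [LHS]/swirtinger_bar !sderive_swirtinger_bar.
by rewrite [swirtinger_bar a f]/swirtinger_bar swirtinger_bar_kap raddfD /= swirtinger_bar_kap.
Qed.
Lemma swirtinger_bar_swirtinger a b f : swirtinger_bar a (swirtinger b f) =
  swirtinger b (swirtinger_bar a f).
Proof.
rewrite [LHS]/swirtinger_bar !sderive_swirtinger.
by rewrite [swirtinger_bar a f]/swirtinger_bar swirtinger_kap raddfD /= swirtinger_kap.
Qed.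
Lemma sdsigma_swirtinger a f : sdsigma (swirtinger a f) = swirtinger a (sdsigma f).
Proof. exact: sderive_swirtinger. Qed.
Lemma sdsigma_swirtinger_bar a f : sdsigma (swirtinger_bar a f) = swirtinger_bar a (sdsigma f).
Proof. exact: sderive_swirtinger_bar. Qed.

Lemma half2 : half *+ 2 = 1.
Proof. by rewrite -raddfMn /= -[_ *+ 2]mulr_natr mulVf ?pnatr_eq0 // rmorph1. Qed.

Lemma sderive_dRe_sz a b : sderive (dRe a) (sz b) = (a == b)%:R.
Proof. by rewrite sderive_sz /= !mxE /= eq_sym -(rmorph_nat kap); case: eqP. Qed.
Lemma sderive_dIm_sz a b : sderive (dIm a) (sz b) = imag * (a == b)%:R.
Proof.
rewrite sderive_sz /= !mxE /= eq_sym -(rmorph_nat kap) -rmorphM; congr kap.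
by case: eqP; rewrite ?mulr1 ?mulr0.
Qed.
Lemma sderive_dRe_szbar a b : sderive (dRe a) (szbar b) = (a == b)%:R.
Proof. by rewrite sderive_szbar /= !mxE /= oppr0 eq_sym -(rmorph_nat kap); case: eqP. Qed.
Lemma sderive_dIm_szbar a b : sderive (dIm a) (szbar b) = - imag * (a == b)%:R.
Proof.
rewrite sderive_szbar /= !mxE /= eq_sym -(rmorph_nat kap) -rmorphN -rmorphM; congr kap.
case: eqP => _; rewrite ?mulr1 ?mulr0 ?oppr0 //.
by apply/eqP; rewrite eq_complex /= oppr0 !eqxx.
Qed.

Lemma swirtinger_sz a b : swirtinger a (sz b) = (a == b)%:R.
Proof.
rewrite /swirtinger sderive_dRe_sz sderive_dIm_sz mulrA imag_imag mulN1r opprK -mulr2n mulrnAr.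
by rewrite -mulrnAl half2 mul1r.
Qed.
Lemma swirtinger_bar_sz a b : swirtinger_bar a (sz b) = 0.
Proof. by rewrite /swirtinger_bar sderive_dRe_sz sderive_dIm_sz mulrA imag_imag mulN1r
  subrr mulr0. Qed.
Lemma swirtinger_szbar a b : swirtinger a (szbar b) = 0.
Proof.
by rewrite /swirtinger sderive_dRe_szbar sderive_dIm_szbar mulrA mulrN imag_imag opprK
  mul1r subrr mulr0.
Qed.
Lemma swirtinger_bar_szbar a b : swirtinger_bar a (szbar b) = (a == b)%:R.
Proof.
rewrite /swirtinger_bar sderive_dRe_szbar sderive_dIm_szbar mulrA mulrN imag_imag opprK mul1r.
by rewrite -mulr2n mulrnAr -mulrnAl half2 mul1r.
Qed.
Lemma sdsigma_sz b : sdsigma (sz b) = 0.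
Proof. by rewrite /sdsigma sderive_sz /= !mxE rmorph0. Qed.
Lemma sdsigma_szbar b : sdsigma (szbar b) = 0.
Proof. by rewrite /sdsigma sderive_szbar /= !mxE oppr0 rmorph0. Qed.
Lemma sdsigma_ssigma : sdsigma ssigma = 1.
Proof. by rewrite /sdsigma sderive_ssigma /= -(rmorph1 kap). Qed.

Variable g : 'M[C]_n.
Hypothesis g_herm : g \is hermsymmx.

Lemma g_conj a b : (g a b)^* = g b a.
Proof.
have /is_hermitianmxP := g_herm; rewrite expr0 scale1r => /matrixP/(_ b a).
by rewrite !mxE => ->.
Qed.

Definition szlow a : S := \sum_b kap (g b a) * szbar b.
Definition szlow_conj a : S := \sum_b kap (g b a)^* * sz b.

Lemma sum_delta_kap (F : 'I_n -> C) a : \sum_b kap (F b) * (a == b)%:R = kap (F a).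
Proof.
rewrite (bigD1 a) //= eqxx mulr1 big1 ?addr0 // => b.
by rewrite eq_sym => /negbTE ->; rewrite mulr0.
Qed.

Lemma swirtinger_szlow a b : swirtinger a (szlow b) = 0.
Proof. by rewrite raddf_sum big1 // => c _; rewrite /= swirtinger_kap swirtinger_szbar mulr0. Qed.
Lemma swirtinger_bar_szlow a b : swirtinger_bar a (szlow b) = kap (g a b).
Proof.
rewrite raddf_sum -(sum_delta_kap (g^~ b)); apply: eq_bigr => c _.
by rewrite /= swirtinger_bar_kap swirtinger_bar_szbar.
Qed.
Lemma sdsigma_szlow b : sdsigma (szlow b) = 0.
Proof. by rewrite raddf_sum big1 // => c _; rewrite /= sdsigma_kap sdsigma_szbar mulr0. Qed.
Lemma swirtinger_bar_szlow_conj a b : swirtinger_bar a (szlow_conj b) = 0.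
Proof. by rewrite raddf_sum big1 // => c _;
  rewrite /= swirtinger_bar_kap swirtinger_bar_sz mulr0. Qed.
Lemma swirtinger_szlow_conj a b : swirtinger a (szlow_conj b) = kap (g b a).
Proof.
rewrite raddf_sum -g_conj -(sum_delta_kap (fun c => (g c b)^*)); apply: eq_bigr => c _.
by rewrite /= swirtinger_kap swirtinger_sz.
Qed.
Lemma sdsigma_szlow_conj b : sdsigma (szlow_conj b) = 0.
Proof. by rewrite raddf_sum big1 // => c _; rewrite /= sdsigma_kap sdsigma_sz mulr0. Qed.

Definition halfi : S := kap ('i / 2%:R).
Definition sdhol a f : S := swirtinger a f + halfi * szlow a * sdsigma f.
Definition sdbar a f : S := swirtinger_bar a f - halfi * szlow_conj a * sdsigma f.

Lemma sdhol_additive a : zmod_morphism (sdhol a).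
Proof. by move=> f h; rewrite /sdhol !raddfB /=; ring. Qed.
HB.instance Definition _ a := GRing.isZmodMorphism.Build S S (sdhol a) (sdhol_additive a).
Lemma sdbar_additive a : zmod_morphism (sdbar a).
Proof. by move=> f h; rewrite /sdbar !raddfB /=; ring. Qed.
HB.instance Definition _ a := GRing.isZmodMorphism.Build S S (sdbar a) (sdbar_additive a).

Lemma sdhol_mul a f h : sdhol a (f * h) = sdhol a f * h + f * sdhol a h.
Proof. by rewrite /sdhol swirtinger_mul sdsigma_mul; ring. Qed.
Lemma sdbar_mul a f h : sdbar a (f * h) = sdbar a f * h + f * sdbar a h.
Proof. by rewrite /sdbar swirtinger_bar_mul sdsigma_mul; ring. Qed.
Lemma sdhol_cst a c : sdhol a (kap c) = 0.
Proof. by rewrite /sdhol swirtinger_cst sdsigma_cst; ring. Qed.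
Lemma sdbar_cst a c : sdbar a (kap c) = 0.
Proof. by rewrite /sdbar swirtinger_bar_cst sdsigma_cst; ring. Qed.

Lemma swirtinger_halfi a u f : swirtinger a (halfi * u * f) =
  halfi * (swirtinger a u * f + u * swirtinger a f).
Proof. by rewrite -mulrA swirtinger_kap swirtinger_mul. Qed.
Lemma swirtinger_bar_halfi a u f : swirtinger_bar a (halfi * u * f) =
  halfi * (swirtinger_bar a u * f + u * swirtinger_bar a f).
Proof. by rewrite -mulrA swirtinger_bar_kap swirtinger_bar_mul. Qed.
Lemma sdsigma_halfi u f : sdsigma (halfi * u * f) = halfi * (sdsigma u * f + u * sdsigma f).
Proof. by rewrite -mulrA sdsigma_kap sdsigma_mul. Qed.

Lemma sdhol_sdhol a b f : sdhol a (sdhol b f) = sdhol b (sdhol a f).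
Proof.
rewrite /sdhol !raddfD /= !swirtinger_halfi !sdsigma_halfi !swirtinger_szlow
  !sdsigma_szlow !sdsigma_swirtinger (swirtinger_swirtinger a b).
by ring.
Qed.
Lemma sdbar_sdbar a b f : sdbar a (sdbar b f) = sdbar b (sdbar a f).
Proof.
rewrite /sdbar !raddfB /= !swirtinger_bar_halfi !sdsigma_halfi
  !swirtinger_bar_szlow_conj !sdsigma_szlow_conj !sdsigma_swirtinger_bar
  (swirtinger_bar_swirtinger_bar a b).
by ring.
Qed.
Lemma sdsigma_sdhol a f : sdsigma (sdhol a f) = sdhol a (sdsigma f).
Proof. by rewrite /sdhol raddfD /= sdsigma_halfi sdsigma_szlow sdsigma_swirtinger; ring. Qed.
Lemma sdsigma_sdbar a f : sdsigma (sdbar a f) = sdbar a (sdsigma f).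
Proof. by rewrite /sdbar raddfB /= sdsigma_halfi sdsigma_szlow_conj
  sdsigma_swirtinger_bar; ring. Qed.

(** [szlow a] is antiholomorphic and [szlow_conj b] holomorphic, so each of the
    two orders contributes one derivative of a coefficient; hermitian symmetry of
    [g] makes them equal. *)
Lemma sdbar_sdhol a b f : sdbar b (sdhol a f) = sdhol a (sdbar b f) + kap ('i * g b a) * sdsigma f.
Proof.
rewrite /sdbar /sdhol !raddfD !raddfN /= swirtinger_bar_halfi swirtinger_halfi !sdsigma_halfi.
rewrite swirtinger_bar_szlow swirtinger_szlow_conj sdsigma_szlow sdsigma_szlow_conj
  !sdsigma_swirtinger !sdsigma_swirtinger_bar swirtinger_bar_swirtinger.
have -> : kap ('i * g b a) = (halfi + halfi) * kap (g b a).
  by rewrite -rmorphD -rmorphM -splitr.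
by ring.
Qed.

Lemma sdhol_sz a b : sdhol a (sz b) = (a == b)%:R.
Proof. by rewrite /sdhol swirtinger_sz sdsigma_sz mulr0 addr0. Qed.
Lemma sdbar_sz a b : sdbar a (sz b) = 0.
Proof. by rewrite /sdbar swirtinger_bar_sz sdsigma_sz mulr0 subr0. Qed.
Lemma sdhol_szbar a b : sdhol a (szbar b) = 0.
Proof. by rewrite /sdhol swirtinger_szbar sdsigma_szbar mulr0 addr0. Qed.
Lemma sdbar_szbar a b : sdbar a (szbar b) = (a == b)%:R.
Proof. by rewrite /sdbar swirtinger_bar_szbar sdsigma_szbar mulr0 subr0. Qed.

Definition eval_at (x : M) (f : S) : C := f x.
Lemma eval_at_zmod x : zmod_morphism (eval_at x).
Proof. by []. Qed.
HB.instance Definition _ x := GRing.isZmodMorphism.Build S C (eval_at x) (eval_at_zmod x).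
Lemma eval_at_monoid x : monoid_morphism (eval_at x).
Proof. by []. Qed.
HB.instance Definition _ x := GRing.isMonoidMorphism.Build S C (eval_at x) (eval_at_monoid x).
Lemma eval_at_kap x c : eval_at x (kap c) = c.
Proof. by []. Qed.

Lemma szlow_eval a x : szlow a x = zlow g x a.
Proof.
rewrite -[LHS]/(eval_at x _) raddf_sum; apply: eq_bigr => b _.
by [].
Qed.
Lemma szlow_conj_eval a x : szlow_conj a x = (zlow g x a)^*.
Proof.
rewrite -[LHS]/(eval_at x _) raddf_sum /zlow rmorph_sum; apply: eq_bigr => b _.
rewrite rmorphM -[LHS]/((g b a)^* * sz b x); congr (_ * _).
exact: (esym (conjcK (zcoord x b))).
Qed.

Lemma sdhol_eval a f : (sdhol a f : M -> C) = dhol g a f.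
Proof.
apply/funext => x; rewrite -[LHS]/(eval_at x _) /sdhol rmorphD !rmorphM /=.
by rewrite -[eval_at x (szlow a)]/(szlow a x) szlow_eval.
Qed.
Lemma sdbar_eval a f : (sdbar a f : M -> C) = dbar g a f.
Proof.
apply/funext => x; rewrite -[LHS]/(eval_at x _) /sdbar rmorphB !rmorphM /=.
by rewrite -[eval_at x (szlow_conj a)]/(szlow_conj a x) szlow_conj_eval.
Qed.
Lemma sdsigma_eval f : (sdsigma f : M -> C) = dsigma f.
Proof. by []. Qed.

End HeisenbergFields.

(** * Symmetrization of tensors *)

Section Symmetrize.
Context {T : eqType} {W : nmodType}.
Implicit Types (F : seq T -> W).

(** The sum over all permutations, organized by the letter that comes first; the
    length is a separate argument to make the recursion structural. *)
Fixpoint perm_sum (k : nat) F (A : seq T) : W :=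
  if k is k'.+1 then
    pick_sum (fun a B => perm_sum k' (fun D => F (a :: D)) B) A
  else F [::].

Lemma pick_sum_map_enum k (v : 'I_k.+1 -> T) (G : T -> seq T -> W) :
  pick_sum G [seq v j | j <- enum 'I_k.+1] =
  \sum_i G (v i) [seq v (lift i j) | j <- enum 'I_k].
Proof.
elim: k v G => [|k IH] v G.
  rewrite big_ord1 enum_ordSl /= -map_comp.
  have -> : enum 'I_0 = [::] by apply/eqP; rewrite -size_eq0 size_enum_ord.
  by rewrite /= addr0.
rewrite enum_ordSl /= -map_comp big_ord_recl; congr (_ + _).
rewrite (IH (v \o lift ord0)); apply: eq_bigr => i _ /=.
rewrite enum_ordSl /= -map_comp; congr (G _ (v _ :: _)); first by apply: val_inj.
apply: eq_map => j /=; congr v; apply: val_inj => /=.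
by rewrite /bump /=; lia.
Qed.

(** A permutation is given by the image of [ord0] and by a bijection of the
    remaining points. *)
Lemma sum_perm_recl k (H : 'S_k.+1 -> W) :
  \sum_p H p = \sum_i \sum_(q : 'S_k) H (lift_perm ord0 i q).
Proof.
rewrite pair_big (reindex (fun p : 'I_k.+1 * 'S_k => lift_perm ord0 p.1 p.2)) //=.
apply/onW_bij/inj_card_bij => [[i q] [j r] /= E|]; last first.
  by rewrite card_prod card_ord !card_Sn factS.
have ij : i = j by rewrite -(lift_perm_id ord0 i q) E lift_perm_id.
congr (_, _) => //; apply/permP => x; apply: (@lift_inj _ i).
by rewrite -(lift_perm_lift ord0 i q) E ij lift_perm_lift.
Qed.

Lemma sum_perm_words k (v : 'I_k -> T) F :
  \sum_(p : 'S_k) F [seq v (p j) | j <- enum 'I_k] =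
  perm_sum k F [seq v j | j <- enum 'I_k].
Proof.
elim: k v F => [|k IH] v F.
  have E0 : enum 'I_0 = [::] by apply/eqP; rewrite -size_eq0 size_enum_ord.
  rewrite E0 /= sumr_const card_Sn fact0 mulr1n //.
rewrite sum_perm_recl /= pick_sum_map_enum; apply: eq_bigr => i _.
rewrite -(IH (v \o lift i)); apply: eq_bigr => q _.
rewrite enum_ordSl /= lift_perm_id -map_comp; congr (F (_ :: _)).
by apply: eq_map => j /=; rewrite lift_perm_lift.
Qed.

Lemma eq_perm_sum k F G A : size A = k ->
  (forall B, size B = k -> F B = G B) -> perm_sum k F A = perm_sum k G A.
Proof.
elim: k F G A => [|k IH] F G A sA FG /=; first exact: FG.
apply: eq_pick_sum => a B sB; apply: IH; first by move: sB; rewrite sA => -[].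
by move=> D sD; apply: FG; rewrite /= sD.
Qed.

Lemma perm_sum_sym k F A : size A = k -> word_symmetric F ->
  perm_sum k F A = F A *+ k`!.
Proof.
elim: k F A => [|k IH] F A sA Fs /=; first by rewrite (size0nil sA).
rewrite (@eq_pick_sum _ _ _ (fun a B => F (a :: B) *+ k`!)); last first.
  move=> a B; rewrite sA => -[sB]; rewrite IH // => D D' DD'.
  by apply: Fs; rewrite perm_cons.
rewrite (pick_sum_sym_const (F := fun A => F A *+ k`!)); last first.
  by move=> D D' DD'; rewrite (Fs _ _ DD').
by rewrite sA -mulrnA factS mulnC.
Qed.

End Symmetrize.

Lemma raddf_perm_sum (T : eqType) (W W' : nmodType) (h : {additive W -> W'}) k
    (F : seq T -> W) A :
  h (perm_sum k F A) = perm_sum k (fun B => h (F B)) A.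
Proof.
elim: k F A => //= k IH F A; rewrite raddf_pick_sum; apply: eq_pick_sum => a B _.
exact: (IH (fun D => F (a :: D))).
Qed.

(** * Operators and tensors on the hypersurface *)

Section HypersurfaceTensors.
Context {R : realType} {n : nat}.
Local Notation C := (R[i]).
Local Notation M := ('rV[R]_n * 'rV[R]_n * R)%type.
Local Notation S := (@smooth_fun R n).
Local Notation kap := (@constant R n).
Variables (g : 'M[C]_n) (w1 w2 : C).
Hypotheses (g_herm : g \is hermsymmx) (g_unit : g \in unitmx).

Lemma symmetrizeE (F : seq 'I_n -> C) A :
  symmetrize F A = ((size A)`!%:R)^-1 * perm_sum (size A) F A.
Proof.
rewrite /symmetrize /permute; congr (_ * _).
by rewrite (sum_perm_words (tnth (in_tuple A)) F) map_tnth_enum.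
Qed.

Lemma symmetrize_sym (F : seq 'I_n -> C) A : word_symmetric F -> symmetrize F A = F A.
Proof.
move=> Fs; rewrite symmetrizeE perm_sum_sym // -[F A *+ _]mulr_natl mulrA mulVf ?mul1r //.
Qed.

Lemma symmetrize_nil (F : seq 'I_n -> C) : symmetrize F [::] = F [::].
Proof. by rewrite symmetrizeE /= fact0 invr1 mul1r. Qed.

Lemma symmetrize_pick (F : seq 'I_n -> C) A : (0 < size A)%N ->
  symmetrize F A = (size A)%:R^-1 *
    pick_sum (fun a B => symmetrize (fun D => F (a :: D)) B) A.
Proof.
rewrite symmetrizeE; case E: (size A) => [|k] // _ /=.
rewrite factS natrM invfM -mulrA; congr (_ * _); rewrite -pick_sum_mull.
by apply: eq_pick_sum => a B; rewrite E => -[sB]; rewrite symmetrizeE sB.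
Qed.

Lemma eq_symmetrize (F G : seq 'I_n -> C) A :
  (forall B, size B = size A -> F B = G B) -> symmetrize F A = symmetrize G A.
Proof. by move=> FG; rewrite !symmetrizeE (eq_perm_sum (G := G)). Qed.

Definition ssymmetrize (F : seq 'I_n -> S) A : S :=
  kap ((size A)`!%:R)^-1 * perm_sum (size A) F A.

Lemma eval_at_ssymmetrize x F A : eval_at x (ssymmetrize F A) =
  symmetrize (fun B => eval_at x (F B)) A.
Proof.
by rewrite symmetrizeE [LHS]rmorphM /= ?eval_at_kap (raddf_perm_sum (eval_at x)).
Qed.

Lemma ssymmetrize_pick (F : seq 'I_n -> S) A : (0 < size A)%N ->
  ssymmetrize F A = pick_mean kap (fun a B => ssymmetrize (fun D => F (a :: D)) B) A.
Proof.
rewrite /ssymmetrize /pick_mean; case E: (size A) => [|k] // _ /=.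
rewrite factS natrM invfM rmorphM -mulrA; congr (_ * _); rewrite -pick_sum_mull.
by apply: eq_pick_sum => a B; rewrite E => -[->].
Qed.

Lemma ssymmetrize_sym (F : seq 'I_n -> S) A : word_symmetric F -> ssymmetrize F A = F A.
Proof.
move=> Fs; rewrite /ssymmetrize perm_sum_sym // -[F A *+ _]mulr_natl -(rmorph_nat kap)
  mulrA -rmorphM.
by rewrite mulVf ?rmorph1 ?mul1r // pnatr_eq0 -lt0n fact_gt0.
Qed.

Lemma ssymmetrize_derivation (V : {additive S -> S}) F A :
  (forall c f, V (kap c * f) = kap c * V f) ->
  V (ssymmetrize F A) = ssymmetrize (fun B => V (F B)) A.
Proof. by move=> Vc; rewrite /ssymmetrize Vc raddf_perm_sum. Qed.

Definition hol_field (a : 'I_n) : {additive S -> S} := sdhol g a.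
Definition bar_field (a : 'I_n) : {additive S -> S} := sdbar g a.
Definition sigma_field : {additive S -> S} := @sdsigma R n.
(** Half of the commutator [[d_{bar b}, d_a]], traced with the metric, appears
    when the symmetric sum in the sub-Laplacian is put in normal order. *)
Definition sigma_coef : C := 2%:R^-1 * (\sum_a \sum_b invmx g a b * ('i * g b a)) +
  'i * ((w1 - w2) / 2%:R).

Local Notation lapS := (lap kap g hol_field bar_field sigma_field sigma_coef).
Local Notation dAS := (sym_up kap g bar_field).
Local Notation dBS := (sym_upbar kap g hol_field).
Local Notation ptrS := (gmul kap g).
Local Notation spannedS := (spanned hol_field bar_field sigma_field).
Local Notation monS := (mon hol_field bar_field sigma_field).

Lemma up_eval a f : (up kap g bar_field a f : M -> C) = dup g a f.
Proof.
apply/funext => x; rewrite -[LHS]/(eval_at x _) raddf_sum; apply: eq_bigr => b _.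
by rewrite /= -sdbar_eval.
Qed.
Lemma upbar_eval a f : (upbar kap g hol_field a f : M -> C) = dupbar g a f.
Proof.
apply/funext => x; rewrite -[LHS]/(eval_at x _) raddf_sum; apply: eq_bigr => b _.
by rewrite /= -sdhol_eval.
Qed.

Lemma foldr_up_eval f D : (foldr (up kap g bar_field) f D : M -> C) = foldr (dup g) (f : M -> C) D.
Proof. by elim: D => //= a D IH; rewrite up_eval IH. Qed.
Lemma foldr_upbar_eval f D :
  (foldr (upbar kap g hol_field) f D : M -> C) = foldr (dupbar g) (f : M -> C) D.
Proof. by elim: D => //= a D IH; rewrite upbar_eval IH. Qed.

(** Symmetrizing once at the end or after each derivative gives the same result. *)
Lemma sym_dup_iter j (V : seq 'I_n -> seq 'I_n -> S) x A B : bisymmetric V ->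
  (j <= size A)%N ->
  sym_dup g j (fun A B => V A B : M -> C) x A B = eval_at x (iter j dAS V A B).
Proof.
move=> Vs jA.
have -> : iter j dAS V A B =
    ssymmetrize (fun A' => foldr (up kap g bar_field) (V (drop j A') B) (take j A')) A.
  elim: j A jA => [|j IH] A jA.
    rewrite ssymmetrize_sym => [|A1 A2 A12]; first by rewrite drop0 take0.
    by rewrite !drop0 !take0 (Vs _ _ _ _ A12 (perm_refl B)).
  rewrite ssymmetrize_pick; last exact: leq_trans jA.
  rewrite iterS.
  apply: eq_pick_mean => a A' sA; rewrite IH; last by rewrite sA in jA.
  by rewrite ssymmetrize_derivation // => c f; apply: up_cst; [exact: sdbar_mul|exact: sdbar_cst].
rewrite eval_at_ssymmetrize; apply: eq_symmetrize => A' _.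
by rewrite -foldr_up_eval.
Qed.

Lemma sym_dupbar_iter j (V : seq 'I_n -> seq 'I_n -> S) x A B : bisymmetric V ->
  (j <= size B)%N ->
  sym_dupbar g j (fun A B => V A B : M -> C) x A B = eval_at x (iter j dBS V A B).
Proof.
move=> Vs jB.
have -> : iter j dBS V A B =
    ssymmetrize (fun B' => foldr (upbar kap g hol_field) (V A (drop j B')) (take j B')) B.
  elim: j B jB => [|j IH] B jB.
    rewrite ssymmetrize_sym => [|A1 A2 A12]; first by rewrite drop0 take0.
    by rewrite !drop0 !take0 (Vs _ _ _ _ (perm_refl A) A12).
  rewrite ssymmetrize_pick; last exact: leq_trans jB.
  rewrite iterS.
  apply: eq_pick_mean => a B' sB; rewrite IH; last by rewrite sB in jB.
  by rewrite ssymmetrize_derivation // => c f; apply: upbar_cst;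
    [exact: sdhol_mul|exact: sdhol_cst].
rewrite eval_at_ssymmetrize; apply: eq_symmetrize => B' _.
by rewrite -foldr_upbar_eval.
Qed.

Lemma eval_at_pick_mean x (F : 'I_n -> seq 'I_n -> S) A : eval_at x (pick_mean kap F A) =
  (size A)%:R^-1 * pick_sum (fun a B => eval_at x (F a B)) A.
Proof. by rewrite -(raddf_pick_sum (eval_at x)). Qed.

Lemma pure_trace_eval (phi : seq 'I_n -> seq 'I_n -> S) x A B : bisymmetric phi ->
  pure_trace g (fun A B => phi A B x) A B = eval_at x (ptrS phi A B).
Proof.
move=> ps; rewrite /pure_trace.
pose F := fun A' => symmetrize (fun B' => match A', B' with
    | a :: A'', b :: B'' => invmx g a b * phi A'' B'' x | _, _ => 0 end) B.
have Fcons a A1 : F (a :: A1) =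
    (size B)%:R^-1 * pick_sum (fun b B1 => invmx g a b * phi A1 B1 x) B.
  rewrite /F; case: (B) => [|b0 B0]; first by rewrite symmetrize_nil mulr0.
  rewrite symmetrize_pick //; congr (_ * _); apply: eq_pick_sum => b B1 _.
  apply: symmetrize_sym => D D' DD'.
  by rewrite (ps _ _ _ _ (perm_refl A1) DD').
rewrite -/F; case: A => [|a0 A0].
  rewrite symmetrize_nil /F /gmul pick_mean_nil raddf0.
  case: (B) => [|b0 B0]; first by rewrite symmetrize_nil.
  rewrite symmetrize_pick // pick_sum0 ?mulr0 // => b B1 _.
  by rewrite symmetrize_sym.
rewrite symmetrize_pick // /gmul eval_at_pick_mean; congr (_ * _).
apply: eq_pick_sum => a A1 _.
transitivity (symmetrize (fun A2 => (size B)%:R^-1 *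
    pick_sum (fun b B1 => invmx g a b * phi A2 B1 x) B) A1).
  by apply: eq_symmetrize => A2 _; apply: Fcons.
rewrite symmetrize_sym => [|D D' DD']; last first.
  congr (_ * _); apply: eq_pick_sum => b B1 _.
  by rewrite (ps _ _ _ _ DD' (perm_refl B1)).
rewrite eval_at_pick_mean; congr (_ * _).
Qed.

Lemma trace_free_eval k l (V : seq 'I_n -> seq 'I_n -> S) x : bisymmetric V ->
  (forall A B, gtrace kap g V A B = 0) ->
  trace_free g k l (fun A B => V A B x).
Proof.
move=> Vs Vt A1 A2 B1 B2 _ _; rewrite -[RHS](raddf0 (eval_at x)) -(Vt (A1 ++ A2) (B1 ++ B2)).
rewrite /gtrace raddf_sum; apply: eq_bigr => a _; rewrite raddf_sum; apply: eq_bigr => b _.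
rewrite [RHS]rmorphM /= ?eval_at_kap; congr (_ * _).
have perm_mid (c : 'I_n) D1 D2 : perm_eq (D1 ++ c :: D2) (c :: D1 ++ D2).
  by rewrite -cat1s perm_catCA.
by rewrite (Vs _ _ _ _ (perm_mid a A1 A2) (perm_mid b B1 B2)).
Qed.

Lemma symmetric_eval k l (V : seq 'I_n -> seq 'I_n -> S) x : bisymmetric V ->
  symmetric_tensor k l (fun A B => V A B x).
Proof. by move=> Vs A A' B B' _ _ AA' BB'; rewrite (Vs _ _ _ _ AA' BB'). Qed.

Lemma trace_free_part_up s k (V : seq 'I_n -> seq 'I_n -> S) (u : C) x :
  bisymmetric V -> (forall A B, gtrace kap g V A B = 0) ->
  (exists phi, bisymmetric phi /\ forall A B, size A = (k + s)%N -> size B = s ->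
     kap u * iter k dAS V A B = V A B + ptrS phi A B) ->
  trace_free_part_is g (k + s) s
    (fun A B => u * sym_dup g k (fun A B => V A B : M -> C) x A B)
    (fun A B => V A B x).
Proof.
move=> Vs Vt [phi [ps E]]; split; first exact: symmetric_eval.
split; first exact: trace_free_eval.
exists (fun A B => phi A B x) => A B sA sB.
rewrite pure_trace_eval // sym_dup_iter //; last by rewrite sA leq_addr.
exact: (congr1 (eval_at x) (E A B sA sB)).
Qed.

Lemma trace_free_part_upbar s k (V : seq 'I_n -> seq 'I_n -> S) (u : C) x :
  bisymmetric V -> (forall A B, gtrace kap g V A B = 0) ->
  (exists phi, bisymmetric phi /\ forall A B, size A = s -> size B = (k + s)%N ->
     kap u * iter k dBS V A B = V A B + ptrS phi A B) ->
  trace_free_part_is g s (k + s)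
    (fun A B => u * sym_dupbar g k (fun A B => V A B : M -> C) x A B)
    (fun A B => V A B x).
Proof.
move=> Vs Vt [phi [ps E]]; split; first exact: symmetric_eval.
split; first exact: trace_free_eval.
exists (fun A B => phi A B x) => A B sA sB.
rewrite pure_trace_eval // sym_dupbar_iter //; last by rewrite sB leq_addr.
exact: (congr1 (eval_at x) (E A B sA sB)).
Qed.

Lemma gmul_scale (u : C) phi A B : ptrS (fun A B => kap u * phi A B) A B = kap u * ptrS phi A B.
Proof.
rewrite /gmul -pick_mean_mull; apply: eq_pick_mean => a A' _.
by rewrite -pick_mean_mull; apply: eq_pick_mean => b B' _; rewrite mulrCA.
Qed.

Lemma first_BGG_up s k (V : seq 'I_n -> seq 'I_n -> S) (u : C) x :
  bisymmetric V -> u != 0 ->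
  (forall A B, size A = (k + s)%N -> size B = s -> V A B = 0) ->
  (exists phi, bisymmetric phi /\ forall A B, size A = (k + s)%N -> size B = s ->
     kap u * iter k dAS V A B = V A B + ptrS phi A B) ->
  trace_free_part_is g (k + s) s (sym_dup g k (fun A B => V A B : M -> C) x)
    (fun _ _ => 0).
Proof.
move=> Vs u0 V0 [phi [ps E]]; split; first by [].
split; first by move=> A1 A2 B1 B2 _ _; rewrite big1 // => a _; rewrite big1 // => b _;
  rewrite mulr0.
have ps' : bisymmetric (fun A B => kap u^-1 * phi A B).
  by move=> A A' B B' AA' BB'; rewrite (ps _ _ _ _ AA' BB').
exists (fun A B => (kap u^-1 * phi A B : S) x) => A B sA sB.
rewrite add0r (pure_trace_eval _ _ _ ps') sym_dup_iter //; last by rewrite sA leq_addr.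
congr (eval_at x); rewrite gmul_scale -[ptrS phi A B]add0r -(V0 A B) // -E // mulrA -rmorphM.
by rewrite mulVf // rmorph1 mul1r.
Qed.

Lemma first_BGG_upbar s k (V : seq 'I_n -> seq 'I_n -> S) (u : C) x :
  bisymmetric V -> u != 0 ->
  (forall A B, size A = s -> size B = (k + s)%N -> V A B = 0) ->
  (exists phi, bisymmetric phi /\ forall A B, size A = s -> size B = (k + s)%N ->
     kap u * iter k dBS V A B = V A B + ptrS phi A B) ->
  trace_free_part_is g s (k + s) (sym_dupbar g k (fun A B => V A B : M -> C) x)
    (fun _ _ => 0).
Proof.
move=> Vs u0 V0 [phi [ps E]]; split; first by [].
split; first by move=> A1 A2 B1 B2 _ _; rewrite big1 // => a _; rewrite big1 // => b _;
  rewrite mulr0.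
have ps' : bisymmetric (fun A B => kap u^-1 * phi A B).
  by move=> A A' B B' AA' BB'; rewrite (ps _ _ _ _ AA' BB').
exists (fun A B => (kap u^-1 * phi A B : S) x) => A B sA sB.
rewrite add0r (pure_trace_eval _ _ _ ps') sym_dupbar_iter //; last by rewrite sB leq_addr.
congr (eval_at x); rewrite gmul_scale -[ptrS phi A B]add0r -(V0 A B) // -E // mulrA -rmorphM.
by rewrite mulVf // rmorph1 mul1r.
Qed.

Lemma mon_eval A B m f : (monS A B m f : M -> C) = monomial g A B m f.
Proof.
rewrite /mon /monomial; elim: A => [|a A IH] /=; last first.
  by rewrite -[LHS]/(sdhol g a (foldr hol_field _ A) : M -> C) sdhol_eval IH.
elim: B => [|b B IH] /=; last first.
  by rewrite -[LHS]/(sdbar g b (foldr bar_field _ B) : M -> C) sdbar_eval IH.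
by elim: m => //= m IH; rewrite -[LHS]/(sdsigma _ : M -> C) sdsigma_eval IH.
Qed.

Lemma eval_atD x (f h : S) : eval_at x (f + h) = eval_at x f + eval_at x h.
Proof. by []. Qed.
Lemma eval_atM x (f h : S) : eval_at x (f * h) = eval_at x f * eval_at x h.
Proof. by []. Qed.

Lemma lap_eval f : (lapS f : M -> C) = sublaplacian g w1 w2 f.
Proof.
apply/funext => x; rewrite -[LHS]/(eval_at x _) /lap eval_atD eval_atM eval_at_kap.
rewrite /sublaplacian.
have -> : \sum_a \sum_b invmx g a b *
      (dhol g a (dbar g b f) x + dbar g b (dhol g a f) x) =
   \sum_a \sum_b (2%:R * (invmx g a b * eval_at x (sdhol g a (sdbar g b f))) +
      invmx g a b * ('i * g b a) * eval_at x (sdsigma f)).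
  apply: eq_bigr => a _; apply: eq_bigr => b _.
  have -> : dhol g a (dbar g b f) x = eval_at x (sdhol g a (sdbar g b f)).
    by rewrite -sdbar_eval -sdhol_eval.
  have -> : dbar g b (dhol g a f) x =
      eval_at x (sdhol g a (sdbar g b f)) + ('i * g b a) * eval_at x (sdsigma f).
    rewrite -sdhol_eval -sdbar_eval.
    have H := congr1 (eval_at x) (sdbar_sdhol g_herm a b f).
    by rewrite eval_atD eval_atM eval_at_kap in H.
  by ring.
have -> : \sum_a \sum_b (2%:R * (invmx g a b * eval_at x (sdhol g a (sdbar g b f))) +
      invmx g a b * ('i * g b a) * eval_at x (sdsigma f)) =
   2%:R * (\sum_a \sum_b (invmx g a b * eval_at x (sdhol g a (sdbar g b f)))) +
   (\sum_a \sum_b invmx g a b * ('i * g b a)) * eval_at x (sdsigma f).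
  rewrite mulr_sumr mulr_suml -big_split; apply: eq_bigr => a _ /=.
  by rewrite mulr_sumr mulr_suml -big_split.
have -> : eval_at x (\sum_a \sum_b kap (invmx g a b) * hol_field a (bar_field b f)) =
   \sum_a \sum_b (invmx g a b * eval_at x (sdhol g a (sdbar g b f))).
  by rewrite raddf_sum; apply: eq_bigr => a _; rewrite raddf_sum.
rewrite /sigma_coef -[dsigma f x]/(eval_at x (sdsigma f)) mulrDr mulrA mulVf ?pnatr_eq0 // mul1r.
by rewrite mulrDl -!addrA; congr (_ + (_ + _)); rewrite !mulrA.
Qed.

(** Operators on smooth functions are extended to all functions by zero; only
    their values on smooth functions matter. *)
Definition extend (Q : S -> S) (f : M -> C) : M -> C := fun x =>
  if pselect (smooth f) is left sf then Q (mk_smooth sf) x else 0.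

Lemma extendE Q f : extend Q (f : S) = Q f.
Proof.
apply/funext => x; rewrite /extend; case: pselect => [sf|]; last first.
  by move=> /(_ (smooth_funP f)).
by congr (Q _ x); apply: smooth_fun_eq.
Qed.

Lemma smooth_sfun (f : M -> C) : smooth f -> exists fs : S, f = fs.
Proof. by move=> sf; exists (mk_smooth sf). Qed.

Lemma spanned_terms p (Q : S -> S) : spannedS p Q ->
  exists (N : nat) (c : 'I_N -> M -> C) (A B : 'I_N -> seq 'I_n) (m : 'I_N -> nat),
    (forall i, smooth (c i)) /\ (forall i, p (A i, B i, m i)) /\
    forall f : S, (Q f : M -> C) =
      fun x => \sum_i c i x * monomial g (A i) (B i) (m i) f x.
Proof.
move=> [s [sp Qs]]; pose t0 : S * @mon_index n := (0, ([::], [::], 0%N)).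
pose t (i : 'I_(size s)) := nth t0 s i.
exists (size s), (fun i => (t i).1 : M -> C), (fun i => (t i).2.1.1),
  (fun i => (t i).2.1.2), (fun i => (t i).2.2).
split; first by move=> i; apply: smooth_funP.
split.
  move=> i; have /allP/(_ (t i)) := sp; rewrite mem_nth // => /(_ isT).
  by case: (t i).2 => [[]].
move=> f; apply/funext => x; rewrite Qs (big_nth t0) big_mkord.
rewrite -[LHS]/(eval_at x _) raddf_sum; apply: eq_bigr => i _.
by rewrite /term_op [LHS]rmorphM /= -mon_eval.
Qed.

Lemma diff_op_extend p Q : spannedS p Q -> diff_op g (extend Q).
Proof.
move=> /spanned_terms[N [c [A [B [m [sc [_ QE]]]]]]].
exists N, c, (fun i => map (@Hol n) (A i) ++ map (@Bar n) (B i) ++ nseq (m i) (@Sigma n)).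
split=> // f /smooth_sfun[fs ->] x; rewrite extendE QE; apply: eq_bigr => i _.
rewrite !foldr_cat !foldr_map; congr (_ * _).
by rewrite /monomial; congr (foldr _ (foldr _ _ _) _ x); elim: (m i) => //= k ->.
Qed.

Lemma diff_op_restrict D : diff_op g D -> exists Ds : S -> S,
  (exists N, spannedS (order_below N) Ds) /\ forall f : S, D f = Ds f :> (M -> C).
Proof.
move=> [N [c [w [sc DE]]]].
pose fr (v : @frame n) : S -> S :=
  match v with Hol a => sdhol g a | Bar a => sdbar g a | Sigma => @sdsigma R n end.
have frE v f : (fr v f : M -> C) = dframe g v f.
  by case: v => [a|a|]; [exact: sdhol_eval|exact: sdbar_eval|].
have wE ws f : (foldr fr f ws : M -> C) = foldr (dframe g) (f : M -> C) ws.
  by elim: ws => //= v ws <-; rewrite frE.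
exists (fun f => \sum_i mk_smooth (sc i) * foldr fr f (w i)); split; last first.
  move=> f; apply/funext => x; rewrite DE; last exact: smooth_funP.
  rewrite -[RHS]/(eval_at x _) raddf_sum; apply: eq_bigr => i _.
  by rewrite [RHS]rmorphM /= -wE.
exists (\max_i size (w i)).+1; apply: spanned_sum => i; apply: spannedM.
apply: (@order_ltW _ _ _ _ _ (size (w i)).+1).
  by rewrite ltnS (leq_bigmax (F := fun i => size (w i))).
elim: (w i) => [|v ws IH] /=.
  exact: (@order_lt_mon _ _ hol_field bar_field sigma_field 1 [::] [::] 0 isT).
case: v => [a|a|] /=.
- apply: order_lt_X IH; exact: sdhol_mul.
- apply: (order_lt_Y g_unit _ _ _ _ _ _ a IH);
    [exact: sdhol_mul|exact: sdbar_mul|exact: sdhol_cst|exact: sdsigma_sdhol|exact: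
    sdsigma_sdbar|exact: sdbar_sdhol].
apply: order_lt_Z IH; [exact: sdsigma_mul|exact: sdsigma_sdhol|exact: sdsigma_sdbar].
Qed.

End HypersurfaceTensors.

(** * Symmetries of the sub-Laplacian *)

Section SubLaplacianSymmetries.
Context {R : realType} {n : nat}.
Local Notation C := (R[i]).
Local Notation M := ('rV[R]_n * 'rV[R]_n * R)%type.
Local Notation S := (@smooth_fun R n).
Local Notation kap := (@constant R n).
Variables (g : 'M[C]_n) (w1 w2 : C).
Hypotheses (g_herm : g \is hermsymmx) (g_unit : g \in unitmx).
Local Notation lapS := (lap kap g (hol_field g) (bar_field g) (@sigma_field R n)
  (sigma_coef g w1 w2)).
Local Notation symS_of :=
  (symmetry_of kap g (hol_field g) (bar_field g) (@sigma_field R n) (sigma_coef g w1 w2)).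
Local Notation spannedS := (spanned (hol_field g) (bar_field g) (@sigma_field R n)).

Lemma symmetry_restrict D : symmetry g w1 w2 D -> exists Ds : S -> S,
  symS_of Ds /\ forall f : S, D f = Ds f :> (M -> C).
Proof.
move=> [/(diff_op_restrict g_herm g_unit)[Ds [[N HN] DE]]].
move=> [delta [/(diff_op_restrict g_herm g_unit)[deltaS [[N' HN'] dE]] comm]].
exists Ds; split=> //; split; first by exists N.
exists deltaS, N'; split=> // f; apply: smooth_fun_eq => x.
by rewrite -dE !lap_eval // -DE; apply: comm; apply: smooth_funP.
Qed.

Lemma symmetry_extend (P : S -> S) : symS_of P -> symmetry g w1 w2 (extend P).
Proof.
move=> [[N HN] [delta [N' [HN' comm]]]]; split; first exact: diff_op_extend HN.
exists (extend delta); split; first exact: diff_op_extend HN'.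
move=> f /smooth_sfun[fs ->] x.
by rewrite extendE -!lap_eval // extendE comm.
Qed.

Lemma trivial_extend p (Q : S -> S) (E : (M -> C) -> M -> C) : spannedS p Q ->
  (forall f : S, E f = Q (lapS f) :> (M -> C)) -> trivial_symmetry g w1 w2 E.
Proof.
move=> HQ EQ; exists (extend Q); split; first exact: diff_op_extend HQ.
by move=> f /smooth_sfun[fs ->] x; rewrite -lap_eval // extendE EQ.
Qed.

Lemma zero_leading_part d s f x : leading_part g d s (fun _ _ _ => 0) f x = 0.
Proof.
apply: big1 => k _; apply: big1 => l _; apply: big1 => A _; apply: big1 => B _.
by rewrite mul0r.
Qed.

Lemma leading_part_eval d s (V : seq 'I_n -> seq 'I_n -> S) (f : S) :
  leading_part g d s (fun A B => V A B : M -> C) f =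
  (\sum_(k < d.+1) \sum_(l < d.+1 | is_leading d s k l)
      \sum_(A : k.-tuple 'I_n) \sum_(B : l.-tuple 'I_n)
        V A B * mon (hol_field g) (bar_field g) (@sigma_field R n) A B (d - k - l) f : S).
Proof.
apply/funext => x; rewrite -[RHS]/(eval_at x _) raddf_sum; apply: eq_bigr => k _.
rewrite raddf_sum; apply: eq_bigr => l _; rewrite raddf_sum; apply: eq_bigr => A _.
rewrite raddf_sum; apply: eq_bigr => B _; rewrite -mon_eval.
by [].
Qed.

Lemma lower_degree_deg_lt d s (t : @mon_index n) : lower_degree d s t ->
  deg_lt (monomial_degree t.1.1 t.1.2 t.2) (d, s).
Proof.
rewrite /lower_degree /index_order /deg_lt /deg_le /monomial_degree /=.
set k := (_ + _)%N; set l := minn _ _ => /orP[kd|/andP[/eqP -> sl]].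
  by rewrite kd /=; apply: contraTneq kd => -[-> _]; rewrite ltnn.
rewrite eqxx (ltnW sl) orbT /=; apply: contraTneq sl => -[->]; by rewrite ltnn.
Qed.

Lemma symmetry_zero : symS_of (fun _ => 0).
Proof.
split; first by exists 0%N; apply: spanned0.
exists (fun _ => 0), 0%N; split; first exact: spanned0.
by move=> f; rewrite raddf0.
Qed.

Lemma iter_sym_up_zero k A B : iter k (sym_up kap g (bar_field g)) (fun _ _ => 0) A B = 0.
Proof.
elim: k A B => // k IH A B; rewrite iterS; apply: pick_mean0 => a A' _.
by rewrite IH raddf0.
Qed.
Lemma iter_sym_upbar_zero k A B : iter k (sym_upbar kap g (hol_field g)) (fun _ _ => 0) A B = 0.
Proof.
elim: k A B => // k IH A B; rewrite iterS; apply: pick_mean0 => a A' _.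
by rewrite IH raddf0.
Qed.
Lemma gmul_zero A B : gmul kap g (fun _ _ => 0) A B = 0.
Proof. by apply: pick_mean0 => a A' _; apply: pick_mean0 => b B' _; rewrite mulr0. Qed.

End SubLaplacianSymmetries.

Theorem theorem3p1 (R : realType) (n : nat) (g : 'M[R[i]]_n)
  (g_hermitian : g \is hermsymmx) (g_nondegenerate : g \in unitmx)
  (w1 w2 : R[i])
  (w_integral : exists m : int, w1 - w2 = m%:~R)
  (w_weight : n%:R + w1 + w2 = 0)
  (D : (cr_point R n -> R[i]) -> cr_point R n -> R[i])
  (D_symmetry : symmetry g w1 w2 D) :
  exists P : (cr_point R n -> R[i]) -> cr_point R n -> R[i],
    symmetry g w1 w2 P /\ equivalent g w1 w2 D P /\
    exists (d s : nat) (V : seq 'I_n -> seq 'I_n -> cr_point R n -> R[i])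
           (L : (cr_point R n -> R[i]) -> cr_point R n -> R[i]),
      (2 * s <= d)%N /\
      (* P has the displayed form *)
      lower_degree_terms g d s L /\
      (forall f, smooth f -> forall x,
        P f x = leading_part g d s V f x + L f x) /\
      (forall A B, leading d s (size A) (size B) -> smooth (V A B)) /\
      (* (d, s) really is the degree of P: the leading part is not zero, unless
         D is equivalent to 0; otherwise V = 0 and a large d would always do *)
      (~ trivial_symmetry g w1 w2 D ->
        exists A B x, leading d s (size A) (size B) /\ V A B x <> 0) /\
      (forall k l, leading d s k l -> forall x,
        symmetric_tensor k l (fun A B => V A B x) /\
        trace_free g k l (fun A B => V A B x)) /\
      first_BGG_solution g d s V /\
      (forall k, (k + 2 * s <= d)%N -> forall x,
        trace_free_part_is g (k + s) s
          (fun A B => 'i ^+ k / (k`!)%:R * sym_dup g k V x A B)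
          (fun A B => V A B x)) /\
      (forall k, (k + 2 * s <= d)%N -> forall x,
        trace_free_part_is g s (k + s)
          (fun A B => (- 'i) ^+ k / (k`!)%:R * sym_dupbar g k V x A B)
          (fun A B => V A B x)).
Proof.
have [Ds [symDs DE]] := symmetry_restrict g_hermitian g_nondegenerate D_symmetry.
have [[Q [M [HQ DQ]]]|] := symmetry_leading_part g_nondegenerate
    (etrans (esym (expr2 _)) (sqrCi _))
    (sdhol_mul g) (sdbar_mul g) (@sdsigma_mul R n) (sdhol_cst g) (sdbar_cst g) (@sdsigma_cst R n)
    (@sdhol_sdhol R n g) (@sdbar_sdbar R n g) (@sdsigma_sdhol R n g) (@sdsigma_sdbar R n g)
    (sdbar_sdhol g_hermitian) (sdhol_sz g) (sdbar_sz g) (@sdsigma_sz R n)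
    (sdhol_szbar g) (sdbar_szbar g) (@sdsigma_szbar R n) (@sdsigma_ssigma R n) symDs.
  have triv : trivial_symmetry g w1 w2 D.
    by apply: (trivial_extend g_hermitian HQ) => f; rewrite DE DQ.
  (* A trivial symmetry is equivalent to the zero operator. *)
  exists (extend (fun _ => 0)); split; first exact/symmetry_extend/symmetry_zero.
  split.
    apply: (trivial_extend g_hermitian HQ) => f; apply/funext => x.
    by rewrite extendE DE DQ -[LHS]/(Q _ x - 0) subr0.
  pose V0 (A B : seq 'I_n) : @smooth_fun R n := 0.
  exists 0%N, 0%N, (fun A B => V0 A B : cr_point R n -> R[i]), (fun _ _ => 0).
  have V0s : bisymmetric V0 by [].
  have V0t A B : gtrace (@constant R n) g V0 A B = 0.
    by apply: big1 => a _; apply: big1 => b _; rewrite mulr0.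
  have itA s k (u : R[i]) : exists phi, bisymmetric phi /\
      forall A B, size A = (k + s)%N -> size B = s ->
      constant u * iter k (sym_up (@constant R n) g (bar_field g)) V0 A B =
      V0 A B + gmul (@constant R n) g phi A B.
    by exists V0; split=> // A B _ _; rewrite gmul_zero iter_sym_up_zero mulr0 addr0.
  have itB s k (u : R[i]) : exists phi, bisymmetric phi /\
      forall A B, size A = s -> size B = (k + s)%N ->
      constant u * iter k (sym_upbar (@constant R n) g (hol_field g)) V0 A B =
      V0 A B + gmul (@constant R n) g phi A B.
    by exists V0; split=> // A B _ _; rewrite gmul_zero iter_sym_upbar_zero mulr0 addr0.
  split=> //; split.
    exists 0%N, (fun _ _ => 0), (fun _ => [::]), (fun _ => [::]), (fun _ => 0%N).
    by split=> [[]//|]; split=> [[]//|] f _ x; rewrite big_ord0.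
  split.
    move=> f /smooth_sfun[fs ->] x; rewrite extendE addr0.
    by rewrite -[RHS]/(leading_part g 0 0 (fun _ _ _ => 0) fs x) zero_leading_part.
  split; first by move=> A B _; apply: smooth_funP.
  split=> //; split.
    by move=> k l _ x; split; [exact: symmetric_eval|exact: trace_free_eval].
  split.
    split; first by move=> x; apply: symmetric_eval.
    split; first by move=> x; apply: trace_free_eval.
    split=> x.
      exact: (first_BGG_up x V0s (oner_neq0 _) (fun _ _ _ _ => erefl) (itA 0%N 1%N 1)).
    exact: (first_BGG_upbar x V0s (oner_neq0 _) (fun _ _ _ _ => erefl) (itB 0%N 1%N 1)).
  split=> k _ x; first exact: trace_free_part_up.
  exact: trace_free_part_upbar.
move=> [Q [M [d [s [V [HQ symP [sd Vs V0 Vt [A0 [B0 [lead0 nz]]]] low iters]]]]]].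
pose P := extend (fun f => Ds f - Q (lap (@constant R n) g (hol_field g) (bar_field g)
  (@sigma_field R n) (sigma_coef g w1 w2) f)).
exists P; split; first exact: symmetry_extend symP.
split.
  apply: (trivial_extend g_hermitian HQ) => f; apply/funext => x.
  rewrite /P extendE DE -[LHS]/(Ds f x - (Ds f x - Q _ x)).
  by rewrite opprB addrCA subrr addr0.
exists d, s, (fun A B => V A B : cr_point R n -> R[i]).
exists (fun f x => P f x - leading_part g d s (fun A B => V A B : cr_point R n -> R[i]) f x).
split=> //; split.
  have [N [c [A [B [m [sc [lw E]]]]]]] := spanned_terms low.
  exists N, c, A, B, m; split=> //; split.
    by move=> i; apply: (@lower_degree_deg_lt n d s (A i, B i, m i)).
  move=> f /smooth_sfun[fs ->] x; rewrite /P extendE leading_part_eval.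
  exact: (congr1 (@^~ x) (E fs)).
split; first by move=> f _ x; rewrite addrC subrK.
split; first by move=> A B _; apply: smooth_funP.
split.
  move=> _; exists A0, B0; apply: contra_notP nz => H.
  apply: smooth_fun_eq => x; apply: contrapT => Vx; apply: H; exists x; split=> //.
split.
  by move=> k l _ x; split; [exact: symmetric_eval|exact: trace_free_eval].
have u0 (u : R[i]) k : u * u = -1 -> u ^+ k / k`!%:R != 0.
  move=> uu; rewrite mulf_neq0 ?expf_neq0 ?invr_eq0 ?pnatr_eq0 -?lt0n ?fact_gt0 //.
  by apply: contra_eq_neq uu => ->; rewrite mul0r eq_sym oppr_eq0 oner_eq0.
have ii : 'i * 'i = -1 :> R[i] by rewrite -expr2 sqrCi.
split.
  (* One step beyond the last component of V, which has d indices in total. *)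
  have Ed : (d + 1 - s = (d + 1 - 2 * s) + s)%N by lia.
  have ks : ((d + 1 - 2 * s) + 2 * s <= d.+1)%N by lia.
  have notlead k l : ((k + l)%N = d.+1) -> ~~ is_leading d s k l.
    by move=> kl; rewrite /is_leading kl ltnn.
  split; first by move=> x; apply: symmetric_eval.
  split; first by move=> x; apply: trace_free_eval.
  have [itA itB] := iters _ ks; rewrite Ed; split=> x.
    apply: (first_BGG_up (u := 'i ^+ (d + 1 - 2 * s) / (d + 1 - 2 * s)`!%:R)) => //.
      exact: u0.
    by move=> A B sA sB; apply: V0; apply: notlead; rewrite sA sB; lia.
  apply: (first_BGG_upbar (u := (- 'i) ^+ (d + 1 - 2 * s) / (d + 1 - 2 * s)`!%:R)) => //.
    by apply: u0; rewrite mulrNN.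
  by move=> A B sA sB; apply: V0; apply: notlead; rewrite sA sB; lia.
split=> k ks x; have [itA itB] := iters k (leqW ks).
  exact: trace_free_part_up.
exact: trace_free_part_upbar.
Qed.
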